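(* Let $f:\mathbb{T}^3\to\mathbb{T}^3$ be an absolutely partially hyperbolic diffeomorphism such that $E^s_f\oplus E^u_f$ is integrable, and let $h:\mathbb{T}^3\to\mathbb{T}^3$ be a homeomorphism with $h\circ f = A\circ h$, where $A:\mathbb{T}^3\to\mathbb{T}^3$ is a linear hyperbolic toral automorphism. Then $A$ is partially hyperbolic with a linear splitting such that $W^*_A = h(W^*_f)$ for $* = c, s, u, cs, cu, us$.
   Context: $f$ is absolutely partially hyperbolic if there is a $Tf$-invariant splitting $T\mathbb{T}^3 = E^s_f\oplus E^c_f\oplus E^u_f$ into one-dimensional bundles and constants $\sigma<1<\mu$ with $\|Tf v^s\|<\sigma<\|Tf v^c\|<\mu<\|Tf v^u\|$ for all unit vectors $v^*\in E^*_f$. Such $f$ on $\mathbb{T}^3$ is dynamically coherent, so there are invariant foliations $W^s_f, W^c_f, W^u_f, W^{cs}_f, W^{cu}_f$ tangent respectively to $E^s_f, E^c_f, E^u_f, E^c_f\oplus E^s_f, E^c_f\oplus E^u_f$; $W^{us}_f$ denotes the foliation tangent to $E^u_f\oplus E^s_f$. For $A$ with its linear partially hyperbolic splitting, $W^*_A$ denote the corresponding linear foliations. *)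

(* Defs.v *)
From HB Require Import structures.
From mathcomp Require Import all_boot all_order all_algebra.
From mathcomp Require Import algC.
From mathcomp Require Import all_classical all_reals all_analysis.

Set Implicit Arguments.
Unset Strict Implicit.
Unset Printing Implicit Defensive.

Import Order.TTheory GRing.Theory Num.Theory.
Import numFieldNormedType.Exports.

Local Open Scope classical_set_scope.
Local Open Scope ring_scope.

(* The torus T^3 = R^3 / Z^3 is handled through lifts: points of R^3 are
   row vectors 'rV[R]_3, and T(T^3) = T^3 x R^3 is trivialised by
   translation, so tangent vectors are also elements of 'rV[R]_3. *)

Section T3.
Variable R : realType.
Local Notation V := 'rV[R]_3.

Definition intvec (v : V) : Prop := forall i, v ord0 i \is a Num.int.

Definition torus_eq (x y : V) : Prop := intvec (x - y).

Definition torus_map (F : V -> V) : Prop :=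
  continuous F /\ forall x y, torus_eq x y -> torus_eq (F x) (F y).

Definition C1 (m n : nat) (F : 'rV[R]_m -> 'rV[R]_n) : Prop :=
  (forall x, differentiable F x) /\ (forall v, continuous (fun x => 'd F x v)).

Definition torus_homeo (H : V -> V) : Prop :=
  torus_map H /\ exists G, torus_map G /\
    forall x, torus_eq (G (H x)) x /\ torus_eq (H (G x)) x.

Definition torus_diffeo (F : V -> V) : Prop :=
  torus_map F /\ C1 F /\ exists G, torus_map G /\ C1 G /\
    forall x, torus_eq (G (F x)) x /\ torus_eq (F (G x)) x.

Definition riem_metric (g : V -> 'M[R]_3) : Prop :=
  continuous g /\ (forall x n, intvec n -> g (x + n) = g x) /\
  forall x, (g x)^T = g x /\
    forall v : V, v != 0 -> 0 < (v *m g x *m v^T) ord0 ord0.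

Definition gnorm (g : V -> 'M[R]_3) (x v : V) : R :=
  Num.sqrt ((v *m g x *m v^T) ord0 ord0).

(* a continuous line field on T^3, given by the orthogonal projection
   P x onto the line at x *)
Definition line_field (P : V -> 'M[R]_3) : Prop :=
  continuous P /\ (forall x n, intvec n -> P (x + n) = P x) /\
  forall x, (P x)^T = P x /\ P x *m P x = P x /\ \rank (P x) = 1%N.

Definition inF (P : V -> 'M[R]_3) : V -> set V := fun x v => v *m P x = v.

Definition sumF (E1 E2 : V -> set V) : V -> set V :=
  fun x v => exists a b, E1 x a /\ E2 x b /\ v = a + b.

Definition abs_PH (g : V -> 'M[R]_3) (F : V -> V)
    (Ps Pc Pu : V -> 'M[R]_3) : Prop :=
  [/\ line_field Ps /\ line_field Pc /\ line_field Pu,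
      (forall x v, exists a b c,
          inF Ps x a /\ inF Pc x b /\ inF Pu x c /\ v = a + b + c),
      ((forall x v, inF Ps x v -> inF Ps (F x) ('d F x v)) /\
       (forall x v, inF Pc x v -> inF Pc (F x) ('d F x v)) /\
       (forall x v, inF Pu x v -> inF Pu (F x) ('d F x v))) &
      exists sig mu : R, sig < 1 < mu /\
        forall x vs vc vu, inF Ps x vs -> inF Pc x vc -> inF Pu x vu ->
          gnorm g x vs = 1 -> gnorm g x vc = 1 -> gnorm g x vu = 1 ->
          [/\ gnorm g (F x) ('d F x vs) < sig,
              sig < gnorm g (F x) ('d F x vc),
              gnorm g (F x) ('d F x vc) < mu &
              mu < gnorm g (F x) ('d F x vu)]].

Definition chart (k : nat) := 'rV[R]_k -> 'rV[R]_(3 - k) -> V.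

Definition plaque k (phi : chart k) (p : V) : set V :=
  [set q | exists t0 t c, p = phi t0 c /\ q = phi t c].

Definition is_chart k (E : V -> set V) (phi : chart k) : Prop :=
  let Phi := fun pr : 'rV[R]_k * 'rV[R]_(3 - k) => phi pr.1 pr.2 in
  [/\ continuous Phi, injective Phi,
      (forall O, open O -> open (Phi @` O)) &
      forall c, C1 (fun t => phi t c) /\
        forall t, (forall v, 'd (fun t => phi t c) t v = 0 -> v = 0) /\
                  (forall v, E (phi t c) ('d (fun t => phi t c) t v))].

Inductive chain k (atl : V -> chart k) : V -> V -> Prop :=
| chain0 x : chain atl x x
| chainS i x y z : plaque (atl i) x y -> chain atl y z -> chain atl x z.

Definition leaf k (atl : V -> chart k) : V -> set V :=
  fun x => [set y | chain atl x y].

Definition is_foliation k (E : V -> set V) (atl : V -> chart k) : Prop :=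
  (forall x, is_chart E (atl x) /\ exists t c, atl x t c = x) /\
  (forall i j p n, intvec n ->
     (exists t c, atl i t c = p) -> (exists t c, atl j t c = p + n) ->
     exists e : R, 0 < e /\ forall q, `|q - p| < e ->
       (plaque (atl i) p q <-> plaque (atl j) (p + n) (q + n))).

(* full preimage in R^3 of the leaf of T^3 through the class of p *)
Definition TL (L : V -> set V) (p : V) : set V :=
  [set z | exists y, L p y /\ intvec (z - y)].

(* the torus map lifted by H sends the foliation with leaves L1 onto the
   foliation with leaves L2: h(L1(x)) = L2(h(x)) for every x *)
Definition maps_leaves (H : V -> V) (L1 L2 : V -> set V) : Prop :=
  forall x z, TL L2 (H x) z <-> exists y, L1 x y /\ intvec (z - H y).

Definition f_invariant (F : V -> V) (L : V -> set V) : Prop :=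
  maps_leaves F L L.

Definition constant_field (P : V -> 'M[R]_3) : Prop := forall x, P x = P 0.

Definition linleaf (E : V -> set V) : V -> set V := fun x y => E x (y - x).

Definition Alin (M : 'M[int]_3) : V -> V :=
  fun x => x *m map_mx (fun a : int => a%:~R) M.

End T3.

Definition hyperbolic_aut (M : 'M[int]_3) : Prop :=
  (\det M = 1 \/ \det M = -1) /\
  forall z : algC, eigenvalue (map_mx (fun a : int => a%:~R) M) z -> `|z| != 1.

(* Main.v *)
(* Everything is lifted to R^3 and row vectors are acted on by A from the right.
   A has a real eigenvalue r which is alone on its side of the unit circle;
   replacing (F, A) by the inverses and exchanging s and u, we may take
   |r| > 1, with r-eigenvector u and a complementary A-invariant plane
   {v | v z = 0} contracted by A. Curves tangent to E^u stay bounded under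
   backward iteration, so H maps them into lines parallel to u. Hence the image
   of the us-foliation is saturated by these lines, and the translates of one
   such line by Z^3 are dense: the image foliation is invariant under all
   translations, so it is a foliation by parallel planes {v | v n = 0}. The
   line {v | v z = v n = 0} is the A-invariant direction of the images of the
   stable leaves, and n is the dual eigenvector for the center eigenvalue.
   Comparing the growth of center curves with that of their images separates
   the moduli of the three eigenvalues; this identifies the center direction
   and the images of all the leaves. *)

Require Import Defs.
From HB Require Import structures.
From mathcomp Require Import all_boot all_order all_algebra.
From mathcomp Require Import algC.
From mathcomp Require Import all_classical all_reals all_analysis.
From mathcomp Require Import polyrcf ring lra.
Import Order.TTheory GRing.Theory Num.Theory.
Import numFieldNormedType.Exports.
Local Open Scope classical_set_scope.
Local Open Scope ring_scope.
Set Implicit Arguments.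
Unset Strict Implicit.
Unset Printing Implicit Defensive.

(** * Continuity and curves in normed spaces *)

(** The bundles are only continuous, so curves tangent to them need not be unique: a curve tangent
    to [E^s] or [E^u] inside a us-leaf, supplied by Peano's theorem, is not known to lie in a leaf
    of [Ws] or [Wu]. On the unstable side bounded backward orbits force every such curve into a line
    parallel to [u]. On the stable side this fails, because [A] contracts a whole plane; the
    substitute is the equivalence relation of being forward asymptotic at the stable rate, together
    with one rigidity: a center curve with asymptotic end points has equal end points. From it
    follow that [w0] is an eigenvector, that stable leaves go to its lines, and the lower bound on
    the center eigenvalue. Since [H] is merely a homeomorphism, growth is compared at large scale,
    where a uniformly continuous map expands distances at most affinely. Such comparisons involve
    orbits of different points, and this is where constants [sig] and [mu] common to all points
    enter. *)

Section Analysis.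
Variable R : realType.

Lemma mx_entry_le m n (M : 'M[R]_(m, n)) i j : `|M i j| <= `|M|.
Proof.
by rewrite [leRHS]/Num.Def.normr/= mx_normrE; exact: (le_bigmax _ _ (i, j)).
Qed.

Lemma mx_norm_le m n (M : 'M[R]_(m, n)) c :
  0 <= c -> (forall i j, `|M i j| <= c) -> `|M| <= c.
Proof.
move=> c0 h; rewrite [leLHS]/Num.Def.normr/= mx_normrE.
by apply: (bigmax_le _ c0) => -[i j] _; exact: h.
Qed.

Lemma rV_norm_le n (v : 'rV[R]_n) c :
  0 <= c -> (forall j, `|v ord0 j| <= c) -> `|v| <= c.
Proof. by move=> c0 h; apply: mx_norm_le => // i j; rewrite ord1. Qed.

Lemma rV_norm_attained n (v : 'rV[R]_n.+1) : exists j, `|v ord0 j| = `|v|.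
Proof.
case: (eqVneq v 0) => [->|v0]; first by exists ord0; rewrite mxE !normr0.
have : mx_norm v != 0 by rewrite -normr_eq0 in v0.
move=> /mx_norm_neq0 [[i j] /= E]; exists j.
by rewrite -[RHS]/(mx_norm v) E (ord1 i).
Qed.

Lemma mulmx_norm_le m n p (M : 'M[R]_(m, n)) (N : 'M[R]_(n, p)) :
  `|M *m N| <= n%:R * (`|M| * `|N|).
Proof.
apply: mx_norm_le => [|i j]; first by rewrite !mulr_ge0.
rewrite mxE (le_trans (ler_norm_sum _ _ _)) //.
have -> : n%:R * (`|M| * `|N|) = \sum_(k < n) (`|M| * `|N|).
  by rewrite sumr_const card_ord mulr_natl.
by apply: ler_sum => k _; rewrite normrM ler_pM // mx_entry_le.
Qed.

Lemma continuous_atP (V W : normedModType R) (f : V -> W) (x : V) :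
  {for x, continuous f} <->
  forall e : R, 0 < e -> exists2 d : R, 0 < d &
    forall y, `|y - x| < d -> `|f y - f x| < e.
Proof.
split=> [/cvgrPdist_lt fc e e0|h].
  have /nbhs_ballP[d /= d0 hd] := fc e e0; exists d => // y yx.
  by rewrite distrC; apply: hd; rewrite -ball_normE /ball_ /= distrC.
apply/cvgrPdist_lt => e e0; have [d d0 hd] := h e e0.
apply/nbhs_ballP; exists d => // y.
by rewrite -ball_normE /ball_ /= => yx; rewrite distrC; apply: hd; rewrite distrC.
Qed.

Lemma continuousP_eps (V W : normedModType R) (f : V -> W) : continuous f ->
  forall (x : V) (e : R), 0 < e -> exists2 d : R, 0 < d &
    forall y, `|y - x| < d -> `|f y - f x| < e.
Proof. by move=> fc x; apply/continuous_atP; exact: fc. Qed.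

Lemma openP_eps (V : normedModType R) (A : set V) : open A <->
  forall x, A x -> exists2 d : R, 0 < d & forall y, `|y - x| < d -> A y.
Proof.
rewrite openE; split=> h x Ax.
  have /nbhs_ballP[d /= d0 hd] := h x Ax; exists d => // y yx.
  by apply: hd; rewrite -ball_normE /ball_ /= distrC.
have [d d0 hd] := h x Ax; apply/nbhs_ballP; exists d => // y.
by rewrite -ball_normE /ball_ /= distrC; exact: hd.
Qed.

(** Connectedness of the line as a continuation principle: a property whose truth is locally
    constant in a real parameter passes from one parameter to all. Leaves, asymptotic classes and
    flatness are propagated in this way. *)
Lemma real_clopen (S : R -> Prop) (a : R) : S a ->
  (forall s, exists2 e : R, 0 < e & forall t, `|t - s| < e -> (S s <-> S t)) ->
  forall s, S s.
Proof.
move=> Sa loc.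
have oS : open [set s | S s].
  apply/openP_eps => s /= Ss; have [e e0 he] := loc s.
  by exists e => // t /he [h _]; exact: h.
have cS : closed [set s | S s].
  rewrite -openC; apply/openP_eps => s /= Ss; have [e e0 he] := loc s.
  by exists e => // t /he [_ h] /= St; apply: Ss; exact: h.
have conn : connected (setT : set R).
  by apply/connected_intervalP => x y _ _ z _.
have E : [set s | S s] = [set: R].
  by apply: conn; [exists a|exists [set s | S s] => //; rewrite setTI|
    exists [set s | S s] => //; rewrite setTI].
by move=> s; have : [set: R] s by []; rewrite -E.
Qed.

Lemma clamp_dist (a b s t : R) :
  `|Num.max a (Num.min b t) - Num.max a (Num.min b s)| <= `|t - s|.
Proof.
have H (x y : R) : x <= y ->
    0 <= Num.max a (Num.min b y) - Num.max a (Num.min b x) <= y - x.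
  move=> xy; have mn : 0 <= Num.min b y - Num.min b x <= y - x.
    by case: (leP b x) => ?; case: (leP b y) => ?; lra.
  move: mn; set u := Num.min b y; set v := Num.min b x => /andP[h1 h2].
  by case: (leP a u) => ?; case: (leP a v) => ?; lra.
case: (leP s t) => [st|/ltW st].
  by have /andP[h1 h2] := H _ _ st; rewrite !ger0_norm // subr_ge0.
have /andP[h1 h2] := H _ _ st; rewrite distrC (distrC t).
by rewrite !ger0_norm // subr_ge0.
Qed.

(** Precomposing with the 1-Lipschitz retraction of the line onto [[a, b]] reduces the segment to
    the whole line. *)
Lemma segment_clopen (S : R -> Prop) (a b c : R) : a <= c <= b -> S c ->
  (forall s, a <= s <= b -> exists2 e : R, 0 < e &
     forall t, a <= t <= b -> `|t - s| < e -> (S s <-> S t)) ->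
  forall s, a <= s <= b -> S s.
Proof.
move=> /andP[ac cb] Sc loc s /andP[sa sb].
pose cl x := Num.max a (Num.min b x).
have clE x : a <= x <= b -> cl x = x.
  by move=> /andP[? ?]; rewrite /cl min_r // max_r.
have ab : a <= b by apply: le_trans ac cb.
have clI x : a <= cl x <= b.
  by rewrite /cl le_max lexx /= ge_max ab ge_min lexx.
have := @real_clopen (S \o cl) c _ _ s; rewrite /= !clE ?ac ?cb ?sa ?sb //.
apply => // x; have [e e0 he] := loc _ (clI x); exists e => // t tx.
by apply: he => //; apply: le_lt_trans tx; exact: clamp_dist.
Qed.

Lemma is_derive_coord n (f : R -> 'rV[R]_n) (t : R) (d : 'rV[R]_n) j :
  is_derive t (1 : R) f d ->
  is_derive t (1 : R) (fun s => f s ord0 j) (d ord0 j).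
Proof.
move=> fd; have df : derivable f t (1 : R) by case: fd.
have /derivable_mxP dj := df; split; first exact: dj.
have -> : d = 'D_1 f t by case: fd.
by rewrite derive_mx // mxE.
Qed.

Lemma is_derive_continuous (V : normedModType R) (f : R -> V) (t : R) d :
  is_derive t (1 : R) f d -> {for t, continuous f}.
Proof.
move=> fd; apply: differentiable_continuous.
by apply/derivable1_diffP; case: fd.
Qed.

Lemma within_continuous_segment (f : R -> R) (a b : R) :
  (forall t, a <= t <= b -> {for t, continuous f}) ->
  {within `[a, b], continuous f}.
Proof.
move=> fc; apply: continuous_in_subspaceT => t; rewrite inE /= in_itv /=.
exact: fc.
Qed.

Lemma derive_sub_le (f g f' g' : R -> R) (a b : R) : a <= b ->
  (forall t, a <= t <= b -> is_derive t (1 : R) f (f' t)) ->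
  (forall t, a <= t <= b -> is_derive t (1 : R) g (g' t)) ->
  (forall t, a <= t <= b -> f' t <= g' t) -> f b - f a <= g b - g a.
Proof.
move=> ab df dg le.
have itv t : t \in `]a, b[ -> a <= t <= b.
  by rewrite in_itv /= => /andP[/ltW -> /ltW ->].
have dh t : a <= t <= b -> is_derive t (1 : R) (g \- f) (g' t - f' t).
  by move=> tab; have := df t tab; have := dg t tab => ? ?; exact: is_deriveB.
have [|c cab E] := MVT_segment ab (fun t tab => dh t (itv t tab)).
  by apply: within_continuous_segment => t /dh; exact: is_derive_continuous.
have : 0 <= (g b - f b) - (g a - f a).
  move: E => /= ->; apply: mulr_ge0; rewrite subr_ge0 //.
  by apply: le; move: cab; rewrite in_itv.
by lra.
Qed.

(** The norm of a row is the maximum of its coordinates, so the scalar comparison, applied to each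
    coordinate and to its opposite, gives the vector inequality without loss. *)
Lemma curve_mvt n (f f' : R -> 'rV[R]_n) (g g' : R -> R) (a b : R) : a <= b ->
  (forall t, a <= t <= b -> is_derive t (1 : R) f (f' t)) ->
  (forall t, a <= t <= b -> is_derive t (1 : R) g (g' t)) ->
  (forall t, a <= t <= b -> `|f' t| <= g' t) -> `|f b - f a| <= g b - g a.
Proof.
move=> ab df dg le.
have h0 : 0 <= g b - g a.
  have := derive_sub_le ab (fun t _ => is_derive_cst (0 : R) t 1) dg.
  by rewrite subrr; apply => t /le; apply: le_trans.
apply: rV_norm_le => // j; rewrite !mxE ler_norml; apply/andP; split.
  have dn t : a <= t <= b ->
      is_derive t (1 : R) (fun s => - f s ord0 j) (- f' t ord0 j).
    by move=> tab; have ? := is_derive_coord j (df t tab); exact: is_deriveN.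
  suff: - f b ord0 j - - f a ord0 j <= g b - g a by lra.
  apply: (derive_sub_le ab dn dg) => t tab; apply: le_trans (le t tab).
  by apply: le_trans (mx_entry_le _ ord0 j); rewrite -normrN ler_norm.
apply: (derive_sub_le ab (fun t tab => is_derive_coord j (df t tab)) dg).
move=> t tab; apply: le_trans (le t tab).
by apply: le_trans (mx_entry_le _ ord0 j); rewrite ler_norm.
Qed.

End Analysis.

(** * The torus *)

Section Torus.
Variable R : realType.
Local Notation V := 'rV[R]_3.

Lemma intvec0 : intvec (0 : V).
Proof. by move=> i; rewrite mxE rpred0. Qed.

Lemma intvecD (x y : V) : intvec x -> intvec y -> intvec (x + y).
Proof. by move=> hx hy i; rewrite mxE rpredD. Qed.

Lemma intvecN (x : V) : intvec x -> intvec (- x).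
Proof. by move=> hx i; rewrite mxE rpredN. Qed.

Lemma intvecB (x y : V) : intvec x -> intvec y -> intvec (x - y).
Proof. by move=> hx hy; apply: intvecD => //; exact: intvecN. Qed.

Lemma intvec_mul (x : V) (M : 'M[int]_3) :
  intvec x -> intvec (x *m map_mx (fun a : int => a%:~R) M).
Proof.
move=> hx i; rewrite mxE rpred_sum // => j _.
by rewrite mxE rpredM // rpred_int.
Qed.

Lemma intvec_floor (x : V) : exists2 n : V, intvec n &
  forall i, 0 <= (x - n) ord0 i <= 1.
Proof.
exists (\row_i (Num.floor (x ord0 i))%:~R) => i; first by rewrite mxE rpred_int.
rewrite !mxE; have := ge_floor (x ord0 i).
have := ltW (floorD1_gt (x ord0 i)).
by rewrite intrD; lra.
Qed.

Lemma cube_compact : compact [set x : V | forall i, 0 <= x ord0 i <= 1].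
Proof.
apply: bounded_closed_compact.
  exists 1; split; first exact: num_real.
  move=> r r1 x /= hx; apply: rV_norm_le => [|j].
    by rewrite (le_trans _ (ltW r1)).
  have /andP[? ?] := hx j.
  by rewrite ger0_norm // (le_trans _ (ltW r1)).
rewrite -openC; apply/openP_eps => x /= hx.
move: hx => /existsNP[i /negP hi].
exists (Num.max (- x ord0 i) (x ord0 i - 1)).
  by rewrite lt_max oppr_gt0 subr_gt0; case: ltP hi => //= ?; rewrite -ltNge.
move=> y yx hy; have := le_lt_trans (mx_entry_le _ ord0 i) yx.
have := hy i; rewrite !mxE ltr_norml lt_max.
by case: (leP (- x ord0 i) (x ord0 i - 1)) hi => ? hi /andP[? ?]; move: hi;
  rewrite negb_and -!ltNge => /orP[] ? /andP[]; lra.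
Qed.

(** Compactness of the torus: [Q] is monotone in [a] and invariant under integer translations, so
    local radii over the unit cube yield one radius for all of R^3. *)
Lemma periodic_uniform (Q : R -> V -> Prop) :
  (forall x, exists2 a, 0 < a & exists2 d, 0 < d &
     forall y, `|y - x| < d -> Q a y) ->
  (forall a b y, 0 < b <= a -> Q a y -> Q b y) ->
  (forall a y n, intvec n -> Q a y -> Q a (y + n)) ->
  exists2 a, 0 < a & forall y, Q a y.
Proof.
move=> loc mono per.
have /compact_near_coveringP := cube_compact.
move=> /(_ R 0^'+ Q _) [x _|e e0 h].
  have [a a0 [d d0 h]] := loc x.
  exists ([set y | `|y - x| < d], [set b | 0 < b <= a]) => /=; last first.
    by move=> [y b] /= [yx ba]; apply: mono ba _; exact: h.
  split; first by apply/nbhs_ballP; exists d => //= y;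
    rewrite -ball_normE /ball_ /= distrC.
  exists a => //= b; rewrite /= sub0r normrN => + b0.
  by rewrite gtr0_norm // b0 => /ltW ->.
exists (e / 2); first by rewrite divr_gt0.
move=> y; have [n n_int hy] := intvec_floor y.
rewrite -(subrK n y); apply: per => //; apply: h => //=.
  by rewrite sub0r normrN gtr0_norm ?divr_gt0 //; rewrite ltr_pdivrMr // ltr_pMr // ltr1n.
by rewrite divr_gt0.
Qed.

(** Distinct integer vectors are at distance at least 1, so [f] is locally constant along each ray
    from 0. This turns congruences modulo Z^3 between lifts into equalities up to one fixed integer
    vector. *)
Lemma int_continuous_cst (f : V -> V) : continuous f ->
  (forall x, intvec (f x)) -> forall x y, f x = f y.
Proof.
move=> fc fi; suff H x : f x = f 0 by move=> x y; rewrite H (H y).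
pose S (s : R) := f (s *: x) = f 0.
suff : S 1 by rewrite /S scale1r.
apply: (@real_clopen R S 0); first by rewrite /S scale0r.
move=> s; have [d d0 hd] := continuousP_eps fc (s *: x) (@ltr01 R).
exists (d / (`|x| + 1)) => [|t ts]; first by rewrite divr_gt0 // ltr_wpDl.
suff -> : S s = S t by [].
rewrite /S; suff -> : f (t *: x) = f (s *: x) by [].
have /hd h1 : `|t *: x - s *: x| < d.
  rewrite -scalerBl normrZ.
  move: ts; rewrite ltr_pdivlMr ?ltr_wpDl // => /(le_lt_trans _); apply.
  by rewrite ler_wpM2l // lerDl.
apply/eqP; rewrite -subr_eq0; apply/eqP/rowP => i.
have := intvecB (fi (t *: x)) (fi (s *: x)) i.
move=> /intrP [m em]; rewrite em [RHS]mxE.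
have := le_lt_trans (mx_entry_le _ ord0 i) h1; rewrite em.
by rewrite -intr_norm ltrz1; case: m {em} => [[|k]|k].
Qed.

End Torus.

Ltac vec_ring := apply/rowP => ?; rewrite !mxE; ring.

(** * Lifts of torus maps and of the conjugacy *)

Section TorusMaps.
Variable R : realType.
Local Notation V := 'rV[R]_3.

Lemma cont_comp (U V W : normedModType R) (f : U -> V) (g : V -> W) :
  continuous f -> continuous g -> continuous (fun x => g (f x)).
Proof. by move=> fc gc x; exact: (continuous_comp (fc x) (gc (f x))). Qed.

Lemma cont_sub (U V : normedModType R) (f g : U -> V) :
  continuous f -> continuous g -> continuous (fun x => f x - g x).
Proof. by move=> fc gc x; exact: (continuousB (fc x) (gc x)). Qed.

Lemma cont_id (U : normedModType R) : continuous (fun x : U => x).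
Proof. by move=> x; exact: cvg_id. Qed.

Lemma cont_shift (U : normedModType R) (n : U) : continuous (fun x => x + n).
Proof.
by move=> x; apply: (continuousD (cont_id (x:=x))); exact: cst_continuous.
Qed.

Definition unif_cont (f : V -> V) := forall e : R, 0 < e ->
  exists2 d : R, 0 < d & forall x y, `|x - y| < d -> `|f x - f y| < e.

(** Here [k] depends on [n] but not on [x]; sending [n] to [k] is the action of the torus map on the
    fundamental group. *)
Definition int_equivariant (f : V -> V) := forall n, intvec n ->
  exists2 k, intvec k & forall x, f (x + n) = f x + k.

Lemma torus_map_equivariant (f : V -> V) : torus_map f -> int_equivariant f.
Proof.
move=> [fc ft] n n_int; pose h x := f (x + n) - f x.
have hi x : intvec (h x).
  by apply: ft; rewrite /torus_eq addrC addKr.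
exists (h 0) => // x; rewrite -(@int_continuous_cst R h _ hi x 0).
  by rewrite /h [RHS]addrC subrK.
apply: cont_sub => //; apply: cont_comp fc; exact: cont_shift.
Qed.

(** The difference [f x - f y] is unchanged when both points move by the same integer vector, so the
    modulus of continuity is periodic. *)
Lemma equivariant_unif_cont (f : V -> V) :
  continuous f -> int_equivariant f -> unif_cont f.
Proof.
move=> fc fe e e0.
have e20 : 0 < e / 2 by rewrite divr_gt0.
have [x|a b y /andP[b0 ba] + z zy|a y n n_int hy z zy|a a0 h] :=
  @periodic_uniform R (fun a x => forall y, `|y - x| < a -> `|f y - f x| < e).
- have [d d0 hd] := continuousP_eps fc x e20.
  exists (d / 2); first by rewrite divr_gt0.
  exists (d / 2) => [|y yx z zy]; first by rewrite divr_gt0.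
  have yx' : `|y - x| < d by lra.
  have zx : `|z - x| < d.
    by rewrite -(subrKA y); apply: le_lt_trans (ler_normD _ _) _; lra.
  rewrite -(subrKA (f x)); apply: le_lt_trans (ler_normD _ _) _.
  by have := hd _ yx'; have := hd _ zx; rewrite (distrC (f x)); lra.
- by apply; apply: lt_le_trans zy ba.
- have [k _ hk] := fe n n_int.
  have -> : z = (z - n) + n by rewrite subrK.
  rewrite !hk opprD addrACA subrr addr0; apply: hy.
  by suff -> : z - n - y = z - (y + n) by []; vec_ring.
by exists a => // x y; exact: h.
Qed.

(** Lifts of inverse torus maps are inverse only up to an integer translation; subtracting that
    constant from [g] makes them inverse on R^3. *)
Lemma torus_inverse (f g : V -> V) : torus_map f -> torus_map g ->
  (forall x, torus_eq (g (f x)) x /\ torus_eq (f (g x)) x) ->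
  exists2 k, intvec k & cancel f (fun y => g y - k) /\
                        cancel (fun y => g y - k) f.
Proof.
move=> ft gt gf; have [fc _] := ft; have [gc _] := gt.
have c1 x : g (f x) - x = g (f 0) - 0.
  apply: (@int_continuous_cst R (fun x => g (f x) - x)) => [|y].
    by apply: cont_sub; [|exact: cont_id]; exact: cont_comp fc gc.
  by case: (gf y).
have c2 x : f (g x) - x = f (g 0) - 0.
  apply: (@int_continuous_cst R (fun x => f (g x) - x)) => [|y].
    by apply: cont_sub; [|exact: cont_id]; exact: cont_comp gc fc.
  by case: (gf y).
exists (g (f 0) - 0); first by case: (gf 0).
have fK : cancel f (fun y => g y - (g (f 0) - 0)).
  by move=> x; rewrite -(c1 x) opprB addrC subrK.
split=> // y; set k2 := f (g 0) - 0.
(* [f] after [g] is the translation by [k2], so [f] is onto and its left inverse is two-sided. *)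
have -> : y = f (g (y - k2)) by rewrite -(subrK (y - k2) (f _)) c2 -/k2 addrC subrK.
by rewrite fK.
Qed.

Lemma mulmx_continuous (N : 'M[R]_3) : continuous (fun v : V => v *m N).
Proof.
move=> x; apply/continuous_atP => e e0.
exists (e / (3 * (`|N| + 1))) => [|y].
  by rewrite divr_gt0 // mulr_gt0 // ltr_wpDl.
rewrite ltr_pdivlMr ?mulr_gt0 ?ltr_wpDl // => h.
rewrite -mulmxBl; apply: le_lt_trans (mulmx_norm_le _ _) _.
apply: le_lt_trans h; rewrite mulrCA ler_wpM2l // ler_wpM2l //.
by rewrite lerDl.
Qed.

(** The defect of the lifted conjugacy is continuous and integer-valued, hence constant, and
    disappears from differences. *)
Lemma semiconj_diff (F H : V -> V) (M : 'M[int]_3) :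
  torus_map F -> torus_map H ->
  (forall x, torus_eq (H (F x)) (Alin M (H x))) ->
  forall x y, H (F x) - H (F y) =
    (H x - H y) *m map_mx (fun a : int => a%:~R) M.
Proof.
move=> [Fc _] [Hc _] h x y.
have E : H (F x) - Alin M (H x) = H (F y) - Alin M (H y).
  apply: (@int_continuous_cst R (fun x => H (F x) - Alin M (H x))) => //.
  apply: cont_sub; first exact: cont_comp Fc Hc.
  by apply: cont_comp Hc _; exact: mulmx_continuous.
rewrite mulmxBl -[X in X = _](subrKA (Alin M (H x))) E /Alin.
by move: (H (F y)) (_ *m _) (_ *m _) => a b c; vec_ring.
Qed.
End TorusMaps.

(** * Curves tangent to a line field *)

Section Curves.
Variable R : realType.
Local Notation V := 'rV[R]_3.

Lemma is_derive_comp_curve m n (Q : 'rV[R]_m -> 'rV[R]_n) (c : R -> 'rV[R]_m)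
    (t : R) v : differentiable Q (c t) -> is_derive t (1 : R) c v ->
  is_derive t (1 : R) (fun s => Q (c s)) ('d Q (c t) v).
Proof.
move=> dQ dc; have /derivable1_diffP diffc : derivable c t (1 : R) by case: dc.
have diffQc : differentiable (Q \o c) t by apply: differentiable_comp.
split; first exact/derivable1_diffP.
have -> : (fun s => Q (c s)) = Q \o c by [].
rewrite deriveE // diff_comp //=; congr ('d Q _ _).
by rewrite -deriveE //; case: dc.
Qed.

Lemma diff_row_sum m n (Q : 'rV[R]_m -> 'rV[R]_n) x (v : 'rV[R]_m) :
  'd Q x v = \sum_i v ord0 i *: 'd Q x (delta_mx ord0 i).
Proof.
rewrite {1}(row_sum_delta v) linear_sum; apply: eq_bigr => i _.
by rewrite linearZ.
Qed.

Lemma continuous_sum_at (U W : normedModType R) (I : Type) (r : seq I)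
    (f : I -> U -> W) (t : U) : (forall i, {for t, continuous (f i)}) ->
  {for t, continuous (fun s => \sum_(i <- r) f i s)}.
Proof.
move=> fc; elim: r => [|i r IH].
  have -> : (fun s => \sum_(i <- [::]) f i s) = (fun _ => 0).
    by apply/funext => s; rewrite big_nil.
  exact: cst_continuous.
have -> : (fun s => \sum_(j <- i :: r) f j s) =
    (fun s => f i s + \sum_(j <- r) f j s).
  by apply/funext => s; rewrite big_cons.
exact: (continuousD (fc i) IH).
Qed.

Lemma coord_continuous_at n (c : R -> 'rV[R]_n) (t : R) i :
  {for t, continuous c} -> {for t, continuous (fun s => c s ord0 i)}.
Proof.
by move=> cc; exact: (continuous_comp cc (@coord_continuous R 1 n ord0 i (c t))).
Qed.

(** [C1] provides continuity in the base point for each fixed vector; expanding on the standard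
    basis lets the vector vary as well. *)
Lemma continuous_diff_along m n (Q : 'rV[R]_m -> 'rV[R]_n)
    (c c' : R -> 'rV[R]_m) (t : R) : C1 Q ->
  {for t, continuous c} -> {for t, continuous c'} ->
  {for t, continuous (fun s => 'd Q (c s) (c' s))}.
Proof.
move=> [_ Qc] cc cc'.
have -> : (fun s => 'd Q (c s) (c' s)) =
    (fun s => \sum_i c' s ord0 i *: 'd Q (c s) (delta_mx ord0 i)).
  by apply/funext => s; exact: diff_row_sum.
apply: continuous_sum_at => i; apply: cvgZ.
  exact: (@coord_continuous_at _ _ t i cc').
exact: (continuous_comp cc (Qc _ _)).
Qed.

(** A regular curve with its velocity carried along as [c']. Derivatives are two-sided even at [a]
    and [b], so restriction to a smaller segment is immediate. *)
Definition tcurve (E : V -> set V) (c c' : R -> V) (a b : R) :=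
  forall t, a <= t <= b ->
    [/\ is_derive t (1 : R) c (c' t), {for t, continuous c'},
        E (c t) (c' t) & c' t != 0].

Lemma tcurve_sub E c c' a b a1 b1 : a <= a1 -> b1 <= b ->
  tcurve E c c' a b -> tcurve E c c' a1 b1.
Proof.
move=> aa bb h t /andP[at1 tb]; apply: h.
by rewrite (le_trans aa at1) (le_trans tb bb).
Qed.

Lemma tcurve_weaken (E E' : V -> set V) c c' a b :
  (forall x v, E x v -> E' x v) -> tcurve E c c' a b -> tcurve E' c c' a b.
Proof. by move=> EE h t /h[? ? /EE ? ?]. Qed.

Lemma tcurve_shift (E : V -> set V) c c' a b n :
  (forall x v, E x v -> E (x + n) v) ->
  tcurve E c c' a b -> tcurve E (fun t => c t + n) c' a b.
Proof.
move=> Eper h t tab; have [dc cc Ec c0] := h t tab; split=> //.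
  by have := is_deriveD dc (is_derive_cst n t (1 : R)); rewrite addr0.
exact: Eper.
Qed.

Lemma tcurve_continuous E c c' a b t : tcurve E c c' a b -> a <= t <= b ->
  {for t, continuous c}.
Proof. by move=> h /h[+ _ _ _]; exact: is_derive_continuous. Qed.

Lemma tcurve_map (E : V -> set V) c c' a b (Q : V -> V) : C1 Q ->
  (forall x v, E x v -> E (Q x) ('d Q x v)) ->
  (forall x v, 'd Q x v = 0 -> v = 0) ->
  tcurve E c c' a b ->
  tcurve E (fun t => Q (c t)) (fun t => 'd Q (c t) (c' t)) a b.
Proof.
move=> QC QE Qinj h t tab; have [dc cc Ec c0] := h t tab.
split.
- by apply: is_derive_comp_curve dc; case: QC.
- exact: (continuous_diff_along QC (tcurve_continuous h tab) cc).
- exact: QE.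
- by apply: contra_neq c0; exact: Qinj.
Qed.

(** [C] is chosen before [Q] and [k]: one constant of the curve serves all iterates of a map. *)
Lemma tcurve_growth (E : V -> set V) c c' a b : a <= b -> tcurve E c c' a b ->
  exists2 C : R, 0 <= C & forall (Q : V -> V) (k : R),
    (forall x, differentiable Q x) ->
    (forall t, a <= t <= b -> `|'d Q (c t) (c' t)| <= k * `|c' t|) -> 0 <= k ->
    `|Q (c b) - Q (c a)| <= k * C.
Proof.
move=> ab h.
have nc : {within `[a, b], continuous (fun t => `|c' t|)}.
  apply: within_continuous_segment => t /h[_ cc _ _].
  exact: (continuous_comp cc (@norm_continuous _ _ _)).
have [m _ hm] := EVT_max ab nc.
exists (`|c' m| * (b - a)); first by rewrite mulr_ge0 // subr_ge0.
move=> Q k dQ Qk k0.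
have -> : k * (`|c' m| * (b - a)) =
  (k * `|c' m|) *: b - (k * `|c' m|) *: a by rewrite /GRing.scale /=; ring.
apply: (@curve_mvt R 3 (fun t => Q (c t)) (fun t => 'd Q (c t) (c' t))
  (fun t => (k * `|c' m|) *: t) (fun t => k * `|c' m|)) => // t tab.
- by apply: is_derive_comp_curve => //; case: (h t tab).
- by have := is_deriveZ (k * `|c' m|) (is_derive_id t (1 : R));
    rewrite /GRing.scale /= mulr1.
apply: le_trans (Qk _ tab) _; rewrite ler_wpM2l //.
by apply: hm; rewrite in_itv.
Qed.

(** At a uniform scale the lines hardly turn, so a single coordinate carries at least half of the
    norm of every tangent vector near [x]. *)
Lemma line_field_cone (P : V -> 'M[R]_3) : line_field P ->
  exists2 d0 : R, 0 < d0 & forall x, exists i : 'I_3,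
    forall y, `|y - x| < d0 -> forall v, inF P y v -> `|v| <= 2 * `|v ord0 i|.
Proof.
move=> [Pc [Pper Pproj]].
have [x|a b y /andP[b0 ba] [i hi]|a y n n_int [i hi]|a a0 h] := @periodic_uniform R
  (fun a x => exists i : 'I_3, forall y, `|y - x| < a ->
     forall v, inF P y v -> `|v| <= 2 * `|v ord0 i|); last by exists a.
- have [_ [_ rk]] := Pproj x.
  (* The factor 3 of [mulmx_norm_le] turns 1/12 into 1/4, and [1 - 1/4 - 1/4] is the half that is
     wanted. *)
  have [d d0 hd] := continuousP_eps Pc x (e := 1/12) ltac:(lra).
  pose v0 := nz_row (P x).
  have v00 : v0 != 0 by rewrite nz_row_eq0 -mxrank_eq0 rk.
  have [i hi] := rV_norm_attained v0.
  have line (v : V) : `|v *m P x| = `|(v *m P x) ord0 i|.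
    have /sub_rVP[a ->] : (v *m P x <= v0)%MS.
      apply: submx_trans (submxMl _ _) _.
      have := mxrank_leqif_eq (nz_row_sub (P x)).
      by rewrite -/v0 rk rank_rV v00 => -[_ /esym /andP[]].
    by rewrite normrZ mxE normrM hi.
  exists (d / 2); first by rewrite divr_gt0.
  exists (d / 2); first by rewrite divr_gt0.
  move=> y yx; exists i => z zy v vz.
  have zx : `|z - x| < d.
    by rewrite -(subrKA y); apply: le_lt_trans (ler_normD _ _) _; lra.
  have h1 : `|v - v *m P x| <= 1/4 * `|v|.
    rewrite -{1}vz -mulmxBr; apply: le_trans (mulmx_norm_le _ _) _.
    by have := hd _ zx; have : 0 <= `|v| by []; nra.
  have h2 := mx_entry_le (v - v *m P x) ord0 i.
  have h3 : `|v| <= `|v - v *m P x| + `|v *m P x|.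
    by rewrite -{1}(subrK (v *m P x) v) ler_normD.
  have h4 : `|(v *m P x) ord0 i| <= `|(v - v *m P x) ord0 i| + `|v ord0 i|.
    have -> : (v *m P x) ord0 i = - (v - v *m P x) ord0 i + v ord0 i.
      by move: (v *m P x) => w; rewrite !mxE; ring.
    by apply: le_trans (ler_normD _ _) _; rewrite normrN.
  by move: h3; rewrite line; lra.
- by exists i => z zy; apply: hi; apply: lt_le_trans zy ba.
exists i => z zy v; have -> : z = (z - n) + n by rewrite subrK.
rewrite /inF Pper // => vz; apply: hi vz.
by suff -> : z - n - y = z - (y + n) by []; vec_ring.
Qed.

Lemma continuous_sign (f : R -> R) (a b : R) : a <= b ->
  (forall t, a <= t <= b -> {for t, continuous f}) ->
  (forall t, a <= t <= b -> f t != 0) ->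
  (forall t, a <= t <= b -> 0 < f t) \/ (forall t, a <= t <= b -> f t < 0).
Proof.
move=> ab fc f0.
have loc s : a <= s <= b -> exists2 e : R, 0 < e & forall t, a <= t <= b ->
    `|t - s| < e -> (0 < f s <-> 0 < f t).
  move=> sab; have := fc s sab => /continuous_atP/(_ `|f s|).
  rewrite normr_gt0 f0 // => /(_ isT)[d d0 hd]; exists d => // t tab /hd.
  by case: (ltrgt0P (f s)); rewrite ltr_norml => ? /andP[]; split; lra.
have [fa|fa] := ltP 0 (f a).
  left; apply: (@segment_clopen R (fun t => 0 < f t) a b a) => //.
  by rewrite lexx.
right; suff H t : a <= t <= b -> f t <= 0.
  by move=> t tab; rewrite lt_neqAle f0 // H.
move=> tab; suff : ~ 0 < f t by move/negP; rewrite -leNgt.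
apply: (@segment_clopen R (fun t => ~ 0 < f t) a b a) => //.
- by rewrite lexx.
- by move=> h; lra.
by move=> s /loc[e e0 h]; exists e => // u uab us; have := h u uab us; tauto.
Qed.

(** A short tangent curve cannot fold back: its dominant coordinate has a nonvanishing derivative,
    hence is monotone. The increment of [Q] is therefore controlled by the chord of the curve rather
    than by its length. *)
Lemma tcurve_chord (P : V -> 'M[R]_3) : line_field P ->
  exists2 d0 : R, 0 < d0 & forall c c' a b, a <= b ->
    tcurve (inF P) c c' a b ->
    (forall t, a <= t <= b -> `|c t - c a| < d0) ->
    forall (Q : V -> V) (k : R), (forall x, differentiable Q x) -> 0 <= k ->
      (forall x v, inF P x v -> `|'d Q x v| <= k * `|v|) ->
      `|Q (c b) - Q (c a)| <= 2 * k * `|c b - c a|.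
Proof.
move=> /line_field_cone[d0 d00 hd0]; exists d0 => // c c' a b ab h small Q k dQ k0 Qk.
have [i hi] := hd0 (c a).
have ci t : a <= t <= b -> `|c' t| <= 2 * `|c' t ord0 i|.
  by move=> tab; case: (h t tab) => _ _ Ec _; apply: hi (small t tab) _ Ec.
have dci t : a <= t <= b -> is_derive t (1 : R) (fun s => c s ord0 i) (c' t ord0 i).
  by move=> tab; case: (h t tab) => dc _ _ _; exact: is_derive_coord.
have dQc t : a <= t <= b ->
    is_derive t (1 : R) (fun s => Q (c s)) ('d Q (c t) (c' t)).
  by move=> tab; apply: is_derive_comp_curve => //; case: (h t tab).
have bnd t : a <= t <= b -> `|'d Q (c t) (c' t)| <= (2 * k) * `|c' t ord0 i|.
  move=> tab; case: (h t tab) => _ _ /Qk h1 _; apply: le_trans h1 _.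
  by rewrite -mulrA mulrCA ler_wpM2l // ci.
have K0 : 0 <= 2 * k by rewrite mulr_ge0.
have dl (e : R) t : a <= t <= b -> is_derive t (1 : R)
    (fun s => e * c s ord0 i) (e * c' t ord0 i).
  by move=> tab; have ? := dci t tab; exact: is_deriveZ.
have fin (e : R) : `|e| = 1 -> (forall t, a <= t <= b ->
    `|c' t ord0 i| = e * c' t ord0 i) ->
    `|Q (c b) - Q (c a)| <= 2 * k * `|c b - c a|.
  move=> e1 He.
  have bnd' t : a <= t <= b -> `|'d Q (c t) (c' t)| <= 2 * k * e * c' t ord0 i.
    by move=> tab; apply: le_trans (bnd t tab) _; rewrite -(mulrA (2 * k)) -He.
  apply: le_trans (curve_mvt ab dQc (dl (2 * k * e)) bnd') _.
  rewrite -mulrBr -(mulrA (2 * k))  ler_wpM2l //.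
  apply: le_trans (mx_entry_le _ ord0 i).
  by rewrite !mxE; apply: le_trans (ler_norm _) _; rewrite normrM e1 mul1r.
have [||pos|neg] := @continuous_sign (fun t => c' t ord0 i) a b ab.
- move=> t /h[_ cc _ _].
  exact: coord_continuous_at.
- move=> t tab; case: (h t tab) => _ _ _; apply: contra_neq => z.
  apply/eqP; rewrite -normr_le0; apply: le_trans (ci t tab) _.
  by rewrite z normr0 mulr0.
- by apply: (fin 1); rewrite ?normr1 // => t /pos p; rewrite mul1r gtr0_norm.
by apply: (fin (-1)); rewrite ?normrN1 // => t /neg p; rewrite mulN1r ltr0_norm.
Qed.

End Curves.

(** * Leaves and plaques *)

Section InjCover.
Variable R : realType.

Lemma segment_inj_between (f : R -> R) (a c b : R) : a < c < b ->
  (forall t, a <= t <= b -> {for t, continuous f}) ->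
  (forall s t, a <= s <= b -> a <= t <= b -> f s = f t -> s = t) ->
  (f a < f c < f b) \/ (f b < f c < f a).
Proof.
move=> /andP[ac cb] fc finj.
have ab := ltW (lt_trans ac cb).
have wc := within_continuous_segment fc.
have fi : {in `[a, b] &, injective f}.
  by move=> s t; rewrite !in_itv /=; exact: finj.
have ia : a \in `[a, b] by rewrite in_itv /= lexx.
have ib : b \in `[a, b] by rewrite in_itv /= lexx ab.
have ic : c \in `[a, b] by rewrite in_itv /= (ltW ac) (ltW cb).
case: (itv_continuous_inj_mono wc fi) => mono; [left|right].
  by rewrite !mono.
by rewrite !mono.
Qed.

Lemma segment_ivt (f : R -> R) (a b y : R) : a <= b ->
  (forall t, a <= t <= b -> {for t, continuous f}) ->
  f a <= y <= f b \/ f b <= y <= f a ->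
  exists2 t, a <= t <= b & f t = y.
Proof.
move=> ab fc h.
have [|t] := IVT ab (within_continuous_segment fc) (v := y).
  case: h => /andP[h1 h2]; rewrite ge_min le_max.
    by rewrite h1 h2 orbT.
  by rewrite h1 h2 orbT.
by rewrite in_itv /= => tab <-; exists t.
Qed.

(** Invariance of domain in dimension one: the value at an interior point is interior to the
    image. *)
Lemma segment_inj_cover (f : R -> R) (a c b : R) : a < c < b ->
  (forall t, a <= t <= b -> {for t, continuous f}) ->
  (forall s t, a <= s <= b -> a <= t <= b -> f s = f t -> s = t) ->
  exists2 e : R, 0 < e & forall y, `|y - f c| < e ->
    exists2 t, a <= t <= b & f t = y.
Proof.
move=> acb fc finj; have ab : a <= b by move: acb => /andP[? ?]; lra.
have btw := segment_inj_between acb fc finj.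
exists (Num.min `|f a - f c| `|f b - f c|).
  by rewrite lt_min !normr_gt0 !subr_eq0; case: btw => /andP[? ?];
    apply/andP; split; apply/eqP; lra.
move=> y; rewrite lt_min => /andP[ya yb]; apply: segment_ivt => //.
case: btw => /andP[h1 h2]; [left|right]; move: ya yb.
  rewrite (@ltr0_norm _ (f a - f c)) ?subr_lt0 // (@gtr0_norm _ (f b - f c)) ?subr_gt0 //.
  by rewrite !ltr_norml => /andP[? ?] /andP[? ?]; apply/andP; split; lra.
rewrite (@gtr0_norm _ (f a - f c)) ?subr_gt0 // (@ltr0_norm _ (f b - f c)) ?subr_lt0 //.
by rewrite !ltr_norml => /andP[? ?] /andP[? ?]; apply/andP; split; lra.
Qed.

End InjCover.

Section MoreContinuity.
Variable R : realType.

Lemma cont_pair (U V W : normedModType R) (f : U -> V) (g : U -> W) :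
  continuous f -> continuous g -> continuous (fun x => (f x, g x)).
Proof.
move=> fc gc x; apply/continuous_atP => e e0.
have [d d0 hd] := continuousP_eps fc x e0.
have [d' d'0 hd'] := continuousP_eps gc x e0.
exists (Num.min d d') => [|y]; first by rewrite lt_min d0.
by rewrite lt_min prod_normE gt_max => /andP[/hd -> /hd' ->].
Qed.

Lemma cont_cst (U V : normedModType R) (v : V) : continuous (fun _ : U => v).
Proof. by move=> x; exact: cst_continuous. Qed.

Lemma cont_const_mx n : continuous (fun s : R => const_mx s : 'rV[R]_n).
Proof.
move=> s; apply/continuous_atP => e e0; exists e => // t ts.
by apply: le_lt_trans ts; apply: rV_norm_le => // j; rewrite !mxE.
Qed.

Lemma cont_coord (U : normedModType R) m n (f : U -> 'M[R]_(m, n)) i j :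
  continuous f -> continuous (fun x => f x i j).
Proof.
move=> fc x; apply/continuous_atP => e e0.
have [d d0 hd] := continuousP_eps fc x e0; exists d => // y /hd.
by move=> /(le_lt_trans (mx_entry_le _ i j)); rewrite !mxE.
Qed.

Lemma cont_mulmxr m n p (U : normedModType R) (f : U -> 'M[R]_(m, n))
  (N : 'M[R]_(n, p)) : continuous f -> continuous (fun x => f x *m N).
Proof.
move=> fc x; apply/continuous_atP => e e0.
have p0 : 0 < n%:R * `|N| + 1 by rewrite ltr_wpDl // mulr_ge0.
have [d d0 hd] := continuousP_eps fc x (divr_gt0 e0 p0).
exists d => // y /hd; rewrite ltr_pdivlMr // => h.
rewrite -mulmxBl; apply: le_lt_trans (mulmx_norm_le _ _) _; apply: le_lt_trans h.
by rewrite mulrCA ler_wpM2l // lerDl.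
Qed.

End MoreContinuity.

Section Leaves.
Variable R : realType.
Local Notation V := 'rV[R]_3.

Lemma plaque_sym k (phi : chart R k) x y : plaque phi x y -> plaque phi y x.
Proof. by move=> [t0 [t [c [-> ->]]]]; exists t, t0, c. Qed.

Lemma chain_trans k (W : V -> chart R k) x y z :
  chain W x y -> chain W y z -> chain W x z.
Proof.
by move=> h; elim: h z => // i {}x {}y w pl _ IH z /IH; exact: chainS pl.
Qed.

Lemma chain_plaque k (W : V -> chart R k) i x y : plaque (W i) x y -> chain W x y.
Proof. by move=> h; apply: chainS h _; exact: chain0. Qed.

Lemma chain_sym k (W : V -> chart R k) x y : chain W x y -> chain W y x.
Proof.
elim=> [{}x|i {}x {}y z pl _ IH]; first exact: chain0.
by apply: chain_trans IH _; apply: (@chain_plaque _ _ i); exact: plaque_sym.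
Qed.

Variables (H K : V -> V).
Hypothesis HK : cancel H K.
Hypothesis KH : cancel K H.

(** [L] is a linear subspace. Plaques stay in translates of [L], which gives one inclusion;
    conversely the leaf meets each ray of [L] from [H x] in an open and closed set, by the local
    hypothesis at the points reached. *)
Lemma leaf_eq k (W : V -> chart R k) (L : set V) :
  L 0 -> (forall a v, L v -> L (a *: v)) ->
  (forall v w, L v -> L w -> L (v + w)) ->
  (forall i x y, plaque (W i) x y -> L (H y - H x)) ->
  (forall x, exists2 e : R, 0 < e & forall w, L w -> `|w| < e ->
     chain W x (K (H x + w))) ->
  forall x y, leaf W x y <-> L (H y - H x).
Proof.
move=> L0 LZ LD pL loc x y; split.
  elim=> [{}x|i {}x {}y z pl _ IH]; first by rewrite subrr.
  by rewrite -(subrKA (H y)); apply: LD IH (pL _ _ _ pl).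
move=> Lw; set w := H y - H x in Lw.
pose S s := chain W x (K (H x + s *: w)).
have -> : y = K (H x + 1 *: w) by rewrite scale1r addrC subrK HK.
apply: (@real_clopen R S 0); first by rewrite /S scale0r addr0 HK; exact: chain0.
move=> s; have [e e0 he] := loc (K (H x + s *: w)).
exists (e / (`|w| + 1)) => [|t]; first by rewrite divr_gt0 // ltr_wpDl.
rewrite ltr_pdivlMr ?ltr_wpDl // => ts.
have st : chain W (K (H x + s *: w)) (K (H x + t *: w)).
  have -> : H x + t *: w = H (K (H x + s *: w)) + (t - s) *: w.
    by rewrite KH -addrA -scalerDl (addrC s) subrK.
  apply: he; first exact: LZ.
  by rewrite normrZ; apply: le_lt_trans ts; rewrite ler_wpM2l // lerDl.
split=> h; [exact: chain_trans h st|exact: chain_trans h (chain_sym st)].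
Qed.

Lemma maps_leaves_of k (W : V -> chart R k) (E : V -> set V) :
  (forall x y, leaf W x y <-> E 0 (H y - H x)) -> (forall x, E x = E 0) ->
  maps_leaves H (leaf W) (linleaf E).
Proof.
move=> h E0 x z; split.
  move=> [y []]; rewrite /linleaf E0 => Ey zy.
  by exists (K y); rewrite KH h KH.
move=> [y [/h Ey zy]]; exists (H y); split=> //.
by rewrite /linleaf E0.
Qed.

Lemma chart1_param (W : V -> chart R 1) (E : V -> set V) x : is_foliation E W ->
  exists t0 : 'rV[R]_1, exists c : 'rV[R]_2,
    [/\ W x t0 c = x, injective (fun s : R => W x (t0 + const_mx s) c : V) &
      continuous (fun s : R => W x (t0 + const_mx s) c : V)].
Proof.
move=> [/(_ x)[[cont inj op sm] [t0 [c e]]] _]; exists t0, c; split=> //.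
  move=> s t /= h; have [/addrI e1] : (t0 + const_mx s, c) = (t0 + const_mx t, c).
    exact: inj.
  by have := congr1 (fun v : 'rV[R]_1 => v ord0 ord0) e1; rewrite !mxE.
move=> s; apply: (@cont_comp R R 'rV[R]_1 V (fun s => t0 + const_mx s)
  (fun t => W x t c)).
  move=> {}s; apply/continuous_atP => e0 e00; exists e0 => // t ts.
  apply: le_lt_trans ts; apply: rV_norm_le => // j.
  by rewrite !mxE (_ : _ - _ = t - s) //; ring.
by move=> t; apply: differentiable_continuous; have [[]] := sm c.
Qed.

Hypothesis Hc : continuous H.
Hypothesis Kc : continuous K.

(** Along a plaque, the coordinate of the image in the direction [w] is continuous and injective, so
    it fills an interval around its value at [x]. *)
Lemma line_leaf_local (W : V -> chart R 1) (E : V -> set V) (w : V) :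
  w != 0 -> is_foliation E W ->
  (forall i x y, plaque (W i) x y -> exists s, H y - H x = s *: w) ->
  forall x, exists2 e : R, 0 < e & forall s, `|s| < e ->
    plaque (W x) x (K (H x + s *: w)).
Proof.
move=> w0 fol pl x; have [t0 [c [Wx inj cont]]] := chart1_param x fol.
have [i wi] : exists i, w ord0 i != 0.
  have [i hi] := rV_norm_attained w; exists i.
  by rewrite -normr_gt0 hi normr_gt0.
set p := (fun s : R => _) in inj cont.
have p0 : p 0 = x.
  rewrite /p (_ : const_mx 0 = 0) ?addr0 //.
have plp s t : plaque (W x) (p s) (p t).
  by exists (t0 + const_mx s), (t0 + const_mx t), c.
pose f s := H (p s) ord0 i / w ord0 i.
have fE s t : H (p t) - H (p s) = (f t - f s) *: w.
  have [u hu] := pl x _ _ (plp s t); rewrite hu; congr (_ *: w).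
  have := congr1 (fun v : V => v ord0 i) hu; rewrite !mxE => hi.
  by rewrite /f -mulrBl hi mulfK.
have [|||e e0 he] := @segment_inj_cover R f (-1) 0 1.
- by lra.
- move=> t _; rewrite /f; apply: (@continuousM _ _ (fun s => H (p s) ord0 i)
    (fun=> (w ord0 i)^-1)); last exact: cst_continuous.
  by apply: coord_continuous_at; exact: (cont_comp cont Hc).
- move=> s t _ _ st; apply: inj; apply: (can_inj HK); apply/eqP.
  by rewrite -subr_eq0 fE st subrr scale0r.
exists e => // s se; have [|t _ ft] := he (f 0 + s).
  by rewrite addrAC subrr add0r.
suff -> : K (H x + s *: w) = p t by have := plp 0 t; rewrite p0.
rewrite -[RHS]HK -(subrK (H (p 0)) (H (p t))) fE ft p0.
by rewrite (addrAC (f 0)) subrr add0r addrC.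
Qed.

(** Rolle's argument without derivatives. The number [e] is a sign merging maximum and minimum; if
    both are attained only at the ends, [f] is constant and the midpoint serves. *)
Lemma interior_extremum (f : R -> R) (a b : R) : a < b -> f a = f b ->
  (forall t, a <= t <= b -> {for t, continuous f}) ->
  exists2 e : R, e != 0 & exists2 m, a < m < b &
    forall t, a <= t <= b -> e * f t <= e * f m.
Proof.
move=> ab fab fc; have wc := within_continuous_segment fc.
have [M Mab hM] := EVT_max (ltW ab) wc; have [m mab hm] := EVT_min (ltW ab) wc.
have hM' t : a <= t <= b -> f t <= f M by move=> tab; apply: hM; rewrite in_itv.
have hm' t : a <= t <= b -> f m <= f t by move=> tab; apply: hm; rewrite in_itv.
move: Mab mab; rewrite !in_itv /= => Mab mab.
have [Mi|] := boolP (a < M < b).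
  by exists 1; rewrite ?oner_neq0 //; exists M => // t /hM'; rewrite !mul1r.
have [mi _|] := boolP (a < m < b).
  exists (-1); first by rewrite oppr_eq0 oner_neq0.
  by exists m => // t /hm'; rewrite !mulN1r lerN2.
have HH (u : R) : a <= u <= b -> ~~ (a < u < b) -> f u = f a.
  move=> /andP[au ub]; rewrite negb_and -!leNgt => /orP[ua|bu].
    by congr f; lra.
  by rewrite fab; congr f; lra.
move=> /(HH _ mab) em /(HH _ Mab) eM.
exists 1; rewrite ?oner_neq0 //; exists ((a + b) / 2); first by lra.
have mid : a <= (a + b) / 2 <= b by lra.
move=> t tab; rewrite !mul1r.
by have := hM' _ tab; have := hm' _ mid; rewrite em eM; lra.
Qed.

Lemma mul_trmx_gt0 (z : 'cV[R]_3) : z != 0 -> 0 < (z^T *m z) ord0 ord0.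
Proof.
move=> z0; rewrite lt_neqAle eq_sym mxE; apply/andP; split; last first.
  by apply: sumr_ge0 => i _; rewrite mxE -expr2 sqr_ge0.
apply: contra z0; rewrite psumr_eq0 => [/allP h|i _]; last first.
  by rewrite mxE -expr2 sqr_ge0.
apply/eqP/matrixP => i j; rewrite ord1 [RHS]mxE.
by have := h i; rewrite mem_index_enum mxE mulf_eq0 orbb => /(_ isT)/eqP.
Qed.

(** The codimension-one counterpart, obtained without invariance of domain in dimension two. The
    functional [z] is constant on plaques and injective in the transverse parameter, so a small
    displacement in its kernel stays in the chart and cannot change the plaque. *)
Lemma plane_leaf_local (W : V -> chart R 2) (E : V -> set V) (z : 'cV[R]_3) :
  z != 0 -> is_foliation E W ->
  (forall i x y, plaque (W i) x y -> (H y - H x) *m z = 0) ->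
  forall x, exists2 e : R, 0 < e & forall v, v *m z = 0 -> `|v| < e ->
    plaque (W x) x (K (H x + v)).
Proof.
move=> z0 fol pl x.
have [[[cont inj op sm] [t0 [c0 Wx]]] _] := (fol.1 x, fol.2).
pose p (s : R) : V := W x t0 (const_mx s).
pose k s : R := (H (p s) *m z) ord0 ord0.
have cE (c : 'rV[R]_(3 - 2)) : c = const_mx (c ord0 ord0).
  by apply/rowP => j; rewrite mxE (ord1 j).
have kE t s : H (W x t (const_mx s)) *m z = H (p s) *m z.
  apply/eqP; rewrite -subr_eq0 -mulmxBl; apply/eqP; apply: (pl x).
  by exists t0, t, (const_mx s).
have pc : continuous p.
  apply: (@cont_comp R R ('rV[R]_2 * 'rV[R]_1)%type V (fun s => (t0, const_mx s))
    (fun pr => W x pr.1 pr.2)) => //.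
  by apply: cont_pair; [exact: cont_cst|exact: cont_const_mx].
have kc : continuous k.
  by apply: cont_coord; apply: cont_mulmxr; exact: cont_comp pc Hc.
have Kopen (O : set V) y : open O -> O y -> exists2 e : R, 0 < e &
    forall v, `|v| < e -> O (K (H y + v)).
  move=> /openP_eps oO /oO[d d0 hd]; have [e e0 he] := continuousP_eps Kc (H y) d0.
  by exists e => // v ve; apply: hd; rewrite -{2}(HK y); apply: he; rewrite addrC addKr.
(* If two levels agreed, [k] would have an interior extremum at some [m]. The chart is open, so
   pushing [H (p m)] a little along [z^T] lands in a nearby plaque and beats that extremum. *)
have kinj : injective k.
  suff lt s t : s < t -> k s <> k t.
    by move=> s t e; case: (ltgtP s t) => // /lt; rewrite e.
  move=> st est; have [|e e0 [m /andP[sm' mt] hm]] := @interior_extremum k s t st est.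
    by move=> u _; exact: kc.
  pose r := Num.min (m - s) (t - m).
  have r0 : 0 < r by rewrite lt_min !subr_gt0 sm' mt.
  pose O := [set pr : 'rV[R]_2 * 'rV[R]_(3 - 2) | `|pr.2 - const_mx m| < r].
  have oO : open O.
    apply/openP_eps => -[u c] /= uc; exists (r - `|c - const_mx m|).
      by rewrite subr_gt0.
    move=> [u' c']; rewrite prod_normE gt_max => /andP[_ /= cc].
    rewrite /O /= -(subrKA c); apply: le_lt_trans (ler_normD _ _) _.
    by rewrite -ltrBrDr.
  have [|d d0 hd] := Kopen _ (p m) (op _ oO).
    by exists (t0, const_mx m) => //; rewrite /O /= subrr normr0.
  have zT0 : 0 < `|z^T| by rewrite normr_gt0 trmx_eq0.
  pose v := (Num.sg e * (d / 2) / `|z^T|) *: z^T.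
  have [|[t' c'] /= rc' E'] := hd v.
    rewrite /v normrZ normrM normfV normr_id mulfVK ?gt_eqF //.
    by rewrite normrM normr_sg e0 mul1r gtr0_norm; lra.
  have := kE t' (c' ord0 ord0); rewrite -cE E' KH mulmxDl.
  move=> /(congr1 (fun M : 'M[R]_1 => M ord0 ord0)); rewrite mxE => ek.
  have mem : s <= c' ord0 ord0 <= t.
    move: rc'; rewrite /O /= => /(le_lt_trans (mx_entry_le _ ord0 ord0)).
    rewrite !mxE lt_min !ltr_norml => /andP[/andP[? ?] /andP[? ?]].
    by apply/andP; split; lra.
  have := hm _ mem; rewrite -[k (c' _ _)]ek mulrDr gerDl leNgt => /negP; apply.
  rewrite /v -scalemxAl mxE mulrA mulr_gt0 //; last exact: mul_trmx_gt0.
  have -> : e * (Num.sg e * (d / 2) / `|z^T|) =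
    (Num.sg e * e) * (d / 2) / `|z^T| by ring.
  rewrite -normrEsg mulr_gt0 ?invr_gt0 //.
  by rewrite mulr_gt0 ?normr_gt0 // divr_gt0.
have [|e e0 he] := Kopen _ x (op _ openT).
  by exists (t0, c0).
exists e => // v vz ve; have [[t c] _ /= E'] := he v ve.
exists t0, t, c0; split=> //; rewrite -E'; congr (W x t _).
rewrite (cE c) (cE c0); congr const_mx; apply: kinj.
rewrite /k -(kE t) -cE E' KH mulmxDl vz addr0.
by rewrite /p -cE Wx.
Qed.

End Leaves.

(** * Tangent curves over short segments of the image lines *)

Section Plaques.
Variable R : realType.
Local Notation V := 'rV[R]_3.

Lemma cont_add (U W : normedModType R) (f g : U -> W) :
  continuous f -> continuous g -> continuous (fun x => f x + g x).
Proof. by move=> fc gc x; exact: (continuousD (fc x) (gc x)). Qed.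

Lemma is_derive_eps (W : normedModType R) (f : R -> W) (t : R) (v : W) :
  (forall e : R, 0 < e -> exists2 d : R, 0 < d &
     forall s, `|s - t| < d -> `|f s - f t - (s - t) *: v| <= e * `|s - t|) ->
  is_derive t (1 : R) f v.
Proof.
move=> h.
have cv : h^-1 *: ((f \o shift t) (h *: (1 : R)) - f t) @[h --> 0^'] --> v.
  apply/cvgrPdist_le => e e0; have [d d0 hd] := h e e0.
  exists d => //= u; rewrite /= sub0r normrN => ud u0.
  have := hd (u + t); rewrite addrK => /(_ ud) h1.
  have E1 : u *: (1 : R) = u by rewrite /GRing.scale /= mulr1.
  rewrite /= E1.
  have -> : v - u^-1 *: (f (u + t) - f t) =
      - (u^-1 *: (f (u + t) - f t - u *: v)).
    by rewrite (scalerBr _ (f (u + t) - f t)) scalerA mulVf // scale1r opprB.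
  rewrite normrN normrZ normfV mulrC ler_pdivrMr ?normr_gt0 //.
split; first exact: (cvgP _ cv).
exact: (cvg_lim (@norm_hausdorff _ _) cv).
Qed.

Lemma is_derive_affine n (t v : 'rV[R]_n) (s : R) :
  is_derive s (1 : R) (fun u : R => t + u *: v) v.
Proof.
apply: is_derive_eps => e e0; exists 1 => // u _.
rewrite opprD addrACA subrr add0r -scalerBl subrr normr0.
by rewrite mulr_ge0 // ltW.
Qed.

Lemma geometric_small (q e : R) : 0 <= q < 1 -> 0 < e ->
  exists N, forall n, (N <= n)%N -> q ^+ n < e.
Proof.
move=> /andP[q0 q1] e0.
have : `|q| < 1 by rewrite ger0_norm.
move=> /cvg_expr /cvgrPdist_lt /(_ e e0) [N _ hN]; exists N => n /hN /=.
by rewrite sub0r normrN ger0_norm // exprn_ge0.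
Qed.

Lemma plaque_tcurve k (E : V -> set V) (phi : chart R k) t1 t2 c a b :
  is_chart E phi -> t1 != t2 ->
  tcurve E (fun u => phi (t1 + u *: (t2 - t1)) c)
    (fun u => 'd (phi^~ c) (t1 + u *: (t2 - t1)) (t2 - t1)) a b.
Proof.
move=> [_ _ _ sm] t12 u _.
have [C1c dc] := sm c.
have dl : is_derive u (1 : R) (fun u : R => t1 + u *: (t2 - t1)) (t2 - t1).
  exact: is_derive_affine.
split.
- by apply: is_derive_comp_curve dl; case: C1c.
- apply: (@continuous_diff_along R k 3 (phi^~ c) (fun u => t1 + u *: (t2 - t1))
    (fun=> t2 - t1)) => //; first exact: is_derive_continuous dl.
  exact: cst_continuous.
- by have [_] := dc (t1 + u *: (t2 - t1)); exact.
by have [+ _] := dc (t1 + u *: (t2 - t1)); move=> h; apply: contra_neq t12 => /h/eqP;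
  rewrite subr_eq0 => /eqP.
Qed.

Variables (H K : V -> V).
Hypothesis HK : cancel H K.
Hypothesis KH : cancel K H.
Hypothesis Hc : continuous H.
Hypothesis Kc : continuous K.
Hypothesis He : int_equivariant H.
Hypothesis Ke : int_equivariant K.

Definition line_image (k : nat) (W : V -> chart R k) (w : V) :=
  forall i x y, plaque (W i) x y -> exists s, H y - H x = s *: w.

Lemma segment_inj_image_between (f : R -> R) (a b : R) : a <= b ->
  (forall t, a <= t <= b -> {for t, continuous f}) ->
  (forall s t, a <= s <= b -> a <= t <= b -> f s = f t -> s = t) ->
  forall t, a <= t <= b -> `|f t - f a| <= `|f b - f a| /\
    `|f t - f b| <= `|f a - f b|.
Proof.
move=> ab fc finj t /andP[ta tb].
case: (eqVneq a t) ta => [-> _|at0 ta]; first by rewrite subrr normr0.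
case: (eqVneq t b) tb => [-> _|tb0 tb]; first by rewrite subrr normr0.
have [] := @segment_inj_between R f a t b _ fc finj.
- by rewrite !lt_neqAle at0 ta tb0 tb.
- move=> /andP[h1 h2]; split.
    by rewrite (@gtr0_norm _ (f b - f a)); [rewrite ler_norml|]; lra.
  by rewrite (@ltr0_norm _ (f a - f b)); [rewrite ler_norml|]; lra.
move=> /andP[h1 h2]; split.
  by rewrite (@ltr0_norm _ (f b - f a)); [rewrite ler_norml|]; lra.
by rewrite (@gtr0_norm _ (f a - f b)); [rewrite ler_norml|]; lra.
Qed.

(** Plaques cover displacements of a uniform size [a] along [w], whatever the point. The value
    [s = 0] is left out because a tangent curve has nonzero velocity. *)
Lemma uniform_plaques (P : V -> 'M[R]_3) (W : V -> chart R 1) (w : V) :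
  w != 0 -> line_field P -> is_foliation (inF P) W -> line_image W w ->
  exists2 a : R, 0 < a & forall x s, 0 < `|s| <= a ->
    exists c c', [/\ tcurve (inF P) c c' 0 1, c 0 = x, c 1 = K (H x + s *: w) &
      forall t, 0 <= t <= 1 -> exists2 s', `|s'| <= `|s| & H (c t) = H x + s' *: w].
Proof.
move=> w0 [_ [Pper _]] fol img.
pose good x s := exists c c', [/\ tcurve (inF P) c c' 0 1, c 0 = x,
  c 1 = K (H x + s *: w) & forall t, 0 <= t <= 1 ->
    exists2 s', `|s'| <= `|s| & H (c t) = H x + s' *: w].
apply: (@periodic_uniform R (fun a x => forall s, 0 < `|s| <= a -> good x s)).
- move=> x.
  have [[chartx _] _] := (fol.1 x, fol.2).
  have [cont inj op sm] := chartx.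
  have [t0 [c0 [Wx _ _]]] := chart1_param x fol.
  have [i wi] : exists i, w ord0 i != 0.
    have [i hi] := rV_norm_attained w; exists i.
    by rewrite -normr_gt0 hi normr_gt0.
  pose p s (c : 'rV[R]_2) : V := W x (t0 + const_mx s) c.
  pose f s c : R := H (p s c) ord0 i / w ord0 i.
  have fE s t c : H (p t c) - H (p s c) = (f t c - f s c) *: w.
    have [|u hu] := img x (p s c) (p t c).
      by exists (t0 + const_mx s), (t0 + const_mx t), c.
    rewrite hu; congr (_ *: w).
    have := congr1 (fun v : V => v ord0 i) hu; rewrite !mxE => hi.
    by rewrite /f -mulrBl hi mulfK.
  have finj c s t : f s c = f t c -> s = t.
    move=> e; have /(can_inj HK) : H (p s c) = H (p t c).
      by apply/eqP; rewrite -subr_eq0 fE e subrr scale0r.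
    rewrite /p => /(inj (_, _) (_, _)) [/addrI e1].
    by have := congr1 (fun v : 'rV[R]_1 => v ord0 ord0) e1; rewrite !mxE.
  have pcont : continuous (fun sc : R * 'rV[R]_2 => p sc.1 sc.2).
    apply: (@cont_comp R (R * 'rV[R]_2)%type ('rV[R]_1 * 'rV[R]_2)%type V
       (fun sc => (t0 + const_mx sc.1, sc.2)) (fun pr => W x pr.1 pr.2)) => //.
    apply: cont_pair; last by move=> [u c]; exact: cvg_snd.
    apply: (@cont_comp R (R * 'rV[R]_2)%type R 'rV[R]_1 fst
      (fun s => t0 + const_mx s)); first by move=> [u c]; exact: cvg_fst.
    by move=> u; apply: continuousD; [exact: cst_continuous|exact: cont_const_mx].
  have fcont : continuous (fun sc : R * 'rV[R]_2 => f sc.1 sc.2).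
    apply: (@cont_comp R (R * 'rV[R]_2)%type R R
      (fun sc => H (p sc.1 sc.2) ord0 i) (fun y => y / w ord0 i)).
      by apply: cont_coord; exact: cont_comp pcont Hc.
    by move=> y; exact: mulrr_continuous.
  have fcs c : continuous (f^~ c).
    apply: (@cont_comp R R (R * 'rV[R]_2)%type R (fun s => (s, c))
      (fun sc => f sc.1 sc.2)) => //.
    by apply: cont_pair; [exact: cont_id|exact: cont_cst].
  have btw := @segment_inj_between R (f^~ c0) (-1) 0 1 ltac:(lra)
    (fun t _ => fcs c0 t) (fun s t _ _ => @finj c0 s t).
  (* One third, since passing to a nearby plaque [c] moves the end value and the middle value by at
     most [gap] each, and a room of [gap] must remain for [s] on both sides. *)
  pose gap := Num.min `|f (-1) c0 - f 0 c0| `|f 1 c0 - f 0 c0| / 3.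
  have gap0 : 0 < gap.
    rewrite divr_gt0 // lt_min !normr_gt0 !subr_eq0.
    by apply/andP; split; apply/eqP => /finj; lra.
  have [d1 d10 h1] := continuousP_eps fcont (-1, c0) gap0.
  have [d2 d20 h2] := continuousP_eps fcont (1, c0) gap0.
  have [d3 d30 h3] := continuousP_eps fcont (0, c0) gap0.
  pose d := Num.min (Num.min d1 d2) (Num.min d3 1).
  have d0 : 0 < d by rewrite !lt_min d10 d20 d30 ltr01.
  pose O := [set pr : 'rV[R]_1 * 'rV[R]_2 | `|pr - (t0, c0)| < d].
  have /op/openP_eps oO : open O.
    apply/openP_eps => pr; rewrite /O /= => h.
    exists (d - `|pr - (t0, c0)|); first by rewrite subr_gt0.
    move=> pr' h'; rewrite -(subrKA pr); apply: le_lt_trans (ler_normD _ _) _.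
    by rewrite -ltrBrDr.
  have [|r r0 hr] := oO x.
    by exists (t0, c0) => //; rewrite /O /= subrr normr0.
  exists gap => //; exists r => // y /hr [[t c]].
  rewrite /O /= prod_normE gt_max => /andP[/= tt0 cc0] yE s /andP[s0 sg].
  pose u := (t - t0) ord0 ord0.
  have tE : t = t0 + const_mx u.
    by apply/rowP => j; rewrite /u !mxE (ord1 j); ring.
  have ud : `|u| < d by apply: le_lt_trans (mx_entry_le _ ord0 ord0) tt0.
  have near0 (v z : R) (dd : R) : `|v - z| < dd -> d <= dd -> `|(v, c) - (z, c0)| < dd.
    by move=> vz ddd; rewrite prod_normE gt_max /= vz (lt_le_trans cc0 ddd).
  have ltd : [/\ d <= d1, d <= d2, d <= d3 & d <= 1].
    by rewrite /d !ge_min !lexx !orbT.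
  have [l1 l2 l3 l4] := ltd.
  have k1 := h1 (-1, c) (near0 (-1) (-1) d1 ltac:(by rewrite subrr normr0) l1).
  have k2 := h2 (1, c) (near0 1 1 d2 ltac:(by rewrite subrr normr0) l2).
  have k3 := h3 (u, c) (near0 u 0 d3 ltac:(by rewrite subr0 (lt_le_trans ud)) l3).
  have pu : p u c = y by rewrite /p -tE -yE.
  have [v _ vE] : exists2 v, -1 <= v <= 1 & f v c = f u c + s.
    apply: segment_ivt; [by lra|by move=> ? _; exact: fcs|].
    move: k1 k2 k3 sg; rewrite /= !ltr_norml ler_norml /gap => k1 k2 k3.
    have ga : `|f (-1) c0 - f 0 c0| >= 3 * gap by rewrite mulrC divfK // ge_min lexx.
    have gb : `|f 1 c0 - f 0 c0| >= 3 * gap.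
      by rewrite mulrC divfK // ge_min lexx orbT.
    move: k1 k2 k3 ga gb; rewrite -/gap.
    case: btw => /andP[b1 b2] k1 k2 k3 ga gb sg; [left|right].
      move: ga gb; rewrite (@ltr0_norm _ (f (-1) c0 - _)); last by lra.
      by rewrite (@gtr0_norm _ (f 1 c0 - _)); lra.
    move: ga gb; rewrite (@gtr0_norm _ (f (-1) c0 - _)); last by lra.
    by rewrite (@ltr0_norm _ (f 1 c0 - _)); lra.
  have uv : u != v.
    apply/eqP => e; move: s0; have -> : s = 0 by move: vE; rewrite e; lra.
    by rewrite normr0 ltxx.
  have t12 : t0 + const_mx u != t0 + const_mx v :> 'rV[R]_1.
    apply: contra uv => /eqP/addrI e; apply/eqP.
    by have := congr1 (fun v : 'rV[R]_1 => v ord0 ord0) e; rewrite !mxE.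
  have pE z : W x (t0 + const_mx u + z *: (t0 + const_mx v - (t0 + const_mx u))) c
      = p (u + z * (v - u)) c.
    by rewrite /p; congr (W x _ c); apply/rowP => j; rewrite !mxE; ring.
  eexists; eexists; split.
  - exact: (@plaque_tcurve 1 (inF P) (W x) _ _ c 0 1 chartx t12).
  - by rewrite /= pE mul0r addr0.
  - rewrite /= pE (_ : u + 1 * (v - u) = v); last by ring.
    rewrite -[LHS]HK; congr K; have /eqP := fE u v c.
    by rewrite pu vE (addrC (f u c)) addrK subr_eq addrC => /eqP.
  move=> z z01; exists (f (u + z * (v - u)) c - f u c); last first.
    rewrite /= pE; have /eqP := fE u (u + z * (v - u)) c.
    by rewrite pu subr_eq (addrC _ (H y)) => /eqP.
  have -> : s = f v c - f u c by lra.
  have [||+ _] := @segment_inj_image_between (fun z => f (u + z * (v - u)) c) 0 1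
    ler01 _ _ z z01.
  - move=> y' _; apply: (@cont_comp R R R R (fun z => u + z * (v - u)) (f^~ c)) => //.
    by apply: cont_add; [exact: cont_cst|exact: mulrr_continuous].
  - move=> a b _ _ /finj/addrI/mulIf; apply.
    by rewrite subr_eq0 eq_sym.
  by rewrite /= mul0r addr0 mul1r (addrC u (v - u)) subrK.
- by move=> a b y /andP[_ ba] h s /andP[s0 sb]; apply: h; rewrite s0 (le_trans sb).
move=> a y n n_int h s /h [c [c' [tc c0 c1 ct]]].
have [k k_int hk] := He n_int; have [m m_int hm] := Ke k_int.
have nm : m = n.
  have := hm (H 0); rewrite HK add0r => <-.
  by rewrite -hk add0r HK.
exists (fun t => c t + n), c'; split.
- by apply: tcurve_shift tc => x v; rewrite /inF Pper.
- by rewrite c0.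
- by rewrite c1 hk addrAC hm nm.
by move=> t /ct[s' ss' E]; exists s' => //; rewrite !hk E addrAC.
Qed.

End Plaques.

(** * Expansion of the eigenvalue along image lines *)

Section Expansion.
Variable R : realType.
Local Notation V := 'rV[R]_3.

(** The norm is the maximum norm; [C] absorbs its comparison with the Riemannian metric. *)
Definition rate (E : V -> set V) (f : V -> V) (q : R) := exists2 C : R, 0 <= C &
  forall n x v, E x v -> `|'d (iter n f) x v| <= C * q ^+ n * `|v|.

Definition iter_C1 (f : V -> V) := forall n, C1 (iter n f).

Lemma iter_cancel (f g : V -> V) n : cancel f g -> cancel (iter n f) (iter n g).
Proof. by move=> fg; elim: n => // n IH x; rewrite iterSr iterS fg IH. Qed.

Variables (H K F Fi : V -> V) (A : 'M[R]_3).
Hypothesis HK : cancel H K.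
Hypothesis KH : cancel K H.
Hypothesis Hc : continuous H.
Hypothesis Kc : continuous K.
Hypothesis He : int_equivariant H.
Hypothesis Ke : int_equivariant K.
Hypothesis FK : cancel F Fi.
Hypothesis HF : forall x y, H (F x) - H (F y) = (H x - H y) *m A.

Lemma lines_subdivide (w : V) (Q : V -> V) (a B : R) : 0 < a ->
  (forall x s, `|s| <= a -> `|Q x - Q (K (H x + s *: w))| <= B) ->
  forall m x s, `|s| <= m%:R * a -> `|Q x - Q (K (H x + s *: w))| <= m%:R * B.
Proof.
move=> a0 h; elim=> [|m IH] x s.
  by rewrite !mul0r normr_le0 => /eqP ->; rewrite scale0r addr0 HK subrr normr0.
have m0 : 0 < m.+1%:R :> R by rewrite ltr0n.
move=> sm; pose s1 := s * m%:R / m.+1%:R; pose s2 := s / m.+1%:R.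
have sE : s = s1 + s2.
  apply: (mulIf (lt0r_neq0 m0)); rewrite mulrDl !divfK ?gt_eqF //.
  by rewrite -natr1; ring.
have b2 : `|s2| <= a by rewrite normrM normfV (gtr0_norm m0) ler_pdivrMr // mulrC.
have b1 : `|s1| <= m%:R * a.
  have -> : s1 = m%:R * s2 by rewrite /s1 /s2; ring.
  by rewrite normrM normr_nat ler_wpM2l.
have := IH x s1 b1; have := h (K (H x + s1 *: w)) s2 b2.
rewrite KH -addrA -scalerDl -sE -natr1 mulrDl mul1r => h1 h2.
rewrite -(subrKA (Q (K (H x + s1 *: w)))).
by apply: le_trans (ler_normD _ _) _; lra.
Qed.

(** After [n] forward steps a segment of the image line is about [|r| ^+ n] times as long. Cut it
    into pieces of size at most [a]: pulled back by [Fi], each piece has size of order [q ^+ n]. If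
    [|r| * q < 1], the total tends to 0, although it bounds the fixed distance of two distinct
    points. *)
Lemma lines_expand (P : V -> 'M[R]_3) (W : V -> chart R 1) (w : V) (r q : R) :
  w != 0 -> line_field P -> is_foliation (inF P) W -> line_image H W w ->
  w *m A = r *: w -> 0 < q < 1 -> rate (inF P) Fi q -> iter_C1 Fi ->
  1 <= `|r| * q.
Proof.
move=> w0 Pl fol img wA /andP[q0 q1] [C C0 rt] FiC.
rewrite leNgt; apply/negP => rq.
have [a1 a10 up] := uniform_plaques HK Hc He Ke w0 Pl fol img.
have [d0 d00 chord] := tcurve_chord Pl.
have [a2 a20 ucK] := equivariant_unif_cont Kc Ke d00.
have wn0 : 0 < `|w| by rewrite normr_gt0.
pose a := Num.min a1 (a2 / (2 * `|w|)).
have a0 : 0 < a by rewrite lt_min a10 divr_gt0 // mulr_gt0.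
have step n x s : `|s| <= a ->
    `|iter n Fi x - iter n Fi (K (H x + s *: w))| <= 2 * (C * q ^+ n) * d0.
  move=> sa; case: (eqVneq s 0) => [->|s0].
    by rewrite scale0r addr0 HK subrr normr0 !mulr_ge0 // ?exprn_ge0 // ltW.
  have [|c [c' [tc c0 c1 ct]]] := up x s.
    by rewrite normr_gt0 s0 (le_trans sa) // ge_min lexx.
  have small t : 0 <= t <= 1 -> `|c t - c 0| < d0.
    move=> /ct[s' ss' E]; rewrite c0 -(HK (c t)) -(HK x); apply: ucK.
    rewrite E addrC addKr normrZ.
    have : `|s'| <= a2 / (2 * `|w|).
      by apply: le_trans ss' (le_trans sa _); rewrite ge_min lexx orbT.
    rewrite ler_pdivlMr ?mulr_gt0 // => h; apply: le_lt_trans (_ : a2 / 2 < a2).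
      by rewrite ler_pdivlMr // -mulrA (mulrC `|w|).
    by rewrite ltr_pdivrMr // ltr_pMr // ltr1n.
  have Cq0 : 0 <= C * q ^+ n by rewrite mulr_ge0 // exprn_ge0 // ltW.
  have := chord c c' 0 1 ler01 tc small (iter n Fi) (C * q ^+ n) _ Cq0 (rt n).
  move=> h; rewrite -c1 -[in X in `|X - _|]c0 distrC; apply: le_trans (h _) _.
    by move=> y; have [dd _] := FiC n; exact: dd.
  rewrite ler_wpM2l //; first by rewrite mulr_ge0.
  apply: ltW; apply: small.
  by rewrite ler01 lexx.
pose y := K (H (K 0) + a *: w).
have yx : 0 < `|K 0 - y|.
  rewrite normr_gt0 subr_eq0; apply: contra w0 => /eqP/(can_inj KH)/eqP.
  by rewrite KH add0r eq_sym scaler_eq0 (gt_eqF a0).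
pose D := 2 * C * d0.
have HFn n x z : H (iter n F x) - H (iter n F z) = (H x - H z) *m A ^+ n.
  elim: n => [|n IH]; first by rewrite expr0 mulmx1.
  by rewrite !iterS HF IH -mulmxA exprSr.
have wAn n : w *m A ^+ n = r ^+ n *: w.
  elim: n => [|n IH]; first by rewrite !expr0 mulmx1 scale1r.
  by rewrite exprSr -mulmxE mulmxA IH -scalemxAl wA scalerA exprSr.
have key n : `|K 0 - y| <= ((`|r| * q) ^+ n + q ^+ n) * D.
  have -> : K 0 = iter n Fi (iter n F (K 0)) by rewrite iter_cancel.
  have -> : y = iter n Fi (iter n F y) by rewrite iter_cancel.
  have -> : iter n F y = K (H (iter n F (K 0)) + (a * r ^+ n) *: w).
    rewrite -[LHS]HK -(subrK (H (iter n F (K 0))) (H (iter n F y))) HFn /y KH.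
    by rewrite (addrC _ (a *: w)) addrK -scalemxAl wAn scalerA addrC.
  (* The number of pieces, rounded up; the rounding accounts for the extra term [q ^+ n] in the
     estimate. *)
  pose m := (Num.trunc (`|r| ^+ n)).+1.
  have r0 : 0 <= `|r| ^+ n by rewrite exprn_ge0.
  have /andP[m1 m2] := truncn_itv r0.
  have am : `|a * r ^+ n| <= m%:R * a.
    by rewrite normrM normrX (gtr0_norm a0) mulrC ler_wpM2r // ltW.
  apply: le_trans (lines_subdivide a0 (step n) _ am) _.
  have -> : ((`|r| * q) ^+ n + q ^+ n) * D =
    (`|r| ^+ n + 1) * (2 * (C * q ^+ n) * d0) by rewrite /D exprMn; ring.
  rewrite ler_wpM2r //; last by rewrite /m -natr1 lerD2r.
  by rewrite !mulr_ge0 // ?exprn_ge0 // ltW.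
have D0 : 0 <= D by rewrite !mulr_ge0 // ltW.
have e0 : 0 < `|K 0 - y| / (2 * (D + 1)).
  by rewrite divr_gt0 // mulr_gt0 // ltr_wpDl.
have rq0 : 0 <= `|r| * q < 1 by rewrite rq mulr_ge0 // ltW.
have q01 : 0 <= q < 1 by rewrite ltW.
have [N1 h1] := geometric_small rq0 e0; have [N2 h2] := geometric_small q01 e0.
have := key (maxn N1 N2).
have := h1 _ (leq_maxl N1 N2); have := h2 _ (leq_maxr N1 N2).
set u := (_ * q) ^+ _; set v := q ^+ _.
have D1 : 0 < 2 * (D + 1) by rewrite mulr_gt0 // ltr_wpDl.
rewrite !ltr_pdivlMr // => k1 k2 k3.
have u0 : 0 <= u by rewrite exprn_ge0 //; case/andP: rq0.
have v0 : 0 <= v by rewrite exprn_ge0 // ltW.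
by clearbody u v D; move: k1 k2 k3; move: `|K 0 - y| => z; lra.
Qed.

End Expansion.

(** * Integral curves *)

Section Peano.
Variable R : realType.

Lemma closed_ball0_compact n (x : 'rV[R]_n) (r : R) :
  compact [set y : 'rV[R]_n | `|y - x| <= r].
Proof.
apply: bounded_closed_compact.
  exists (r + `|x|); split; first exact: num_real.
  move=> M rM y /= yr; rewrite -(subrK x y).
  by apply: le_trans (ler_normD _ _) (le_trans _ (ltW rM)); rewrite lerD2r.
rewrite -openC; apply/openP_eps => y /= /negP; rewrite -ltNge => h.
exists (`|y - x| - r); first by rewrite subr_gt0.
move=> z zy /= zx; have : `|y - x| <= `|z - y| + `|z - x|.
  by rewrite -(subrKA z) (distrC z y) ler_normD.
by lra.
Qed.

(** Limits along one ultrafilter make the Euler polygons converge at all times simultaneously, in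
    place of the extraction of a subsequence by equicontinuity. *)
Lemma ultra_lim n (U : set_system nat) (a : nat -> 'rV[R]_n) (x : 'rV[R]_n) r :
  UltraFilter U -> (forall N, `|a N - x| <= r) ->
  exists l, forall e : R, 0 < e -> U [set N | `|a N - l| < e].
Proof.
move=> UF ab; have UP : ProperFilter (a @ U) by apply: fmap_proper_filter.
have [|l [_ lc]] := @closed_ball0_compact n x r (a @ U) UP.
  have Ufil : Filter U by typeclasses eauto.
  by apply: (@filterS _ U _ setT) => [N _|]; [exact: ab|exact: filterT].
exists l => e e0; set S := [set N | _].
have [//|US] := in_ultra_setVsetC S UF.
have [|z []] := lc [set z | ~ (`|z - l| < e)] [set z | `|z - l| < e] US.
  by apply/nbhs_ballP; exists e => // y; rewrite -ball_normE /ball_ /= distrC.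
by [].
Qed.

Variables (n : nat) (w : 'rV[R]_n -> 'rV[R]_n) (t0 : 'rV[R]_n).
Hypothesis wc : continuous w.

Fixpoint euler (N k : nat) : 'rV[R]_n :=
  if k is k'.+1 then euler N k' + (N.+1%:R)^-1 *: w (euler N k') else t0.

Lemma euler_step_bound (N i j : nat) (q : 'rV[R]_n) (e : R) : (i <= j)%N ->
  (forall m, (i <= m < j)%N -> `|w (euler N m) - q| <= e) ->
  `|euler N j - euler N i - ((j - i)%:R / N.+1%:R) *: q| <= (j - i)%:R / N.+1%:R * e.
Proof.
move=> /subnK <-; move: (j - i)%N => k {j}; rewrite addnK.
elim: k => [|k IH] h.
  by rewrite add0n !mul0r scale0r subr0 subrr normr0.
have /IH h1 : forall m, (i <= m < k + i)%N -> `|w (euler N m) - q| <= e.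
  by move=> m /andP[im mk]; apply: h; rewrite im addSn ltnS ltnW.
have h2 : `|w (euler N (k + i)) - q| <= e.
  by apply: h; rewrite leq_addl addSn ltnSn.
rewrite addSn /= -(natr1 k) !mulrDl mul1r scalerDl.
have -> : euler N (k + i) + N.+1%:R^-1 *: w (euler N (k + i)) - euler N i -
    ((k%:R / N.+1%:R) *: q + N.+1%:R^-1 *: q) =
    (euler N (k + i) - euler N i - (k%:R / N.+1%:R) *: q) +
    N.+1%:R^-1 *: (w (euler N (k + i)) - q).
  by rewrite scalerBr; move: (_ *: q) (_ *: q) (_ *: w _) => a b c; vec_ring.
apply: le_trans (ler_normD _ _) (lerD h1 _).
by rewrite normrZ normfV normr_nat ler_wpM2l // invr_ge0.
Qed.

Definition euler_index (N : nat) (t : R) := Num.trunc (t * N.+1%:R).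

Lemma euler_indexP N t : 0 <= t ->
  t - N.+1%:R^-1 <= (euler_index N t)%:R / N.+1%:R <= t.
Proof.
move=> t0'; have N0 : 0 < N.+1%:R :> R by rewrite ltr0n.
have /andP[h1 h2] := truncn_itv (mulr_ge0 t0' (ltW N0)).
rewrite ler_pdivrMr // h1 andbT ler_pdivlMr // mulrBl mulVf ?gt_eqF //.
by rewrite lerBlDr natr1 ltW.
Qed.

(** The derivative is expressed by increments over [s1 <= s2], a form that makes sense at the left
    end 0, where a forward and a backward solution will be glued. *)
Lemma peano_forward : exists2 d : R, 0 < d & exists2 c : R -> 'rV[R]_n, c 0 = t0 &
  forall s e, 0 <= s < d -> 0 < e -> exists2 h : R, 0 < h &
    forall s1 s2, 0 <= s1 <= s2 -> s2 < d -> `|s1 - s| < h -> `|s2 - s| < h ->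
      `|c s2 - c s1 - (s2 - s1) *: w (c s)| <= e * (s2 - s1).
Proof.
have [rho rho0 hrho] := continuousP_eps wc t0 (@ltr01 R).
pose B := `|w t0| + 1.
have B0 : 0 < B by rewrite ltr_wpDl.
have wB z : `|z - t0| < rho -> `|w z| <= B.
  move=> /hrho h; rewrite -(subrK (w t0) (w z)) /B addrC.
  by apply: le_trans (ler_normD _ _) _; rewrite lerD2l ltW.
(* Up to time [d] a polygon of speed at most [B] travels at most [rho / 2], so it stays in the ball
   where this bound on [w] holds. *)
pose d := rho / (2 * B).
have d0 : 0 < d by rewrite divr_gt0 // mulr_gt0.
have dB : d * B < rho.
  rewrite /d invfM mulrA mulfVK ?gt_eqF // ltr_pdivrMr // ltr_pMr //.
  by rewrite ltr1n.
have bnd N k : k%:R / N.+1%:R <= d -> `|euler N k - t0| <= k%:R / N.+1%:R * B.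
  elim: k => [|k IH] kd; first by rewrite /= subrr normr0 !mul0r.
  have N0 : 0 < N.+1%:R :> R by rewrite ltr0n.
  have kd' : k%:R / N.+1%:R <= d.
    by apply: le_trans kd; rewrite ler_wpM2r ?invr_ge0 // ler_nat.
  have := IH kd' => h.
  have wk : `|w (euler N k)| <= B.
    by apply: wB; apply: le_lt_trans h (le_lt_trans _ dB); rewrite ler_wpM2r // ltW.
  rewrite /= addrAC -(natr1 k) !mulrDl mul1r.
  apply: le_trans (ler_normD _ _) (lerD h _).
  by rewrite normrZ normfV normr_nat ler_wpM2l // invr_ge0.
have [U [UF Uinf]] := @ultraFilterLemma nat \oo _.
have UPr : ProperFilter U by typeclasses eauto.
pose a s N := euler N (euler_index N s).
have lim s : exists l, 0 <= s < d -> forall e : R, 0 < e -> U [set N | `|a s N - l| < e].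
  have [/andP[s0 sd]|] := boolP (0 <= s < d); last by exists 0.
  have [N|l hl] := @ultra_lim n U (a s) t0 (d * B) UF; last by exists l.
  have /andP[_ h] := euler_indexP N s0.
  have hd : (euler_index N s)%:R / N.+1%:R <= d by rewrite (le_trans h) // ltW.
  by apply: le_trans (bnd _ _ hd) _; rewrite ler_wpM2r // ltW.
pose c s := sval (cid (lim s)).
have cP s : 0 <= s < d -> forall e : R, 0 < e -> U [set N | `|a s N - c s| < e].
  exact: (svalP (cid (lim s))).
have Usmall (e : R) : 0 < e -> U [set N : nat | (N.+1%:R)^-1 < e].
  move=> e0; apply: Uinf; exists (Num.trunc e^-1) => // N /= hN.
  rewrite invf_plt ?posrE ?ltr0n // (lt_le_trans (truncnS_gt _)) // ler_nat.
  by rewrite ltnS.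
exists d => //; exists c.
  apply/eqP; rewrite -subr_eq0 -normr_le0; apply/ler_addgt0Pr => e e0; rewrite add0r.
  have [|N /=] := filter_ex (cP 0 _ e e0); first by rewrite lexx.
  by rewrite /a /euler_index mul0r truncn0 /= distrC => /ltW.
move=> s e /andP[s0 sd] e0.
have [eta eta0 heta] := continuousP_eps wc (c s) e0.
have h0 : 0 < eta / (4 * B) by rewrite divr_gt0 // mulr_gt0.
exists (eta / (4 * B)) => // s1 s2 /andP[s10 s12] s2d s1s s2s.
have I1 : 0 <= s1 < d by rewrite s10 (le_lt_trans s12).
have I2 : 0 <= s2 < d by rewrite (le_trans s10).
have Is : 0 <= s < d by rewrite s0.
apply/ler_addgt0Pr => e1 e10.
(* [M] collects the errors: two for the limits at [s1] and [s2], and the rounding of times to the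
   Euler grid, multiplied once by the norm of [w (c s)] and once by [e]. *)
pose M := 2 + `|w (c s)| + e.
have M0 : 0 < M by rewrite ltr_wpDl // ltr_wpDr.
have e20 : 0 < e1 / M by rewrite divr_gt0.
have eta40 : 0 < eta / 4 by rewrite divr_gt0.
have [N [[[k1 k2] k3] [k4 k5]]] : exists N, ((`|a s1 N - c s1| < e1 / M /\
    `|a s2 N - c s2| < e1 / M) /\ `|a s N - c s| < eta / 4) /\
    (N.+1%:R^-1 < e1 / M /\ N.+1%:R^-1 < eta / (4 * B)).
  by apply: (@filter_ex _ U); apply: filterI; [apply: filterI; [apply: filterI|]|
    apply: filterI]; [exact: cP|exact: cP|exact: cP|exact: Usmall|exact: Usmall].
pose i := euler_index N s1; pose j := euler_index N s2; pose k := euler_index N s.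
have N0 : 0 < N.+1%:R :> R by rewrite ltr0n.
have ij : (i <= j)%N by apply: le_truncn; rewrite ler_wpM2r // ltW.
have /andP[i1 i2] := euler_indexP N s10.
have /andP[j1 j2] := euler_indexP N (le_trans s10 s12).
have /andP[l1 l2] := euler_indexP N s0.
rewrite -/i in i1 i2; rewrite -/j in j1 j2; rewrite -/k in l1 l2.
have close m m' : (m <= m')%N -> m'%:R / N.+1%:R <= d ->
    `|euler N m' - euler N m| <= (m'%:R / N.+1%:R - m%:R / N.+1%:R) * B.
  move=> mm md; have := @euler_step_bound N m m' 0 B mm.
  rewrite scaler0 subr0 -mulrBl -natrB //; apply => m2 /andP[_ m2m].
  rewrite subr0; apply: wB; apply: le_lt_trans (bnd _ _ _) _.
    by apply: le_trans md; rewrite ler_wpM2r ?invr_ge0 // ler_nat ltnW.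
  apply: le_lt_trans dB; rewrite ler_wpM2r ?(ltW B0) //.
  by apply: le_trans md; rewrite ler_wpM2r ?invr_ge0 // ler_nat ltnW.
have est := @euler_step_bound N i j (w (c s)) e ij.
have est' m : (i <= m < j)%N -> `|w (euler N m) - w (c s)| <= e.
  move=> /andP[im mj]; apply/ltW/heta.
  have mi : i%:R / N.+1%:R <= m%:R / N.+1%:R :> R.
    by rewrite ler_wpM2r ?invr_ge0 // ler_nat.
  have jm : m%:R / N.+1%:R <= j%:R / N.+1%:R :> R.
    by rewrite ler_wpM2r ?invr_ge0 // ler_nat ltnW.
  have hmk : `|euler N m - euler N k| < eta / 2.
    have E : eta / 2 = (2 * (eta / (4 * B))) * B.
      by rewrite invfM !mulrA mulfVK ?gt_eqF //; field.
    rewrite E; case: (leqP m k) => [mk|/ltnW km].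
      have kd : k%:R / N.+1%:R <= d by rewrite (le_trans l2) // ltW.
      rewrite distrC; apply: le_lt_trans (close _ _ mk kd) _; rewrite ltr_pM2r //.
      move: s1s l2 i1 mi k5; rewrite ltr_norml => /andP[].
      by move: (eta / (4 * B)) (N.+1%:R^-1) (k%:R / N.+1%:R) (m%:R / N.+1%:R) (i%:R / N.+1%:R) => *; lra.
    have md : m%:R / N.+1%:R <= d by rewrite (le_trans jm) // (le_trans j2) // ltW.
    apply: le_lt_trans (close _ _ km md) _; rewrite ltr_pM2r //.
    move: s2s l1 j2 jm k5; rewrite ltr_norml => /andP[].
    by move: (eta / (4 * B)) (N.+1%:R^-1) (k%:R / N.+1%:R) (m%:R / N.+1%:R) (j%:R / N.+1%:R) => *; lra.
  rewrite -(subrKA (euler N k)); apply: le_lt_trans (ler_normD _ _) _.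
  by move: k3; rewrite /a -/k; lra.
have {est est'} est := est est'.
set q := w (c s) in est *.
set ii := i%:R / N.+1%:R in i1 i2 est *; set jj := j%:R / N.+1%:R in j1 j2 est *.
have ejj : (j - i)%:R / N.+1%:R = jj - ii by rewrite natrB // mulrBl.
rewrite ejj in est; clear ejj.
have -> : c s2 - c s1 - (s2 - s1) *: q = (- (a s2 N - c s2) + (a s1 N - c s1)) +
    ((euler N j - euler N i - (jj - ii) *: q) + ((jj - ii) - (s2 - s1)) *: q).
  rewrite /a -/i -/j; move: (euler N j) (euler N i) (c s2) (c s1) (q) => *; vec_ring.
have n1 : `|- (a s2 N - c s2) + (a s1 N - c s1)| <= e1 / M + e1 / M.
  by apply: le_trans (ler_normD _ _) _; rewrite normrN lerD // ltW.
have n2 : `|((jj - ii) - (s2 - s1)) *: q| <= e1 / M * `|q|.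
  rewrite normrZ ler_wpM2r // ler_norml; move: i1 i2 j1 j2 k4; clearbody ii jj.
  by move: (e1 / M) (N.+1%:R^-1) => *; apply/andP; split; lra.
have n3 : (jj - ii) * e <= e * (s2 - s1) + e * (e1 / M).
  rewrite mulrC -mulrDr ler_wpM2l ?(ltW e0) //; move: i1 i2 j1 j2 k4.
  by clearbody ii jj; move: (e1 / M) (N.+1%:R^-1) => *; lra.
have n4 : e1 = e1 / M * (2 + `|q| + e) by rewrite -/M divfK // gt_eqF.
apply: le_trans (ler_normD _ _) _.
have n5 : `|(euler N j - euler N i - (jj - ii) *: q) +
    ((jj - ii) - (s2 - s1)) *: q| <= (jj - ii) * e + e1 / M * `|q|.
  by apply: le_trans (ler_normD _ _) (lerD est n2).
by rewrite [in X in _ <= X]n4; lra.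
Qed.

End Peano.

(** Backward time is the forward solution for the opposite field. For a merely continuous [w] this
    yields existence without uniqueness. *)
Lemma peano (R : realType) n (w : 'rV[R]_n -> 'rV[R]_n) (t0 : 'rV[R]_n) :
  continuous w -> exists2 d : R, 0 < d & exists2 c : R -> 'rV[R]_n, c 0 = t0 &
    forall s, `|s| < d -> is_derive s (1 : R) c (w (c s)).
Proof.
move=> wc.
have [d1 d10 [c1 c10 h1]] := peano_forward t0 wc.
have wNc : continuous (fun x => - w x).
  by move=> x; apply: continuousN; exact: wc.
have [d2 d20 [c2 c20 h2]] := peano_forward t0 wNc.
pose c s := if 0 <= s then c1 s else c2 (- s).
pose d := Num.min d1 d2.
exists d; first by rewrite lt_min d10.
have cp s : 0 <= s -> c s = c1 s by rewrite /c => ->.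
have cn s : s <= 0 -> c s = c2 (- s).
  rewrite /c => s0; case: leP => // h; have -> : s = 0 by lra.
  by rewrite oppr0 c10 c20.
exists c; first by rewrite cp.
move=> s; rewrite lt_min => /andP[sd1 sd2]; apply: is_derive_eps => e e0.
have P1 : 0 <= s -> exists2 h : R, 0 < h & forall u, 0 <= u -> `|u - s| < h ->
    `|c u - c s - (u - s) *: w (c s)| <= e * `|u - s|.
  move=> s0; have I : 0 <= s < d1 by rewrite s0 (le_lt_trans (ler_norm _)).
  have [h h0 hh] := h1 s e I e0.
  have hd : 0 < d1 - s by case/andP: I => _ ?; rewrite subr_gt0.
  exists (Num.min h (d1 - s)) => [|u u0]; first by rewrite lt_min h0.
  rewrite lt_min => /andP[us ud]; rewrite !cp //.
  have ss : `|s - s| < h by rewrite subrr normr0.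
  have ud1 : u < d1 by move: ud => /(le_lt_trans (ler_norm _)); lra.
  case: (leP s u) => su.
    rewrite (ger0_norm (x := u - s)) ?subr_ge0 //.
    by apply: hh => //; rewrite s0.
  rewrite (ltr0_norm (x := u - s)) ?subr_lt0 // opprB.
  have := hh u s _ _ us ss; rewrite u0 (ltW su) => /(_ isT); case/andP: I => _ ->.
  move=> /(_ isT) hle; apply: le_trans hle.
  rewrite -normrN le_eqVlt; apply/predU1P; left; congr `|_|.
  by move: (c1 s) (c1 u) (w _) => x y z; vec_ring.
have P2 : s <= 0 -> exists2 h : R, 0 < h & forall u, u <= 0 -> `|u - s| < h ->
    `|c u - c s - (u - s) *: w (c s)| <= e * `|u - s|.
  move=> s0; have I : 0 <= - s < d2.
    by rewrite oppr_ge0 s0 /= (le_lt_trans (ler_norm _)) // normrN.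
  have [h h0 hh] := h2 (- s) e I e0.
  have hd : 0 < d2 + s by case/andP: I => _ ?; lra.
  exists (Num.min h (d2 + s)) => [|u u0]; first by rewrite lt_min h0.
  rewrite lt_min => /andP[us ud]; rewrite !cn //.
  have ss : `|- s - - s| < h by rewrite subrr normr0.
  have us' : `|- u - - s| < h by rewrite -opprD normrN.
  have ud1 : - u < d2 by move: ud; rewrite distrC => /(le_lt_trans (ler_norm _)); lra.
  have u0' : 0 <= - u by rewrite oppr_ge0.
  case: (leP s u) => su.
    rewrite (ger0_norm (x := u - s)) ?subr_ge0 //.
    have := hh (- u) (- s) _ _ us' ss; rewrite u0' lerN2 su => /(_ isT).
    case/andP: I => _ -> /(_ isT); rewrite opprK (addrC (- s)).
    move=> hle; apply: le_trans hle.
    rewrite -normrN le_eqVlt; apply/predU1P; left; congr `|_|.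
    by move: (c2 _) (c2 _) (w _) => x y z; vec_ring.
  rewrite (ltr0_norm (x := u - s)) ?subr_lt0 //.
  have := hh (- s) (- u) _ ud1 ss us'; case/andP: I => -> _.
  rewrite lerN2 (ltW su) => /(_ isT); rewrite opprK opprB (addrC (- u)).
  move=> hle; apply: le_trans hle.
  rewrite le_eqVlt; apply/predU1P; left; congr `|_|.
  by move: (c2 _) (c2 _) (w _) => x y z; vec_ring.
case: (ltrgtP s 0) => s0.
- have [h h0 hh] := P2 (ltW s0); exists (Num.min h (- s)).
    by rewrite lt_min h0 oppr_gt0.
  move=> u; rewrite lt_min => /andP[us us0]; apply: hh => //.
  by move: us0 => /(le_lt_trans (ler_norm _)); lra.
- have [h h0 hh] := P1 (ltW s0); exists (Num.min h s); first by rewrite lt_min h0.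
  move=> u; rewrite lt_min => /andP[us us0]; apply: hh => //.
  by move: us0; rewrite distrC => /(le_lt_trans (ler_norm _)); lra.
have [h h0 hh] : exists2 h : R, 0 < h & forall u, 0 <= u -> `|u - s| < h ->
    `|c u - c s - (u - s) *: w (c s)| <= e * `|u - s| by apply: P1; rewrite s0.
have [h' h'0 hh'] : exists2 h : R, 0 < h & forall u, u <= 0 -> `|u - s| < h ->
    `|c u - c s - (u - s) *: w (c s)| <= e * `|u - s| by apply: P2; rewrite s0.
exists (Num.min h h') => [|u]; first by rewrite lt_min h0.
by rewrite lt_min => /andP[uh uh']; case: (leP 0 u) => [/hh|/ltW/hh']; apply.
Qed.

(** * Curves tangent to a line field inside a two-dimensional plaque *)

Section IntegralCurves.
Variable R : realType.
Local Notation V := 'rV[R]_3.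

Lemma cont_mulmx m n p (U : normedModType R) (f : U -> 'M[R]_(m, n))
    (g : U -> 'M[R]_(n, p)) :
  continuous f -> continuous g -> continuous (fun x => f x *m g x).
Proof.
move=> fc gc x; apply/continuous_atP => e e0.
pose B := `|f x| + `|g x| + 1.
have B0 : 0 < B by rewrite ltr_wpDl // addr_ge0.
pose M := n%:R * (B + B) + 1.
have M0 : 0 < M by rewrite ltr_wpDl // mulr_ge0 // addr_ge0 // ltW.
have e10 : 0 < Num.min 1 (e / M) by rewrite lt_min ltr01 divr_gt0.
have [d d0 hd] := continuousP_eps fc x e10.
have [d' d'0 hd'] := continuousP_eps gc x e10.
exists (Num.min d d') => [|y]; first by rewrite lt_min d0.
rewrite lt_min => /andP[/hd + /hd']; rewrite !lt_min.
move=> /andP[f1 f2] /andP[g1 g2].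
have -> : f y *m g y - f x *m g x = (f y - f x) *m g y + f x *m (g y - g x).
  by rewrite mulmxBl mulmxBr addrA subrK.
have gB : `|g y| <= B.
  rewrite -(subrK (g x) (g y)); apply: le_trans (ler_normD _ _) _.
  by rewrite /B; have := normr_ge0 (f x); lra.
have fB : `|f x| <= B by rewrite /B; have := normr_ge0 (g x); lra.
apply: le_lt_trans (ler_normD _ _) _.
have h1 : `|(f y - f x) *m g y| <= n%:R * (e / M * B).
  by apply: le_trans (mulmx_norm_le _ _) _; rewrite ler_wpM2l // ler_pM // ltW.
have h2 : `|f x *m (g y - g x)| <= n%:R * (B * (e / M)).
  by apply: le_trans (mulmx_norm_le _ _) _; rewrite ler_wpM2l // ler_pM // ltW.
apply: le_lt_trans (lerD h1 h2) _.
have -> : n%:R * (e / M * B) + n%:R * (B * (e / M)) = e / M * (M - 1).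
  by rewrite /M; ring.
rewrite mulrBr divfK ?gt_eqF // mulr1.
have eM : 0 < e / M by rewrite divr_gt0.
by lra.
Qed.

Lemma cont_matrix m n (U : normedModType R) (f : U -> 'M[R]_(m, n)) :
  (forall i j, continuous (fun x => f x i j)) -> continuous f.
Proof.
move=> fc x; apply/continuous_atP => e e0.
have [d d0 hd] : exists2 d : R, 0 < d & forall ij : 'I_m * 'I_n,
    forall y, `|y - x| < d -> `|f y ij.1 ij.2 - f x ij.1 ij.2| < e / 2.
  have e20 : 0 < e / 2 by rewrite divr_gt0.
  have /fin_all_exists2[g g0 hg] : forall ij : 'I_m * 'I_n, exists2 d : R, 0 < d &
      forall y, `|y - x| < d -> `|f y ij.1 ij.2 - f x ij.1 ij.2| < e / 2.
    by move=> [i j] /=; exact: (continuousP_eps (fc i j) x e20).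
  exists (\big[Num.min/1]_ij g ij); first by apply/bigmin_gtP.
  by move=> ij y yx; apply: hg; apply: lt_le_trans yx _; exact: bigmin_le.
exists d => // y yx; apply: le_lt_trans (_ : e / 2 < e).
  apply: mx_norm_le => [|i j]; first by rewrite divr_ge0 // ltW.
  by rewrite !mxE ltW // (hd (i, j)).
by rewrite ltr_pdivrMr // ltr_pMr // ltr1n.
Qed.

Lemma deriv_neq0_inj (f f' : R -> R) (a b : R) :
  (forall t, a <= t <= b -> is_derive t (1 : R) f (f' t)) ->
  (forall t, a <= t <= b -> f' t != 0) ->
  forall s t, a <= s <= b -> a <= t <= b -> f s = f t -> s = t.
Proof.
move=> df f0 s t.
wlog st : s t / s <= t.
  by move=> h; case: (leP s t) => [|/ltW ts] sab tab e; [apply: h|apply/esym/h].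
move=> /andP[sa sb] /andP[ta tb] e.
have sub u : s <= u <= t -> a <= u <= b.
  by move=> /andP[? ?]; apply/andP; split; lra.
have [u||c cst E] := @MVT_segment R f f' s t st.
- by rewrite in_itv /= => /andP[/ltW us /ltW ut]; apply/df/sub; rewrite us.
- apply: within_continuous_segment => u /sub /df; exact: is_derive_continuous.
move: E; rewrite e subrr => /esym/eqP; rewrite mulf_eq0 subr_eq0.
rewrite in_itv /= in cst.
by rewrite (negPf (f0 c (sub c cst))) => /eqP ->.
Qed.

(** The chart restricted to the plaque is an immersion whose image plane contains the lines of [N].
    Pulling back a section of [N] gives a continuous planar field, to which Peano's theorem
    applies. *)
Lemma plaque_integral_curve (P1 P2 N : V -> 'M[R]_3) (phi : chart R 2) t0 c :
  line_field P1 -> line_field P2 -> line_field N ->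
  (forall x v, inF N x v -> sumF (inF P1) (inF P2) x v) ->
  is_chart (sumF (inF P1) (inF P2)) phi ->
  exists2 d : R, 0 < d & exists Y Y' : R -> V,
    [/\ Y 0 = phi t0 c, tcurve (inF N) Y Y' (- d) d,
        forall s, plaque phi (Y 0) (Y s) &
        forall s s', - d <= s <= d -> - d <= s' <= d -> Y s = Y s' -> s = s'].
Proof.
move=> [_ [_ P1p]] [_ [_ P2p]] [Nc [_ Np]] NE [_ _ _ sm].
have [[dphi cphi] tphi] := sm c.
set f : 'rV[R]_2 -> V := phi^~ c in dphi cphi tphi.
have fc : continuous f by move=> t; apply: differentiable_continuous.
pose v0 := nz_row (N (f t0)).
have v00 : v0 != 0.
  by have [_ [_ rk]] := Np (f t0); rewrite nz_row_eq0 -mxrank_eq0 rk.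
have v0N : v0 *m N (f t0) = v0.
  have [_ [NN _]] := Np (f t0).
  have /submxP[D ->] : (v0 <= N (f t0))%MS := nz_row_sub _.
  by rewrite -mulmxA NN.
pose J t : 'M[R]_(2, 3) := lin1_mx ('d f t).
have JE t v : v *m J t = 'd f t v by rewrite mul_rV_lin1.
have Jc : continuous J.
  apply: cont_matrix => i j.
  have -> : (fun t => J t i j) = (fun t => 'd f t (delta_mx ord0 i) ord0 j).
    by apply/funext => t; rewrite mxE.
  by apply: cont_coord; exact: cphi.
pose G t := J t *m (J t)^T.
pose n t := v0 *m N (f t).
(* Least squares with the Gram matrix [G] of the immersion. The adjugate replaces the inverse, so
   [w] is visibly continuous; the price is the nonzero factor [\det (G t)] in the velocity, which
   does not affect tangency. *)
pose w t := n t *m (J t)^T *m \adj (G t).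
have JTc : continuous (fun t => (J t)^T).
  apply: cont_matrix => i j.
  have -> : (fun t => (J t)^T i j) = (fun t => J t j i).
    by apply/funext => t; rewrite mxE.
  exact: cont_coord.
have Gc : continuous G by exact: cont_mulmx.
have nc : continuous n.
  apply: (@cont_mulmx _ _ _ _ (fun=> v0)); first exact: cont_cst.
  exact: cont_comp fc Nc.
have wc : continuous w.
  apply: cont_mulmx; first exact: cont_mulmx.
  apply: cont_matrix => i j.
  have -> : (fun t => \adj (G t) i j) =
      (fun t => (-1) ^+ (j + i) * G t (lift j ord0) (lift i ord0)).
    by apply/funext => t; rewrite !mxE /cofactor det_mx11 !mxE.
  apply: (@cont_comp _ _ _ _ (fun t => G t (lift j ord0) (lift i ord0))
    (fun x => (-1) ^+ (j + i) * x)); first exact: cont_coord.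
  by move=> x; exact: mulrl_continuous.
pose D t := \det (G t).
have inj t (a : 'rV[R]_2) : a *m J t = 0 -> a = 0 by rewrite JE; have [+ _] := tphi t; exact.
have D0 t : D t != 0.
  apply/negP => /det0P[v v0' vG].
  have : v *m J t = 0.
    apply/trmx_inj/eqP; rewrite trmx0; apply: contraT => /mul_trmx_gt0.
    by rewrite trmxK trmx_mul mulmxA -(mulmxA v) -/(G t) vG mul0mx mxE ltxx.
  by move/inj/eqP; rewrite (negPf v0').
have nJ t : exists a, n t = a *m J t.
  have rJ : \rank (J t) = 2%N.
    by apply/eqP; rewrite -/(row_free _); apply: inj_row_free => a; exact: inj.
  have JE12 : (J t <= P1 (f t) + P2 (f t))%MS.
    apply/row_subP => j; rewrite rowE JE.
    have [_ /(_ (delta_mx 0 j)) [a [b [aP [bP ->]]]]] := tphi t.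
    by apply: addmx_sub_adds; [rewrite -aP|rewrite -bP]; exact: submxMl.
  have r12 : (\rank (P1 (f t) + P2 (f t))%MS <= 2)%N.
    apply: leq_trans (mxrank_adds_leqif _ _) _.
    by have [_ [_ ->]] := P1p (f t); have [_ [_ ->]] := P2p (f t).
  have e12 : (P1 (f t) + P2 (f t) <= J t)%MS.
    by rewrite -(geq_leqif (mxrank_leqif_sup JE12)) rJ.
  apply/submxP; apply: submx_trans e12.
  have [a [b [aP [bP ->]]]] : sumF (inF P1) (inF P2) (f t) (n t).
    apply: NE; rewrite /inF /n -mulmxA; have [_ [-> _]] := Np (f t); by [].
  by apply: addmx_sub_adds; [rewrite -aP|rewrite -bP]; exact: submxMl.
have wE t : 'd f t (w t) = D t *: n t.
  have [a na] := nJ t.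
  by rewrite -JE /w na -(mulmxA a) -/(G t) -(mulmxA a) mul_mx_adj mul_mx_scalar scalemxAl.
have [i hi] := rV_norm_attained v0.
have [d1 d10 [g g0 dg]] := peano t0 wc.
have gc s : `|s| < d1 -> {for s, continuous g}.
  by move=> /dg; exact: is_derive_continuous.
have nn : 0 < `|v0 ord0 i| by rewrite hi normr_gt0.
have [d2 d20 hd2] := continuousP_eps (@cont_coord R _ _ _ n ord0 i nc) t0 nn.
have [d3 d30 hd3] : exists2 d : R, 0 < d & forall s, `|s - 0| < d -> `|g s - g 0| < d2.
  have /continuous_atP/(_ d2 d20) : {for 0, continuous g} by apply: gc; rewrite normr0.
  by [].
pose d := Num.min d1 d3 / 2.
have dd : 0 < d by rewrite divr_gt0 // lt_min d10.
have small s : - d <= s <= d -> `|s| < d1 /\ `|s| < d3.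
  rewrite -ler_norml => sd.
  suff : `|s| < Num.min d1 d3 by rewrite lt_min => /andP[].
  apply: le_lt_trans sd _; rewrite /d ltr_pdivrMr // ltr_pMr ?ltr1n //.
  by rewrite lt_min d10.
(* A coordinate of the section that stays nonzero provides both the nonzero velocity and, by Rolle,
   the injectivity of the curve. *)
have ni s : - d <= s <= d -> n (g s) ord0 i != 0.
  move=> /small[_ sd]; have := hd3 s; rewrite subr0 => /(_ sd); rewrite g0 => /hd2.
  rewrite /n v0N => h; apply/eqP => z; move: h.
  by rewrite z sub0r normrN ltxx.
exists d => //; exists (fun s => f (g s)), (fun s => 'd f (g s) (w (g s))).
split; first by rewrite g0.
- move=> s sd; have [s1 s3] := small s sd; split.
  + by apply: is_derive_comp_curve (dg s s1).
  + apply: continuous_diff_along; [by []|exact: gc|].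
    exact: (continuous_comp (gc s s1) (wc (g s))).
  + have [_ [NN _]] := Np (f (g s)).
    by rewrite wE /inF -scalemxAl /n -mulmxA NN.
  rewrite wE scaler_eq0 negb_or D0 /=; apply: contra (ni s sd) => /eqP ->.
  by rewrite mxE.
- by move=> s; exists (g 0), (g s), c.
move=> s s' sd sd' e.
apply: (@deriv_neq0_inj (fun s => f (g s) ord0 i)
  (fun s => 'd f (g s) (w (g s)) ord0 i) (- d) d) => //.
- move=> t td; apply: is_derive_coord; have [t1 _] := small t td.
  by apply: is_derive_comp_curve (dg t t1).
- by move=> t td; rewrite wE mxE mulf_neq0 // ni.
by rewrite e.
Qed.

End IntegralCurves.

(** * Flatness of the image of the us-foliation *)

Section LocalSubgroup.
Variable R : realType.

Lemma bounded_cluster n (a : nat -> 'rV[R]_n) (r : R) : (forall N, `|a N| <= r) ->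
  exists l, forall (e : R) N0, 0 < e -> exists2 N, (N0 <= N)%N & `|a N - l| < e.
Proof.
move=> ar; have [U [UF Uinf]] := @ultraFilterLemma nat \oo _.
have UPr : ProperFilter U by typeclasses eauto.
have [N|l hl] := @ultra_lim R n U a 0 r UF; first by rewrite subr0.
exists l => e N0 e0.
have U2 : U [set N | (N0 <= N)%N] by apply: Uinf; exists N0.
by have [N [/= h1 h2]] := filter_ex (filterI (hl e e0) U2); exists N.
Qed.

(* As in Cartan's closed subgroup theorem: directions of smaller and smaller
   elements of a closed local group accumulate on a line contained in it. *)
Lemma local_line n k (N : 'M[R]_(n, k)) (D : 'rV[R]_n -> Prop) (r : R) : 0 < r ->
  (forall w1 w2, `|w1| < r -> `|w2| < r -> D w1 -> D w2 -> D (w1 + w2)) ->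
  (forall w, `|w| < r -> D w -> D (- w)) ->
  (forall w, `|w| < r -> ~ D w -> exists2 e : R, 0 < e & forall w',
     `|w' - w| < e -> ~ D w') ->
  (forall e : R, 0 < e -> exists w, [/\ w != 0, `|w| < e, w *m N = 0 & D w]) ->
  exists l, [/\ l != 0, l *m N = 0 & forall s, `|s *: l| < r -> D (s *: l)].
Proof.
move=> r0 addD negD closedD small.
have seq j : exists w, [/\ w != 0, `|w| < j.+1%:R^-1, w *m N = 0 & D w].
  by apply: small; rewrite invr_gt0 ltr0n.
pose w j := sval (cid (seq j)).
have wP j : [/\ w j != 0, `|w j| < j.+1%:R^-1, w j *m N = 0 & D (w j)].
  exact: (svalP (cid (seq j))).
have w0 j : 0 < `|w j| by rewrite normr_gt0; case: (wP j).
pose a j := `|w j|^-1 *: w j.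
have a1 j : `|a j| = 1 by rewrite normrZ normfV normr_id mulVf // gt_eqF.
have aE j : a j = `|w j|^-1 *: w j by [].
clearbody a; have [l hl] := @bounded_cluster n a 1 ltac:(by move=> j; rewrite a1).
have l1 : `|l| = 1.
  apply/eqP; rewrite -subr_eq0 -normr_le0; apply/ler_addgt0Pr => e e0; rewrite add0r.
  have [j _ h] := hl e 0%N e0; rewrite -(a1 j).
  by apply: le_trans (ltW h); rewrite (distrC (a j)); exact: ler_dist_dist.
have lN : l *m N = 0.
  apply/eqP; rewrite -normr_le0; apply/ler_addgt0Pr => e e0; rewrite add0r.
  have M0 : 0 < n%:R * `|N| + 1 by rewrite ltr_wpDl // mulr_ge0.
  have [j _ h] := hl (e / (n%:R * `|N| + 1)) 0%N (divr_gt0 e0 M0).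
  have -> : l *m N = - ((a j - l) *m N).
    by rewrite mulmxBl aE -scalemxAl; case: (wP j) => _ _ -> _; rewrite scaler0 sub0r opprK.
  rewrite normrN; apply: le_trans (mulmx_norm_le _ _) _.
  rewrite mulrCA; move: h; rewrite ltr_pdivlMr // => /ltW h; apply: le_trans h.
  by rewrite ler_wpM2l // lerDl.
have pos s : 0 <= s < r -> D (s *: l).
  move=> /andP[s0 sr]; apply: contrapT => nD.
  have slr : `|s *: l| < r by rewrite normrZ l1 mulr1 ger0_norm.
  have [e e0 he] := closedD _ slr nD.
  have s10 : 0 < 2 * (s + 1) by rewrite mulr_gt0 // ltr_wpDl.
  have m0 : 0 < Num.min (e / 2) r by rewrite lt_min divr_gt0.
  have [j jN h] := hl (e / (2 * (s + 1))) (Num.trunc (Num.min (e / 2) r)^-1) (divr_gt0 e0 s10).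
  have [wj0 wj1 _ Dw] := wP j.
  have : `|w j| < Num.min (e / 2) r.
    apply: lt_trans wj1 _; rewrite invf_plt ?posrE ?ltr0n //.
    by apply: lt_le_trans (truncnS_gt _) _; rewrite ler_nat ltnS.
  rewrite lt_min => /andP[we wr].
  (* [m] copies of the small element [w j] reach [s *: l] up to the length of [w j] and the error in
     direction, each at most [e / 2]. *)
  pose m := Num.trunc (s / `|w j|).
  have /andP[m1 m2] : m%:R <= s / `|w j| < m.+1%:R.
    by apply: truncn_itv; rewrite divr_ge0.
  rewrite ler_pdivlMr // in m1; rewrite ltr_pdivrMr // -natr1 mulrDl mul1r in m2.
  apply: (he (m%:R *: w j)).
    have -> : m%:R *: w j - s *: l = (m%:R * `|w j| - s) *: a j + s *: (a j - l).
      rewrite scalerBr scalerBl addrA subrK aE scalerA.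
      by rewrite -mulrA mulfV ?mulr1 // gt_eqF.
    apply: le_lt_trans (ler_normD _ _) _; rewrite !normrZ a1 mulr1 (ger0_norm s0).
    have k1 : `|m%:R * `|w j| - s| <= e / 2.
      by rewrite ler_norml; apply/andP; split; lra.
    have k2 : s * `|a j - l| < e / 2.
      move: h; rewrite invfM mulrA ltr_pdivlMr ?ltr_wpDl // => h.
      apply: le_lt_trans h; rewrite mulrC ler_wpM2l // lerDl //.
    by lra.
  have : (m <= m)%N by [].
  move: {-2}m => i; elim: i => [|i IH] im.
    rewrite scale0r -[0](subrr (w j)); apply: addD => //; first by rewrite normrN.
    exact: negD.
  rewrite -natr1 scalerDl scale1r; apply: addD => //; last by apply: IH; exact: ltnW.
  rewrite normrZ normr_nat; apply: le_lt_trans sr; apply: le_trans m1.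
  by rewrite ler_wpM2r // ler_nat ltnW.
exists l; split=> //; first by rewrite -normr_gt0 l1.
move=> s; rewrite normrZ l1 mulr1 => sr; have [s0|s0] := leP 0 s.
  by apply: pos; rewrite s0 (le_lt_trans (ler_norm _)).
have sr' : - s < r by apply: le_lt_trans (ler_norm _) _; rewrite normrN.
rewrite -[s]opprK scaleNr; apply: negD.
  by rewrite normrZ l1 mulr1 normrN.
by apply: pos; rewrite sr' oppr_ge0 ltW.
Qed.

Lemma basis3_coord (b0 b1 b2 : 'rV[R]_3) :
  (forall x y z, x *: b0 + y *: b1 + z *: b2 = 0 -> [/\ x = 0, y = 0 & z = 0]) ->
  exists f0 f1 f2 : 'cV[R]_3, forall v : 'rV[R]_3,
    v = (v *m f0) ord0 ord0 *: b0 + (v *m f1) ord0 ord0 *: b1 + (v *m f2) ord0 ord0 *: b2.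
Proof.
move=> ind.
pose B : 'M[R]_3 := \matrix_(i, j)
  (if i == 0 then b0 ord0 j else if i == 1 then b1 ord0 j else b2 ord0 j).
have BE (v : 'rV[R]_3) : v *m B = v ord0 0 *: b0 + v ord0 1 *: b1 + v ord0 2 *: b2.
  rewrite mulmx_sum_row !big_ord_recl big_ord0 addr0 addrA.
  have e0 : row ord0 B = b0 by apply/rowP => j; rewrite !mxE.
  have e1 : row (lift ord0 ord0) B = b1 by apply/rowP => j; rewrite !mxE.
  have e2 : row (lift ord0 (lift ord0 ord0)) B = b2 by apply/rowP => j; rewrite !mxE.
  rewrite e0 e1 e2; congr (_ *: _ + _ *: _ + _ *: _); congr (v ord0 _);
    by apply/val_inj.
have Bu : B \in unitmx.
  rewrite -row_free_unit; apply: inj_row_free => v; rewrite BE => /ind[v0 v1 v2].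
  apply/rowP => -[[|[|[|//]]] i]; rewrite mxE; [rewrite -v0|rewrite -v1|rewrite -v2];
    congr (v _ _); exact: val_inj.
exists (col 0 (invmx B)), (col 1 (invmx B)), (col 2 (invmx B)) => v.
rewrite -{1}[v](mulmxKV Bu) BE.
by congr (_ *: _ + _ *: _ + _ *: _); rewrite !mxE; apply: eq_bigr => i _; rewrite mxE.
Qed.

End LocalSubgroup.

Lemma cont_scale (R : realType) (U W : normedModType R) (f : U -> R) (g : U -> W) :
  continuous f -> continuous g -> continuous (fun x => f x *: g x).
Proof. by move=> fc gc x; exact: (cvgZ (fc x) (gc x)). Qed.

(* A codimension-one foliation seen through its charts: [O p] is the domain of
   the chart at [p] and [X p] its transverse coordinate. *)
Section TranslationInvariance.
Variable R : realType.
Local Notation V := 'rV[R]_3.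

Variables (O : V -> set V) (X : V -> V -> R).
Hypothesis O_open : forall p, open (O p).
Hypothesis O_self : forall p, O p p.
Hypothesis X_cont : forall p x, O p x -> {for x, continuous (X p)}.
Hypothesis X_compat : forall p q x m, intvec m -> O p x -> O q (x + m) ->
  exists2 e : R, 0 < e & forall y, `|y - x| < e ->
    (X p x = X p y <-> X q (x + m) = X q (y + m)).
Hypothesis X_path : forall p r, 0 < r -> exists2 d : R, 0 < d &
  forall x y, `|x - p| < d -> `|y - p| < d -> X p x = X p y ->
  exists c : R -> V, [/\ continuous c, c 0 = x, c 1 = y &
    forall t, 0 <= t <= 1 -> `|c t - p| < r /\ X p (c t) = X p x].
Hypothesis X_noncst : forall p r, 0 < r -> exists2 y, `|y - p| < r & X p y <> X p p.
Variable u : V.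
Hypothesis u_sat : forall p, exists2 e : R, 0 < e & forall s, `|s| < e ->
  X p (p + s *: u) = X p p.
Hypothesis u_dense : forall v (e : R), 0 < e -> exists s m, intvec m /\
  `|v - (s *: u + m)| < e.

Lemma O_ball p x : O p x -> exists2 r : R, 0 < r & forall y, `|y - x| < r -> O p y.
Proof. by have /openP_eps h := O_open (p := p); move=> /h. Qed.

Lemma compat0 p q x : O p x -> O q x ->
  exists2 e : R, 0 < e & forall y, `|y - x| < e -> (X p x = X p y <-> X q x = X q y).
Proof.
move=> px qx; have := X_compat (intvec0 _) px; rewrite addr0 => /(_ q qx)[e e0 h].
by exists e => // y /h; rewrite addr0.
Qed.

Lemma small_scale (v : V) (r : R) : 0 < r -> exists2 d : R, 0 < d &
  forall s, `|s| < d -> `|s *: v| < r.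
Proof.
move=> r0; exists (r / (`|v| + 1)); first by rewrite divr_gt0 // ltr_wpDl.
move=> s; rewrite ltr_pdivlMr ?ltr_wpDl // normrZ => h; apply: le_lt_trans h.
by rewrite ler_wpM2l // lerDl.
Qed.

(** [u_sat] speaks of the chart centred at the point concerned. Continuation along the [u]-segment
    carries it to the fixed chart [p], with a size uniform near [x]. *)
Lemma flow_box p x : O p x -> exists2 d : R, 0 < d & forall y s,
  `|y - x| < d -> `|s| < d -> O p (y + s *: u) /\ X p (y + s *: u) = X p y.
Proof.
move=> px; have [r r0 hr] := O_ball px.
have r20 : 0 < r / 2 by rewrite divr_gt0.
have [d d0 hd] := small_scale u r20.
exists (Num.min d (r / 2)); first by rewrite lt_min d0.
move=> y s; rewrite !lt_min => /andP[_ yx] /andP[sd _].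
have inO t : `|t| < d -> O p (y + t *: u).
  move=> td; apply: hr; rewrite addrAC; apply: le_lt_trans (ler_normD _ _) _.
  by have := hd t td; lra.
split; first exact: inO.
pose S t := X p (y + t *: u) = X p y.
apply: (@segment_clopen R S (- `|s|) `|s| 0) => //.
- by rewrite oppr_le0 normr_ge0.
- by rewrite /S scale0r addr0.
- move=> t; rewrite -ler_norml => ts; have td := le_lt_trans ts sd.
  have [e e0 he] := u_sat (y + t *: u).
  have [e' e'0 he'] := compat0 (inO t td) (O_self (y + t *: u)).
  have [e2 e20 he2] := small_scale u e'0.
  exists (Num.min e e2); first by rewrite lt_min e0.
  move=> t' _; rewrite lt_min => /andP[h1 h2]; rewrite /S.
  suff <- : X p (y + t *: u) = X p (y + t' *: u) by [].
  have E : y + t' *: u = y + t *: u + (t' - t) *: u.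
    by rewrite -addrA -scalerDl (addrC t) subrK.
  apply/he'; first by rewrite E addrC addKr; exact: he2.
  by rewrite E he.
by rewrite -ler_norml.
Qed.

(** Staying in a leaf, expressed at each time in the chart centred at [c t]: the notion remains
    meaningful after translations so large that no chart is common to the curve and its
    translate. *)
Definition leafwise_at (c : R -> V) t := exists2 e : R, 0 < e & forall t',
  0 <= t' <= 1 -> `|t' - t| < e -> X (c t) (c t) = X (c t) (c t').

Lemma leafwise_chart (c : R -> V) t p : continuous c -> O p (c t) ->
  (leafwise_at c t <-> exists2 e : R, 0 < e & forall t',
    0 <= t' <= 1 -> `|t' - t| < e -> X p (c t) = X p (c t')).
Proof.
move=> cc pc; have [e1 e10 h1] := compat0 (O_self (c t)) pc.
have [e2 e20 h2] := continuousP_eps cc t e10.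
split=> -[e e0 h]; exists (Num.min e e2); rewrite ?lt_min ?e0 // => t' t01;
  rewrite lt_min => /andP[te te2]; apply/h1; by [apply: h2|apply: h].
Qed.

Lemma leafwise_cst c p : continuous c ->
  (forall t, 0 <= t <= 1 -> leafwise_at c t) ->
  (forall t, 0 <= t <= 1 -> O p (c t)) -> X p (c 0) = X p (c 1).
Proof.
move=> cc lw pc.
apply: (@segment_clopen R (fun t => X p (c 0) = X p (c t)) 0 1 0); rewrite ?lexx ?ler01 //.
move=> t t01; have /(leafwise_chart cc (pc t t01))[e e0 h] := lw t t01.
by exists e => // t' t'01 /(h t' t'01) ->.
Qed.

Lemma leafwise_shift_int c t m : continuous c -> intvec m ->
  leafwise_at c t -> leafwise_at (fun t => c t + m) t.
Proof.
move=> cc m_int [e e0 h].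
have [e1 e10 h1] := X_compat m_int (O_self (c t)) (O_self (c t + m)).
have [e2 e20 h2] := continuousP_eps cc t e10.
exists (Num.min e e2); first by rewrite lt_min e0.
by move=> t' t01; rewrite lt_min => /andP[te te2]; apply/h1; [exact: h2|exact: h].
Qed.

(** Continuation in [s]: a flow box changes [s] by a small amount without altering transverse
    coordinates, so arbitrarily long translations along [u] preserve leafwise curves. *)
Lemma leafwise_shift_u c t s : continuous c ->
  leafwise_at c t -> leafwise_at (fun t => c t + s *: u) t.
Proof.
move=> cc lw; have cs s' : continuous (fun t => c t + s' *: u).
  by apply: cont_add => //; exact: cont_cst.
apply: (@real_clopen R (fun s => leafwise_at (fun t => c t + s *: u) t) 0).
  rewrite (_ : (fun t => c t + 0 *: u) = c) //.
  by apply/funext => ?; rewrite scale0r addr0.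
move=> s0; have [d d0 hd] := flow_box (O_self (c t + s0 *: u)).
exists d => // s1 s10; set q := c t + s0 *: u in hd.
have [e e0 he] := continuousP_eps (cs s0) t d0.
have E t' : c t' + s1 *: u = (c t' + s0 *: u) + (s1 - s0) *: u.
  by rewrite -addrA -scalerDl (addrC s0) subrK.
have qq : `|q - q| < d by rewrite subrr normr0.
have Oq1 : O q (c t + s1 *: u) by rewrite E; case: (hd q (s1 - s0) qq s10).
rewrite (leafwise_chart (cs s0) (O_self q)) (leafwise_chart (cs s1) Oq1).
have Xq t' : `|t' - t| < e -> X q (c t' + s1 *: u) = X q (c t' + s0 *: u).
  by move=> /he te; rewrite E; case: (hd _ (s1 - s0) te s10).
have tt : `|t - t| < e by rewrite subrr normr0.
split=> -[e1 e10 h]; exists (Num.min e e1); rewrite ?lt_min ?e0 //;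
  move=> t' t01; rewrite lt_min => /andP[te te1].
  by rewrite !Xq //; exact: h.
by rewrite -!Xq //; exact: h.
Qed.

(** Translations by [s *: u + m] preserve leafwise curves and are dense among all translations. A
    path in the plaque from [x] to [y] is moved by one of them close to [v]: its translate is
    leafwise inside one chart, so its ends have equal transverse coordinate. Continuity of [X p]
    then gives the claim for [v] itself. *)
Lemma local_translation p : exists2 r : R, 0 < r & forall x y v,
  `|x - p| < r -> `|y - p| < r -> `|v| < r ->
  [/\ O p (x + v), O p (y + v) &
      X p x = X p y -> X p (x + v) = X p (y + v)].
Proof.
have [r r0 hr] := O_ball (O_self p).
have r20 : 0 < r / 2 by rewrite divr_gt0.
have [d d0 hd] := X_path p r20.
exists (Num.min d (r / 4)); first by rewrite lt_min d0 divr_gt0.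
move=> x y v; rewrite !lt_min => /andP[xd x4] /andP[yd y4] /andP[_ v4].
have inO z w : `|z - p| < r / 2 -> `|w| < r / 2 -> O p (z + w).
  move=> zp wr; apply: hr; rewrite addrAC.
  by apply: le_lt_trans (ler_normD _ _) _; lra.
have x2 : `|x - p| < r / 2 by lra.
have y2 : `|y - p| < r / 2 by lra.
have v2 : `|v| < r / 2 by lra.
split; [exact: inO|exact: inO|move=> exy].
have [c [cc c0 c1 hc]] := hd x y xd yd exy.
have cO t : 0 <= t <= 1 -> O p (c t).
  by move=> /hc[h _]; rewrite -(addr0 (c t)); apply: inO; rewrite ?normr0.
have lwc t : 0 <= t <= 1 -> leafwise_at c t.
  move=> t01; apply/(leafwise_chart cc (cO t t01)); exists 1 => // t' t'01 _.
  by have [_ ->] := hc t t01; have [_ ->] := hc t' t'01.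
have key s m : intvec m -> `|s *: u + m| < r / 2 ->
    X p (x + (s *: u + m)) = X p (y + (s *: u + m)).
  move=> m_int small.
  have csm : continuous (fun t => c t + s *: u + m).
    by apply: cont_add; [apply: cont_add => //|]; exact: cont_cst.
  have := @leafwise_cst (fun t => c t + s *: u + m) p csm.
  rewrite c0 c1 -!addrA; apply => t t01.
    apply: (@leafwise_shift_int (fun t => c t + s *: u)) => //.
      by apply: cont_add => //; exact: cont_cst.
    by apply: leafwise_shift_u => //; exact: lwc.
  by rewrite -addrA; apply: inO => //; case: (hc t t01).
apply/eqP/contraT => /eqP ne; exfalso.
have h0 : 0 < `|X p (x + v) - X p (y + v)| / 2.
  by rewrite divr_gt0 // normr_gt0 subr_eq0; apply/eqP.
have [/continuous_atP cx /continuous_atP cy] :=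
  (X_cont (inO _ _ x2 v2), X_cont (inO _ _ y2 v2)).
have [e1 e10 h1] := cx _ h0; have [e2 e20 h2] := cy _ h0.
have e30 : 0 < Num.min (Num.min e1 e2) (r / 4).
  by rewrite !lt_min e10 e20 divr_gt0.
have [s [m [m_int]]] := u_dense v e30.
set w := s *: u + m; rewrite !lt_min distrC => /andP[/andP[w1 w2] w3].
have wr : `|w| < r / 2.
  by rewrite -(subrK v w); apply: le_lt_trans (ler_normD _ _) _; lra.
have := key s m m_int wr; rewrite -/w => ew.
have := h1 (x + w); rewrite opprD addrACA subrr add0r => /(_ w1) k1.
have := h2 (y + w); rewrite opprD addrACA subrr add0r => /(_ w2) k2.
have : `|X p (x + v) - X p (y + v)| <=
    `|X p (x + w) - X p (x + v)| + `|X p (y + w) - X p (y + v)|.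
  rewrite (distrC (X p (x + w))) ew -(subrKA (X p (y + w)) (X p (x + v))).
  exact: ler_normD.
by lra.
Qed.

Definition flat_at (n : 'cV[R]_3) p := exists2 e : R, 0 < e & forall v, `|v| < e ->
  O p (p + v) /\ (X p (p + v) = X p p <-> v *m n = 0).

(** The translation by [q - p] carries the level set through [p] to the one through [q], both read
    in the chart at [p]; [compat0] then passes to the chart at [q]. *)
Lemma flat_local p : exists2 r : R, 0 < r & forall q n, `|q - p| < r ->
  (flat_at n p <-> flat_at n q).
Proof.
have [r r0 hr] := local_translation p.
exists (r / 2) => [|q n qp]; first by rewrite divr_gt0.
have qr : `|q - p| < r by lra.
have pr : `|p - p| < r by rewrite subrr normr0.
have r0' : `|0 : V| < r by rewrite normr0.
have Oq : O p q by have [+ _ _] := hr q p 0 qr pr r0'; rewrite addr0.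
have [e1 e10 h1] := compat0 Oq (O_self q).
have [e2 e20 h2] := O_ball (O_self q).
have [e3 e30 h3] := O_ball (O_self p).
have E v : `|v| < r / 2 -> (X p (p + v) = X p p <-> X p (q + v) = X p q).
  move=> vr; have vr' : `|v| < r by lra.
  have pv : `|p + v - p| < r by rewrite addrC addKr.
  have qv : `|q + v - p| < r.
    by rewrite addrAC; apply: le_lt_trans (ler_normD _ _) _; lra.
  split=> h.
    have [_ _ /(_ h)] := hr (p + v) p (q - p) pv pr qr.
    have -> : p + v + (q - p) = q + v by vec_ring.
    by have -> : p + (q - p) = q by vec_ring.
  have pq : `|p - q| < r by rewrite distrC.
  have [_ _ /(_ h)] := hr (q + v) q (p - q) qv qr pq.
  have -> : q + v + (p - q) = p + v by vec_ring.
  by have -> : q + (p - q) = p by vec_ring.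
have E' v : `|v| < r / 2 -> `|v| < e1 ->
    (X p (p + v) = X p p <-> X q (q + v) = X q q).
  move=> vr v1; have qv : `|q + v - q| < e1 by rewrite addrC addKr.
  by have [k1 k2] := h1 _ qv; rewrite E //; split=> /esym h; apply/esym; auto.
have m0 e : 0 < e -> 0 < Num.min (Num.min e (r / 2)) (Num.min e1 (Num.min e2 e3)).
  by move=> e0; rewrite !lt_min e0 divr_gt0 // e10 e20.
split=> -[e e0 h]; exists (Num.min (Num.min e (r / 2)) (Num.min e1 (Num.min e2 e3)));
  rewrite ?m0 // => v; rewrite !lt_min => /andP[/andP[ve vr] /and3P[v1 v2 v3]].
  split; first by apply: h2; rewrite addrC addKr.
  by rewrite -E' //; case: (h v ve).
split; first by apply: h3; rewrite addrC addKr.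
by rewrite E' //; case: (h v ve).
Qed.

Lemma flat_everywhere n p q : flat_at n p -> flat_at n q.
Proof.
move=> fp; pose c (s : R) := p + s *: (q - p).
have cc : continuous c.
  move=> s; apply: is_derive_continuous; exact: is_derive_affine.
have -> : q = c 1 by rewrite /c scale1r addrC subrK.
apply: (@real_clopen R (fun s => flat_at n (c s)) 0).
  by rewrite /c scale0r addr0.
move=> s; have [r r0 hr] := flat_local (c s).
have [d d0 hd] := continuousP_eps cc s r0.
by exists d => // t /hd; exact: hr.
Qed.

Lemma small_coord (f : 'cV[R]_3) (b : V) (e : R) : 0 < e -> exists2 d : R, 0 < d &
  forall v : V, `|v| < d -> `|(v *m f) ord0 ord0 *: b| < e.
Proof.
move=> e0; have [d d0 hd] := small_scale b e0.
have M0 : 0 < 3 * `|f| + 1 by rewrite ltr_wpDl // mulr_ge0.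
exists (d / (3 * `|f| + 1)) => [|v]; first by rewrite divr_gt0.
rewrite ltr_pdivlMr // => h; apply: hd; apply: le_lt_trans h.
apply: le_trans (mx_entry_le _ _ _) (le_trans (mulmx_norm_le _ _) _).
by rewrite mulrCA ler_wpM2l // lerDl.
Qed.

(** The small translations [D] fixing the level set of [p] form a closed local group containing the
    direction [u]. A second direction comes from an intermediate value argument; a third would make
    [X p] locally constant. Hence [D] is locally a plane, and [n] is its normal. *)
Lemma flat_exists (z : 'cV[R]_3) (p : V) : u *m z = 1%:M ->
  exists n : 'cV[R]_3, [/\ n != 0, u *m n = 0 & forall q, flat_at n q].
Proof.
move=> uz.
have uz1 : (u *m z) ord0 ord0 = 1 by rewrite uz mxE.
have [r r0 hr] := local_translation p.
pose D w := X p (p + w) = X p p.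
have pr : `|p - p| < r by rewrite subrr normr0.
have sh w : `|w| < r -> `|p + w - p| < r by rewrite addrC addKr.
have addD w1 w2 : `|w1| < r -> `|w2| < r -> D w1 -> D w2 -> D (w1 + w2).
  move=> r1 r2 D1 D2; have [_ _ /(_ D1)] := hr (p + w1) p w2 (sh _ r1) pr r2.
  by rewrite -addrA /D => ->.
have subD w1 w2 : `|w1| < r -> `|w2| < r -> X p (p + w1) = X p (p + w2) -> D (w2 - w1).
  move=> r1 r2 D12; have r1' : `|- w1| < r by rewrite normrN.
  have [_ _ /(_ D12)] := hr _ _ (- w1) (sh _ r1) (sh _ r2) r1'.
  by rewrite addrK -addrA /D => <-.
have r00 : `|0 : V| < r by rewrite normr0.
have negD w : `|w| < r -> D w -> D (- w).
  by move=> wr Dw; rewrite -sub0r; apply: subD => //; rewrite Dw addr0.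
have Op w : `|w| < r -> O p (p + w).
  by move=> wr; have [] := hr p p w pr pr wr.
have closedD w : `|w| < r -> ~ D w -> exists2 e : R, 0 < e & forall w',
    `|w' - w| < e -> ~ D w'.
  move=> wr nD; have /continuous_atP cX := X_cont (Op w wr).
  have e0 : 0 < `|X p (p + w) - X p p| by rewrite normr_gt0 subr_eq0; apply/eqP.
  have [e e00 he] := cX _ e0; exists e => // w' w'w Dw'.
  have := he (p + w'); rewrite opprD addrACA subrr add0r Dw' => /(_ w'w).
  by rewrite distrC ltxx.
have [d [d0 du dr]] : exists d : R, [/\ 0 < d, forall s, `|s| < d -> D (s *: u) & d <= r].
  have [e e0 he] := u_sat p; exists (Num.min e r).
  by split=> [|s|]; rewrite ?ge_min ?lexx ?orbT // lt_min ?e0 // => /andP[/he].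
have ker2 : exists p1 p2 : V, [/\ p1 *m z = 0, p2 *m z = 0 &
    forall x y, x *: p1 + y *: p2 = 0 -> x = 0 /\ y = 0].
  have [i ui] : exists i, u ord0 i != 0.
    have [i hi] := rV_norm_attained u; exists i.
    rewrite -normr_gt0 hi normr_gt0; apply: contra_eq_neq uz => ->.
    by rewrite mul0mx eq_sym oner_eq0.
  (* The two standard vectors other than the [i]-th, projected along [u], remain independent because
     [u] has a nonzero [i]-th coordinate. *)
  pose dl (j : 'I_2) : V := delta_mx ord0 (lift i j).
  pose q (j : 'I_2) : V := dl j - (dl j *m z) ord0 ord0 *: u.
  exists (q ord0), (q ord_max).
  have qz j : q j *m z = 0.
    rewrite mulmxBl -scalemxAl uz; apply/matrixP => a b; rewrite !ord1 mxE.
    by move: (_ *m z) => y; rewrite !mxE mulr1 subrr.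
  have qc j k : q j ord0 (lift i k) = (k == j)%:R -
      (dl j *m z) ord0 ord0 * u ord0 (lift i k).
    by rewrite /q; move: (dl j *m z) => y; rewrite !mxE /= (inj_eq lift_inj).
  have qi j : q j ord0 i = - ((dl j *m z) ord0 ord0 * u ord0 i).
    rewrite /q; move: (dl j *m z) => y; rewrite !mxE /=.
    by rewrite (negPf (neq_lift i j)) sub0r.
  clearbody q; split=> // x y h.
  have hc k := congr1 (fun v : V => v ord0 k) h.
  have h2 := hc i; rewrite !mxE !qi in h2.
  set a := (dl ord0 *m z) ord0 ord0 in h2.
  set b := (dl ord_max *m z) ord0 ord0 in h2.
  have h3 : x * a + y * b = 0.
    apply: (mulIf ui); rewrite mul0r; lra.
  have := hc (lift i ord0); have := hc (lift i ord_max); rewrite !mxE !qc /= -/a -/b => k1 k2.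
  have f1 : (ord_max == ord0 :> 'I_2) = false by [].
  have f2 : (ord0 == ord_max :> 'I_2) = false by [].
  rewrite ?f1 ?f2 ?eqxx /= ?mulr0n ?mulr1n in k1 k2.
  have E0 (w : R) : (x * a + y * b) * w = 0 by rewrite h3 mul0r.
  have := E0 (u ord0 (lift i ord0)); have := E0 (u ord0 (lift i ord_max)).
  by split; lra.
have small (e : R) : 0 < e -> exists w, [/\ w != 0, `|w| < e, w *m z = 0 & D w].
  move=> e0; have [p1 [p2 [p1z p2z ind]]] := ker2.
  pose M := `|p1| + `|p2| + 1.
  have M0 : 0 < M by rewrite ltr_wpDl // addr_ge0.
  have er0 : 0 < Num.min e r by rewrite lt_min e0.
  pose e1 := Num.min e r / (4 * M).
  have e10 : 0 < e1 by rewrite divr_gt0 // mulr_gt0.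
  have e1M : e1 * M = Num.min e r / 4.
    by rewrite /e1 invfM mulrA mulfVK // gt_eqF.
  (* A Borsuk-Ulam argument on a circle: this arc avoids 0 and joins [- p1] to [p1], so the
     difference of [X p] at opposite points changes sign along it. At a zero, the two opposite
     points lie on one level and their difference belongs to [D]. *)
  pose v (t : R) := t *: p1 + (1 - t ^+ 2) *: p2.
  have vM t : -1 <= t <= 1 -> `|v t| <= M.
    move=> /andP[t1 t2]; apply: le_trans (ler_normD _ _) _; rewrite !normrZ.
    have h1 : `|t| <= 1 by rewrite ler_norml t1.
    have h2 : `|1 - t ^+ 2| <= 1 by rewrite ler_norml; apply/andP; split; nra.
    rewrite /M; have h3 : `|t| * `|p1| <= `|p1| by rewrite ler_piMl.
    have h4 : `|1 - t ^+ 2| * `|p2| <= `|p2| by rewrite ler_piMl.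
    by lra.
  have ev t s : -1 <= t <= 1 -> `|s| = e1 -> `|s *: v t| < Num.min e r / 2.
    move=> /vM h sE; rewrite normrZ sE; apply: (@le_lt_trans _ _ (e1 * M)).
      by rewrite ler_wpM2l // ltW.
    by rewrite e1M; lra.
  have evr t s : -1 <= t <= 1 -> `|s| = e1 -> `|s *: v t| < r.
    move=> h1 h2; apply: lt_le_trans (ev t s h1 h2) _.
    have : Num.min e r <= r by rewrite ge_min lexx orbT.
    by lra.
  have vc s : continuous (fun t => p + s *: v t).
    apply: cont_add; first exact: cont_cst.
    apply: cont_scale; first exact: cont_cst.
    apply: cont_add; apply: cont_scale; try exact: cont_cst; first exact: cont_id.
    apply: cont_sub; first exact: cont_cst.
    by move=> t; exact: exprn_continuous.
  have en1 : `|e1| = e1 by rewrite gtr0_norm.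
  have en2 : `|- e1| = e1 by rewrite normrN gtr0_norm.
  pose g t := X p (p + e1 *: v t) - X p (p + (- e1) *: v t).
  have godd : g (-1) = - g 1.
    have vN : v (-1) = - v 1 by rewrite /v sqrrN expr1n subrr !scale0r !addr0 scaleN1r scale1r.
    by rewrite /g vN !scalerN !scaleNr opprK opprB.
  have [|||t t1 gt] := @segment_ivt R g (-1) 1 0.
  - by lra.
  - move=> t t1; apply: continuousB.
      exact: (continuous_comp (vc e1 t) (X_cont (Op _ (evr _ _ t1 en1)))).
    exact: (continuous_comp (vc (- e1) t) (X_cont (Op _ (evr _ _ t1 en2)))).
  - rewrite godd oppr_le0 oppr_ge0; case: (leP 0 (g 1)) => h; [left|right] => //.
    by rewrite (ltW h).
  have v0 : v t != 0.
    by apply/eqP => /ind[t0 t2]; move: t2; rewrite t0 expr0n subr0 => /eqP; rewrite oner_eq0.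
  exists (e1 *: v t - (- e1) *: v t); split.
  - by rewrite -scalerBl opprK scaler_eq0 negb_or v0 -mulr2n mulrn_eq0 /= gt_eqF.
  - apply: le_lt_trans (ler_normB _ _) _.
    have := ev t _ t1 en1; have := ev t _ t1 en2.
    have : Num.min e r <= e by rewrite ge_min lexx.
    by lra.
  - by rewrite mulmxBl -!scalemxAl mulmxDl -!scalemxAl p1z p2z !scaler0 addr0 !scaler0 subr0.
  apply: subD; [exact: evr|exact: evr|].
  by move/eqP: gt; rewrite subr_eq0 => /eqP ->.
have [w0 [w00 w0z Dw0]] := local_line r0 addD negD closedD small.
have [n [n0 un w0n]] : exists n : 'cV[R]_3, [/\ n != 0, u *m n = 0 & w0 *m n = 0].
  pose C := row_mx u^T w0^T.
  have K0 : kermx C != 0.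
    rewrite -mxrank_eq0 mxrank_ker -lt0n subn_gt0.
    by apply: leq_ltn_trans (rank_leq_col C) _.
  have : nz_row (kermx C) *m C = 0.
    by apply/sub_kermxP; exact: nz_row_sub.
  rewrite mul_mx_row -[0]hsubmxK => /eq_row_mx[h1 h2].
  exists (nz_row (kermx C))^T; split.
  - by rewrite trmx_eq0 nz_row_eq0.
  - by apply: trmx_inj; rewrite trmx_mul trmxK h1; apply/matrixP => i j; rewrite !mxE.
  by apply: trmx_inj; rewrite trmx_mul trmxK h2; apply/matrixP => i j; rewrite !mxE.
pose w1 := n^T.
have w1n : 0 < (w1 *m n) ord0 ord0 by exact: mul_trmx_gt0.
have ind x y t : x *: u + y *: w0 + t *: w1 = 0 -> [/\ x = 0, y = 0 & t = 0].
  move=> h; have := congr1 (fun v : V => (v *m n) ord0 ord0) h.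
  rewrite /= !mulmxDl -!scalemxAl un w0n !scaler0 !add0r mul0mx mxE [RHS]mxE => /eqP.
  rewrite mulf_eq0 (gt_eqF w1n) orbF => /eqP t0.
  have := congr1 (fun v : V => (v *m z) ord0 ord0) h.
  rewrite t0 scale0r addr0 /= mulmxDl -!scalemxAl w0z scaler0 addr0 mul0mx mxE uz1.
  rewrite mulr1 mxE => x0; split=> //.
  by move/eqP: h; rewrite t0 x0 !scale0r add0r addr0 scaler_eq0 (negPf w00) orbF => /eqP.
have [f0 [f1 [f2 fE]]] := basis3_coord ind.
have Duw a b : `|a| < d -> `|a *: u| < r -> `|b *: w0| < r -> D (a *: u + b *: w0).
  by move=> ad ar br; apply: addD => //; [exact: du|exact: Dw0].
have fn (v : V) : (v *m n) ord0 ord0 = (v *m f2) ord0 ord0 * (w1 *m n) ord0 ord0.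
  rewrite {1}[v]fE !mulmxDl -!scalemxAl un w0n !scaler0 !add0r.
  by rewrite [LHS]mxE.
have r20 : 0 < r / 2 by rewrite divr_gt0.
have r40 : 0 < r / 4 by rewrite divr_gt0.
have [d1 d10 h1] := small_coord f0 u r40.
have [d2 d20 h2] := small_coord f1 w0 r40.
have [d3 d30 h3] := small_coord f0 (const_mx 1 : V) d0.
have h3' (v : V) : `|v| < d3 -> `|(v *m f0) ord0 ord0| < d.
  move=> /h3; apply: le_lt_trans; rewrite -[X in X <= _]mulr1 normrZ ler_wpM2l //.
  by apply: le_trans (mx_entry_le (const_mx 1 : V) ord0 ord0); rewrite mxE normr1.
pose dd := Num.min (Num.min d1 d2) (Num.min d3 (r / 2)).
have dd0 : 0 < dd by rewrite !lt_min d10 d20 d30.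
have Dc (v : V) : `|v| < dd -> [/\ D ((v *m f0) ord0 ord0 *: u + (v *m f1) ord0 ord0 *: w0),
    `|(v *m f0) ord0 ord0 *: u + (v *m f1) ord0 ord0 *: w0| < r / 2 & `|v| < r / 2].
  rewrite !lt_min => /andP[/andP[v1 v2] /andP[v3 v4]].
  have k1 := h1 v v1; have k2 := h2 v v2.
  split=> //; last by apply: le_lt_trans (ler_normD _ _) _; lra.
  apply: Duw; [exact: h3'|by lra|by lra].
(* Otherwise arbitrarily small elements of [D] leave the plane of [u] and [w0]. Removing their
   components in that plane gives elements of [D] along [w1], hence a third direction, and [D] would
   fill a ball. *)
have [ee ee0 hee] : exists2 e : R, 0 < e & forall w : V, `|w| < e -> D w -> w *m n = 0.
  apply: contrapT => nex.
  have bad (e : R) : 0 < e -> exists w : V, [/\ `|w| < e, D w & (w *m n) ord0 ord0 != 0].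
    move=> e0; apply: contrapT => nw; apply: nex; exists e => // w we Dw.
    apply/matrixP => i j; rewrite !ord1 [RHS]mxE.
    by apply/eqP; apply: contraT => wn; exfalso; apply: nw; exists w.
  have [w1f0 w1f1] : (w1 *m f0) ord0 ord0 = 0 /\ (w1 *m f1) ord0 ord0 = 0.
    have := fE w1; set a := (_ *m f0) _ _; set b := (_ *m f1) _ _; set c := (_ *m f2) _ _.
    move=> /eqP; rewrite -subr_eq0 => /eqP h.
    have /ind[-> -> _] : a *: u + b *: w0 + (c - 1) *: w1 = 0; last by [].
    by rewrite scalerBl scale1r addrA -[LHS]opprK opprB h oppr0.
  have [|l [l0 lN Dl]] := @local_line R 3 (1 + 1) (row_mx f0 f1) D r r0 addD negD closedD.
    move=> e e0.
    have [d4 d40 h4] := small_coord f2 w1 e0.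
    have [w [wd Dw wn]] := bad (Num.min dd d4) ltac:(by rewrite lt_min dd0).
    move: wd; rewrite lt_min => /andP[wd wd4].
    have [D1 D2 D3] := Dc w wd.
    exists ((w *m f2) ord0 ord0 *: w1); split.
    - rewrite scaler_eq0 negb_or trmx_eq0 n0 andbT.
      by move: wn; rewrite fn mulf_eq0 negb_or => /andP[].
    - exact: h4.
    - rewrite -scalemxAl mul_mx_row.
      have -> : w1 *m f0 = 0 by apply/matrixP => i j; rewrite !ord1 w1f0 mxE.
      have -> : w1 *m f1 = 0 by apply/matrixP => i j; rewrite !ord1 w1f1 mxE.
      by rewrite row_mx0 scaler0.
    have -> : (w *m f2) ord0 ord0 *: w1 =
        w - ((w *m f0) ord0 ord0 *: u + (w *m f1) ord0 ord0 *: w0).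
      by apply/eqP; rewrite eq_sym subr_eq [X in _ == X]addrC -fE.
    by apply: subD; [lra|lra|rewrite D1 Dw].
  move: lN; rewrite mul_mx_row -[0]hsubmxK => /eq_row_mx[lf0 lf1].
  have lE : l = (l *m f2) ord0 ord0 *: w1.
    by rewrite {1}[l]fE lf0 lf1 !mxE !scale0r !add0r.
  have lc : (l *m f2) ord0 ord0 != 0.
    by apply: contra_neq l0 => e; rewrite lE e scale0r.
  have Dw1 s : `|s *: w1| < r -> D (s *: w1).
    have -> : s *: w1 = (s / (l *m f2) ord0 ord0) *: l.
      by rewrite {2}lE scalerA divfK.
    exact: Dl.
  have [d4 d40 h4] := small_coord f2 w1 r20.
  have [y yp] := X_noncst p (r := Num.min dd d4) ltac:(by rewrite lt_min dd0).
  move: yp; rewrite lt_min => /andP[y1 y2]; apply.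
  have [D1 D2 D3] := Dc _ y1; have D4 := h4 _ y2.
  have : D (y - p).
    rewrite [y - p]fE; apply: addD => //; [lra|lra|apply: Dw1; lra].
  by rewrite /D addrC subrK.
exists n; split=> // q; apply: (@flat_everywhere n p); exists (Num.min ee dd).
  by rewrite lt_min ee0.
move=> v; rewrite lt_min => /andP[ve vd]; have [D1 D2 D3] := Dc v vd.
split; first by apply: Op; lra.
split=> [|vn]; first exact: hee.
suff E : v = (v *m f0) ord0 ord0 *: u + (v *m f1) ord0 ord0 *: w0 by rewrite E.
have := fn v; rewrite vn mxE => /esym/eqP; rewrite mulf_eq0 (gt_eqF w1n) orbF => /eqP c0.
by rewrite {1}[v]fE c0 scale0r addr0.
Qed.

End TranslationInvariance.

(** * Flatness of a saturated foliation, from its charts *)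

Section FlatFoliation.
Variable R : realType.
Local Notation V := 'rV[R]_3.
Variables (H K : V -> V).
Hypothesis HK : cancel H K.
Hypothesis KH : cancel K H.
Hypothesis Hc : continuous H.
Hypothesis Kc : continuous K.
Hypothesis Ke : int_equivariant K.
Variables (E : V -> set V) (W : V -> chart R 2).
Hypothesis fol : is_foliation E W.
Local Notation T := ('rV[R]_2 * 'rV[R]_1)%type.

Let Phi p (tc : T) : V := W (K p) tc.1 tc.2.
Let Phi_inj p : injective (Phi p).
Proof. by have [[[_ inj _ _] _] _] := (fol.1 (K p), fol.2). Qed.
Let Phi_cont p : continuous (Phi p).
Proof. by have [[[cont _ _ _] _] _] := (fol.1 (K p), fol.2). Qed.
Let Phi_open p U : open U -> open (Phi p @` U).
Proof. by have [[[_ _ op _] _] _] := (fol.1 (K p), fol.2); exact: op. Qed.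
Let Phi_p p : exists tc, Phi p tc = K p.
Proof. by have [[_ [t [c e]]] _] := (fol.1 (K p), fol.2); exists (t, c). Qed.

Let O p : set V := [set x | exists tc, K x = Phi p tc].
(** The transverse parameter of [K x] in the chart centred at [K p]; the value 0 outside [O p] is a
    default. *)
Let X p x : R := if pselect (exists tc, K x = Phi p tc) is left h
  then (sval (cid h)).2 ord0 ord0 else 0.

Let X_Phi p x tc : K x = Phi p tc -> X p x = tc.2 ord0 ord0.
Proof.
move=> e; rewrite /X; case: pselect => [h|]; last by case; exists tc.
case: (cid h) => tc' /= e'; suff -> : tc' = tc by [].
by apply: (@Phi_inj p); rewrite -e' e.
Qed.

Let coord1 (c c' : 'rV[R]_1) : c ord0 ord0 = c' ord0 ord0 -> c = c'.
Proof. by move=> h; apply/rowP => j; rewrite !(ord1 j). Qed.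

Let nbhs_Phi p x (U : set T) tc : open U -> U tc -> K x = Phi p tc ->
  exists2 e : R, 0 < e & forall y, `|y - x| < e -> exists2 tc', U tc' & K y = Phi p tc'.
Proof.
move=> Uo Utc e; have /openP_eps h := @Phi_open p U Uo.
have [|d d0 hd] := h (K x); first by exists tc.
have [e1 e10 he] := continuousP_eps Kc x d0.
by exists e1 => // y /he /hd [tc' Utc' <-]; exists tc'.
Qed.

Let ballT_open (tc : T) (r : R) : open [set tc' : T | `|tc' - tc| < r].
Proof.
apply/openP_eps => t /= h; exists (r - `|t - tc|); first by rewrite subr_gt0.
move=> t' h'; rewrite -(subrKA t); apply: le_lt_trans (ler_normD _ _) _.
by rewrite -ltrBrDr.
Qed.

Let plaqueE p x y : plaque (W (K p)) (K x) (K y) <->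
  [/\ O p x, O p y & X p x = X p y].
Proof.
split.
  move=> [t [t' [c [e e']]]]; have ex : K x = Phi p (t, c) by [].
  have ey : K y = Phi p (t', c) by [].
  by split; [exists (t, c)|exists (t', c)|rewrite (X_Phi ex) (X_Phi ey)].
move=> [[[t c] ex] [[t' c'] ey]]; rewrite (X_Phi ex) (X_Phi ey) => /coord1 /= cc.
by exists t, t', c; split; [exact: ex|rewrite cc; exact: ey].
Qed.

Variables (u : V) (z : 'cV[R]_3).
Hypothesis uz : u *m z = 1%:M.
Hypothesis u_sat : forall x, exists2 e : R, 0 < e & forall s, `|s| < e ->
  plaque (W x) x (K (H x + s *: u)).
Hypothesis u_dense : forall v (e : R), 0 < e -> exists s m, intvec m /\
  `|v - (s *: u + m)| < e.

(** [flat_exists] describes level sets only near each point. A plaque may be large, so its flatness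
    is continued along a segment of the chart parameter. *)
Lemma flat_foliation : exists n : 'cV[R]_3, [/\ n != 0, u *m n = 0,
  (forall i x y, plaque (W i) x y -> (H y - H x) *m n = 0) &
  forall x, exists2 e : R, 0 < e & forall v, v *m n = 0 -> `|v| < e ->
    plaque (W x) x (K (H x + v))].
Proof.
have O_open p : open (O p).
  apply/openP_eps => x [tc e]; have [d d0 hd] := @nbhs_Phi p x setT tc openT I e.
  by exists d => // y /hd [tc' _ e']; exists tc'.
have O_self p : O p p by have [tc e] := Phi_p p; exists tc.
have X_cont p x : O p x -> {for x, continuous (X p)}.
  move=> [tc e]; apply/continuous_atP => r r0.
  have [|d d0 hd] := @nbhs_Phi p x _ tc (@ballT_open tc r) _ e.
    by rewrite /= subrr normr0.
  exists d => // y /hd [tc' /= h e']; rewrite (X_Phi e) (X_Phi e').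
  move: h; rewrite prod_normE gt_max => /andP[_]; apply: le_lt_trans.
  by have := mx_entry_le (tc'.2 - tc.2) ord0 ord0; rewrite !mxE.
have X_compat p q x m : intvec m -> O p x -> O q (x + m) ->
    exists2 e : R, 0 < e & forall y, `|y - x| < e ->
      (X p x = X p y <-> X q (x + m) = X q (y + m)).
  move=> m_int px qx; have [n n_int Kn] := Ke m_int.
  have [_ /(_ (K p) (K q) (K x) n n_int)] := fol; case.
  - by case: px => -[t c] e; exists t, c.
  - by case: qx => -[t c] e; exists t, c; rewrite -Kn.
  move=> e [e0 he]; have [d d0 hd] := continuousP_eps Kc x e0.
  have [r1 r10 h1] : exists2 r : R, 0 < r & forall y, `|y - x| < r -> O p y.
    by have /openP_eps h := O_open p; exact: h.
  have [r2 r20 h2] : exists2 r : R, 0 < r & forall y, `|y - (x + m)| < r -> O q y.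
    by have /openP_eps h := O_open q; exact: h.
  exists (Num.min d (Num.min r1 r2)) => [|y]; first by rewrite !lt_min d0 r10.
  rewrite !lt_min => /and3P[yd y1 y2].
  have py := h1 y y1.
  have qy : O q (y + m) by apply: h2; rewrite opprD addrACA subrr addr0.
  have := he _ (hd _ yd); rewrite -!Kn !plaqueE.
  by move=> [k1 k2]; split=> h; [case: k1|case: k2].
have X_path p r : 0 < r -> exists2 d : R, 0 < d & forall x y,
    `|x - p| < d -> `|y - p| < d -> X p x = X p y ->
    exists c : R -> V, [/\ continuous c, c 0 = x, c 1 = y &
      forall t, 0 <= t <= 1 -> `|c t - p| < r /\ X p (c t) = X p x].
  move=> r0; have [tc0 e0] := Phi_p p.
  have HPc : continuous (fun tc => H (Phi p tc)) by exact: cont_comp (@Phi_cont p) Hc.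
  have [d1 d10 h1] := continuousP_eps HPc tc0 r0.
  have [|d d0 hd] := @nbhs_Phi p p _ tc0 (@ballT_open tc0 d1) _ (esym e0).
    by rewrite /= subrr normr0.
  exists d => // x y /hd[[t c] /= htc ex] /hd[[t' c'] /= htc' ey].
  rewrite (X_Phi ex) (X_Phi ey) => /coord1 /= cc; subst c'.
  exists (fun s => H (Phi p (t + s *: (t' - t), c))); split.
  - apply: cont_comp Hc; apply: cont_comp (@Phi_cont p); apply: cont_pair.
      by move=> s; apply: is_derive_continuous; exact: is_derive_affine.
    exact: cont_cst.
  - by rewrite scale0r addr0 -ex KH.
  - by rewrite scale1r addrC subrK -ey KH.
  move=> s /andP[s0 s1]; split; last first.
    rewrite (@X_Phi p _ (t + s *: (t' - t), c)) ?HK // (X_Phi ex) //.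
  rewrite -[X in `|_ - X|]KH -e0; apply: h1.
  move: htc htc'; rewrite !prod_normE !gt_max /= => /andP[a1 a2] /andP[a3 _].
  rewrite a2 andbT.
  have -> : t + s *: (t' - t) - tc0.1 = (1 - s) *: (t - tc0.1) + s *: (t' - tc0.1).
    by apply/rowP => j; rewrite !mxE; ring.
  apply: le_lt_trans (ler_normD _ _) _; rewrite !normrZ !ger0_norm ?subr_ge0 //.
  move: a1 a3; move: `|t - _| `|t' - _| => a b a1 a3.
  have m1 : Num.max a b < d1 by rewrite gt_max a1.
  have m2 : (1 - s) * a <= (1 - s) * Num.max a b.
    by rewrite ler_wpM2l ?subr_ge0 // le_max lexx.
  have m3 : s * b <= s * Num.max a b by rewrite ler_wpM2l // le_max lexx orbT.
  by lra.
have X_noncst p r : 0 < r -> exists2 y, `|y - p| < r & X p y <> X p p.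
  move=> r0; have [tc0 e0] := Phi_p p.
  have HPc : continuous (fun tc => H (Phi p tc)) by exact: cont_comp (@Phi_cont p) Hc.
  have [d d0 hd] := continuousP_eps HPc tc0 r0.
  exists (H (Phi p (tc0.1, tc0.2 + const_mx (d / 2)))).
    rewrite -[X in `|_ - X|]KH -e0; apply: hd.
    rewrite prod_normE gt_max /= subrr normr0 d0 (addrC tc0.2) addrK /=.
    apply: le_lt_trans (_ : d / 2 < d); last by rewrite ltr_pdivrMr // ltr_pMr // ltr1n.
    by apply: mx_norm_le => [|i j]; rewrite ?mxE ?ger0_norm // divr_ge0 // ltW.
  rewrite (@X_Phi p _ _ (HK _)) (@X_Phi p _ _ (esym e0)) !mxE => /eqP.
  by rewrite addrC -subr_eq0 addrK => /eqP; lra.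
have sat p : exists2 e : R, 0 < e & forall s, `|s| < e -> X p (p + s *: u) = X p p.
  have [e e0 he] := u_sat (K p); exists e => // s /he.
  by rewrite KH => /plaqueE[].
have [n [n0 un fl]] := flat_exists O_open O_self X_cont X_compat X_path
  X_noncst sat u_dense 0 uz.
exists n; split=> //.
  move=> i x y [t [t' [c [ex ey]]]].
  pose p := H i; pose s2 (s : R) := H (Phi p (t + s *: (t' - t), c)).
  have s2c : continuous s2.
    apply: cont_comp Hc; apply: cont_comp (@Phi_cont p); apply: cont_pair.
      by move=> s; apply: is_derive_continuous; exact: is_derive_affine.
    exact: cont_cst.
  have xE : H x = s2 0 by rewrite /s2 scale0r addr0 /Phi /p HK ex.
  have yE : H y = s2 1 by rewrite /s2 scale1r addrC subrK /Phi /p HK ey.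
  rewrite xE yE; apply: (@real_clopen R (fun s => (s2 s - s2 0) *m n = 0) 0).
    by rewrite subrr mul0mx.
  move=> s; have [e e0 he] := fl (s2 s).
  have Os : O p (s2 s) by exists (t + s *: (t' - t), c); rewrite /s2 HK.
  have [e1 e10 he1] := compat0 X_compat Os (O_self (s2 s)).
  have m0 : 0 < Num.min e e1 by rewrite lt_min e0.
  have [d d0 hd] := continuousP_eps s2c s m0.
  exists d => // s' /hd; rewrite lt_min => /andP[k1 k2].
  suff h : (s2 s' - s2 s) *m n = 0.
    suff -> : (s2 s' - s2 0) *m n = (s2 s - s2 0) *m n by [].
    have -> : s2 s' - s2 0 = (s2 s' - s2 s) + (s2 s - s2 0) by rewrite subrKA.
    by rewrite [LHS]mulmxDl h add0r.
  have [_] := he _ k1; rewrite addrC subrK; case=> + _; apply.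
  apply/esym/(he1 _ k2).
  by rewrite (@X_Phi p _ _ (HK _)) (@X_Phi p _ _ (HK _)).
move=> x; have [e e0 he] := fl (H x); exists e => // v vn ve.
have [Ov [_ /(_ vn) Xv]] := he v ve.
have := plaqueE (H x) (H x) (H x + v); rewrite HK => -[_]; apply.
by split=> //; rewrite Xv.
Qed.

End FlatFoliation.

(** * The splitting *)

Section Growth.
Variable R : realType.
Local Notation V := 'rV[R]_3.

(** Cut the segment from [y] to [x] into steps shorter than [d]: each contributes at most 1, and
    their number is affine in the distance. *)
Lemma large_scale (f : V -> V) : unif_cont f ->
  exists2 C : R, 0 < C & forall x y, `|f x - f y| <= C * (`|x - y| + 1).
Proof.
move=> /(_ 1 ltr01)[d d0 hd].
have chain m x y : `|x - y| < m%:R * d -> `|f x - f y| <= m%:R.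
  elim: m x y => [|m IH] x y; first by rewrite mul0r ltNge normr_ge0.
  move=> xy; have m0 : 0 < m.+1%:R :> R by rewrite ltr0n.
  pose t := y + (m.+1%:R)^-1 *: (x - y).
  have ht : `|t - y| < d.
    by rewrite addrC addKr normrZ normfV normr_nat mulrC ltr_pdivrMr // mulrC.
  have hx : `|x - t| < m%:R * d \/ m = 0%N.
    case: (posnP m) => [->|m1]; [by right|left].
    have -> : x - t = (m%:R / m.+1%:R) *: (x - y).
      rewrite /t opprD addrA -[x - y as X in X - _]scale1r -scalerBl; congr (_ *: _).
      by rewrite -natr1; field; rewrite natr1 gt_eqF.
    rewrite normrZ ger0_norm ?divr_ge0 // -mulrA ltr_pM2l ?ltr0n //.
    by rewrite mulrC ltr_pdivrMr // mulrC.
  have [hx'|m00] := hx; last by subst m; rewrite ltW // hd //; rewrite mul1r in xy.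
  rewrite -(subrKA (f t)) -natr1; apply: le_trans (ler_normD _ _) (lerD _ _).
    exact: IH.
  exact: ltW (hd _ _ ht).
exists (d^-1 + 1) => [|x y]; first by rewrite addr_gt0 ?invr_gt0.
have n0 : 0 <= `|x - y| / d by rewrite divr_ge0 // ltW.
have /andP[h1 h2] := truncn_itv n0.
rewrite ltr_pdivrMr // in h2; apply: le_trans (chain _ _ _ h2) _.
rewrite -natr1; apply: le_trans (lerD h1 (lexx 1)) _.
rewrite mulrDl mul1r mulrDr mulr1 mulrC.
have : 0 <= d^-1 by rewrite invr_ge0 ltW.
by have := normr_ge0 (x - y); lra.
Qed.

Lemma diff_zero (Q : V -> V) x : 'd Q x 0 = 0.
Proof. exact: linear0. Qed.

Lemma diff_idE (x v : V) : 'd (fun y : V => y) x v = v.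
Proof. by have := @diff_val _ _ _ _ _ _ _ (is_diff_id x) => /(congr1 (fun k : V -> V => k v)). Qed.

Lemma diff_cancel (f g : V -> V) x v : cancel f g -> differentiable f x ->
  differentiable g (f x) -> 'd g (f x) ('d f x v) = v.
Proof.
move=> fg df dg; have E : g \o f = id by apply/funext => y; exact: fg.
have := diff_comp df dg; rewrite E => /(congr1 (fun k => k v)) /= <-.
exact: diff_idE.
Qed.

Lemma iter_invariant (P : V -> 'M[R]_3) (f : V -> V) n : iter_C1 f ->
  (forall x v, inF P x v -> inF P (f x) ('d f x v)) ->
  forall x v, inF P x v -> inF P (iter n f x) ('d (iter n f) x v).
Proof.
move=> fC h; elim: n => [|n IH] x v xv.
  by rewrite (_ : 'd (iter 0 f) x v = v) //; exact: diff_idE.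
have -> : iter n.+1 f = f \o iter n f by [].
have [df _] := fC 1%N; have [dn _] := fC n.
by rewrite diff_comp //=; apply: h; exact: IH.
Qed.

Lemma rate_curve (E : V -> set V) (f : V -> V) (q : R) c c' a b : a <= b ->
  0 <= q -> iter_C1 f -> rate E f q -> tcurve E c c' a b ->
  exists2 C : R, 0 <= C & forall n, `|iter n f (c b) - iter n f (c a)| <= C * q ^+ n.
Proof.
move=> ab q0 fC [C C0 rt] tc; have [B B0 hB] := tcurve_growth ab tc.
exists (C * B) => [|n]; first by rewrite mulr_ge0.
rewrite mulrAC; apply: hB.
- by move=> x; have [h _] := fC n; exact: h.
- by move=> t /tc[_ _ Ec _]; exact: rt.
by rewrite mulr_ge0 // exprn_ge0.
Qed.

(** Along the orbits the functional [w] is multiplied by [l] at each step, while the images separate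
    at most like [q ^+ n], up to the affine error of [large_scale]; [1 <= q] absorbs that error and
    [q < |l|] forces the value 0. *)
Lemma functional_zero (H f : V -> V) (M : 'M[R]_3) (w : 'cV[R]_3) (l q C : R) x y :
  unif_cont H ->
  (forall x y, H (f x) - H (f y) = (H x - H y) *m M) -> M *m w = l *: w ->
  1 <= q < `|l| -> (forall n, `|iter n f x - iter n f y| <= C * q ^+ n) ->
  (H x - H y) *m w = 0.
Proof.
move=> ucH Hf Mw /andP[q1 ql] hC.
have [B B0 hB] := large_scale ucH.
have it n : (H (iter n f x) - H (iter n f y)) *m w = l ^+ n *: ((H x - H y) *m w).
  elim: n => [|n IH]; first by rewrite scale1r.
  by rewrite !iterS Hf -mulmxA Mw -scalemxAr IH scalerA exprS.
have q0 : 0 < q by lra.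
have l0 : 0 < `|l| by lra.
have C0 : 0 <= C.
  by have := hC 0%N; rewrite expr0 mulr1; apply: le_trans.
apply/eqP; rewrite -normr_le0; apply/ler_addgt0Pr => e e0; rewrite add0r.
pose D := 3 * (B * (C + 1) * `|w|) + 1.
have D0 : 0 < D by rewrite ltr_wpDl // !mulr_ge0 // ?addr_ge0 // ltW.
have [|N hN] := @geometric_small R (q / `|l|) (e / D) _ (divr_gt0 e0 D0).
  by rewrite divr_ge0 ?(ltW q0) //= ltr_pdivrMr // mul1r.
have := hN N (leqnn N); rewrite expr_div_n ltr_pdivlMr // mulrAC.
rewrite ltr_pdivrMr ?exprn_gt0 // => k1.
rewrite -(ler_pM2l (exprn_gt0 N l0)) -normrX -normrZ -it.
apply: le_trans (mulmx_norm_le _ _) _; rewrite normrX (mulrC (_ ^+ _)).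
apply: le_trans (ltW k1).
have q1N : 1 <= q ^+ N by rewrite exprn_ege1.
have h1 := le_trans (hB _ _) (ler_wpM2l (ltW B0) (lerD (hC N) q1N)).
have -> : q ^+ N * D = 3 * ((B * (C * q ^+ N + q ^+ N)) * `|w|) + q ^+ N.
  by rewrite /D; ring.
apply: ler_wpDr; first by rewrite exprn_ge0 // ltW.
by rewrite ler_wpM2l // ler_wpM2r.
Qed.

End Growth.

(** The conclusion in the coordinates of [H], where leaves are affine lines and planes. Its form is
    symmetric under inverting [A] while exchanging s and u, which serves the case of a contracting
    isolated eigenvalue. *)
Definition adapted_splitting (R : realType) (H : 'rV[R]_3 -> 'rV[R]_3) (A : 'M[R]_3)
    (Ws Wc Wu : 'rV[R]_3 -> chart R 1) (Wcs Wcu Wus : 'rV[R]_3 -> chart R 2) :=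
  exists es ec eu : 'rV[R]_3, exists ls lc lu : R,
  [/\ [/\ es *m A = ls *: es, ec *m A = lc *: ec & eu *m A = lu *: eu],
      (forall x y t, x *: es + y *: ec + t *: eu = 0 -> [/\ x = 0, y = 0 & t = 0]),
      [/\ `|ls| < `|lc|, `|lc| < `|lu|, `|ls| < 1 & 1 < `|lu|],
      [/\ (forall x y, leaf Ws x y <-> exists s, H y - H x = s *: es),
          (forall x y, leaf Wc x y <-> exists s, H y - H x = s *: ec) &
          (forall x y, leaf Wu x y <-> exists s, H y - H x = s *: eu)] &
      [/\ (forall x y, leaf Wcs x y <-> exists a b, H y - H x = a *: ec + b *: es),
          (forall x y, leaf Wcu x y <-> exists a b, H y - H x = a *: ec + b *: eu) &
          (forall x y, leaf Wus x y <-> exists a b, H y - H x = a *: eu + b *: es)]].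

(** * The splitting for an expanding isolated eigenvalue *)

Section Core.
Variable R : realType.
Local Notation V := 'rV[R]_3.

Variables (F Fi H K : V -> V) (A : 'M[R]_3).
Hypothesis FK : cancel F Fi.
Hypothesis FiK : cancel Fi F.
Hypothesis FC : iter_C1 F.
Hypothesis FiC : iter_C1 Fi.
Hypothesis HK : cancel H K.
Hypothesis KH : cancel K H.
Hypothesis Hc : continuous H.
Hypothesis Kc : continuous K.
Hypothesis He : int_equivariant H.
Hypothesis Ke : int_equivariant K.
Hypothesis HF : forall x y, H (F x) - H (F y) = (H x - H y) *m A.
Hypothesis Au : A \in unitmx.
Hypothesis A_int : forall m : V, intvec m -> intvec (m *m A).

Variables (Ps Pc Pu : V -> 'M[R]_3).
Hypothesis Ps_lf : line_field Ps.
Hypothesis Pc_lf : line_field Pc.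
Hypothesis Pu_lf : line_field Pu.
Hypothesis Pc_inv : forall x v, inF Pc x v -> inF Pc (F x) ('d F x v).

Variables (qs qu kcs kcu : R).
Hypothesis qs01 : 0 < qs < 1.
Hypothesis qu01 : 0 < qu < 1.
Hypothesis kcs1 : 1 <= kcs.
Hypothesis kcu1 : 1 <= kcu.
Hypothesis kcs_qu : kcs * qu < 1.
Hypothesis kcu_qs : kcu * qs < 1.
Hypothesis rs : rate (inF Ps) F qs.
Hypothesis ru : rate (inF Pu) Fi qu.
Hypothesis rcs : rate (sumF (inF Pc) (inF Ps)) F kcs.
Hypothesis rcu : rate (sumF (inF Pc) (inF Pu)) Fi kcu.

Variables (Ws Wc Wu : V -> chart R 1) (Wcs Wcu Wus : V -> chart R 2).
Hypothesis Ws_fol : is_foliation (inF Ps) Ws.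
Hypothesis Wc_fol : is_foliation (inF Pc) Wc.
Hypothesis Wu_fol : is_foliation (inF Pu) Wu.
Hypothesis Wcs_fol : is_foliation (sumF (inF Pc) (inF Ps)) Wcs.
Hypothesis Wcu_fol : is_foliation (sumF (inF Pc) (inF Pu)) Wcu.
Hypothesis Wus_fol : is_foliation (sumF (inF Pu) (inF Ps)) Wus.

Variables (u : V) (z : 'cV[R]_3) (r : R).
Hypothesis uA : u *m A = r *: u.
Hypothesis Az : A *m z = r *: z.
Hypothesis uz : u *m z = 1%:M.
Hypothesis r1 : 1 < `|r|.
Hypothesis contr : forall v : V, v *m z = 0 -> forall e : R, 0 < e ->
  exists N, forall n, (N <= n)%N -> `|v *m A ^+ n| < e.

Let ucH : unif_cont H := equivariant_unif_cont Hc He.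
Let ucK : unif_cont K := equivariant_unif_cont Kc Ke.
Let qs0 : 0 < qs. Proof. by case/andP: qs01. Qed.
Let qu0 : 0 < qu. Proof. by case/andP: qu01. Qed.
Let kcs0 : 0 <= kcs. Proof. exact: le_trans kcs1. Qed.
Let kcu0 : 0 <= kcu. Proof. exact: le_trans kcu1. Qed.
Let r0 : r != 0. Proof. by rewrite -normr_gt0 (lt_trans _ r1). Qed.
Let Ai := invmx A.
Let r00 : 0 < `|r|. Proof. by rewrite normr_gt0. Qed.

Lemma uz00 : (u *m z) ord0 ord0 = 1. Proof. by rewrite uz mxE. Qed.

Lemma u_neq0 : u != 0.
Proof. by apply: contra_eq_neq uz => ->; rewrite mul0mx eq_sym oner_eq0. Qed.

Lemma uAn n : u *m A ^+ n = r ^+ n *: u.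
Proof.
elim: n => [|n IH]; first by rewrite !expr0 mulmx1 scale1r.
by rewrite exprSr -mulmxE mulmxA IH -scalemxAl uA scalerA exprSr.
Qed.

Lemma Anz n : A ^+ n *m z = r ^+ n *: z.
Proof.
elim: n => [|n IH]; first by rewrite !expr0 mul1mx scale1r.
by rewrite exprSr -mulmxE -mulmxA Az -scalemxAr IH scalerA -exprS.
Qed.

Definition projP (v : V) := v - (v *m z) ord0 ord0 *: u.

Lemma projPz v : projP v *m z = 0.
Proof.
rewrite mulmxBl -scalemxAl uz; apply/matrixP => i j; rewrite !ord1 mxE.
by move: (v *m z) => y; rewrite !mxE mulr1 subrr.
Qed.

Lemma projP_id v : v *m z = 0 -> projP v = v.
Proof. by move=> vz; rewrite /projP vz mxE scale0r subr0. Qed.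

Lemma projPE v : v = (v *m z) ord0 ord0 *: u + projP v.
Proof. by rewrite addrC subrK. Qed.

Lemma contr_unif e : 0 < e -> exists N, forall n (v : V), (N <= n)%N -> v *m z = 0 ->
  `|v *m A ^+ n| <= e * `|v|.
Proof.
move=> e0; have e30 : 0 < e / 3 by rewrite divr_gt0.
have /fin_all_exists[N hN] := fun i : 'I_3 => contr (projPz (delta_mx ord0 i)) e30.
exists (\max_i N i) => n v Nn vz.
have vE : v = \sum_(i < 3) v ord0 i *: projP (delta_mx ord0 i).
  have -> : \sum_(i < 3) v ord0 i *: projP (delta_mx ord0 i) = projP v.
    rewrite /projP {2 3}(row_sum_delta v) mulmx_suml summxE scaler_suml -sumrB.
    apply: eq_bigr => i _; rewrite -scalemxAl scalerBr scalerA.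
    by congr (_ - _ *: _); rewrite [RHS]mxE.
  by rewrite projP_id.
rewrite {1}vE mulmx_suml.
apply: le_trans (ler_norm_sum _ _ _) _.
apply: (@le_trans _ _ (\sum_(i < 3) `|v| * (e / 3))).
  apply: ler_sum => i _; rewrite -scalemxAl normrZ ler_pM ?mx_entry_le //.
  by apply/ltW/hN; apply: leq_trans Nn; exact: leq_bigmax.
by rewrite sumr_const card_ord -mulr_natl; lra.
Qed.

Lemma HFi x y : H (Fi x) - H (Fi y) = (H x - H y) *m Ai.
Proof. by rewrite -{2}(FiK x) -{2}(FiK y) HF mulmxK. Qed.

Lemma iter_diff (f : V -> V) (M : 'M[R]_3) n x y :
  (forall x y, H (f x) - H (f y) = (H x - H y) *m M) ->
  H (iter n f x) - H (iter n f y) = (H x - H y) *m M ^+ n.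
Proof.
move=> h; elim: n => [|n IH]; first by rewrite expr0 mulmx1.
by rewrite !iterS h IH exprSr -mulmxE mulmxA.
Qed.

(** The component of [H x - H y] in the contracted plane is the image under [A ^+ n] of a component
    that stays bounded, so it is 0. *)
Lemma bounded_back_u (C : R) x y :
  (forall n, `|iter n Fi x - iter n Fi y| <= C) ->
  H x - H y = ((H x - H y) *m z) ord0 ord0 *: u.
Proof.
move=> hC; set w := H x - H y.
have [B B0 hB] := large_scale ucH.
have wA n : `|w *m Ai ^+ n| <= B * (C + 1).
  rewrite /w -(iter_diff n x y HFi); apply: le_trans (hB _ _) _.
  by rewrite ler_wpM2l ?(ltW B0) // lerD2r hC.
have [M M0 hM] : exists2 M : R, 0 <= M & forall v : V, `|projP v| <= M * `|v|.
  exists (1 + 3 * `|z| * `|u|); first by rewrite addr_ge0 // !mulr_ge0.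
  move=> v; apply: le_trans (ler_normB _ _) _; rewrite mulrDl mul1r lerD2l normrZ.
  have := mx_entry_le (v *m z) ord0 ord0; have := mulmx_norm_le v z => h1 h2.
  have -> : 3 * `|z| * `|u| * `|v| = 3 * (`|v| * `|z|) * `|u| by ring.
  by rewrite ler_wpM2r // (le_trans h2).
have AiA n : Ai ^+ n *m A ^+ n = 1%:M.
  elim: n => [|n IH]; first by rewrite !expr0 mulmx1.
  by rewrite exprS exprSr -!mulmxE mulmxA -(mulmxA Ai) IH mulmx1 mulVmx.
have pA n (v : V) : projP (v *m A ^+ n) = projP v *m A ^+ n.
  rewrite /projP mulmxBl -scalemxAl uAn -(mulmxA v) Anz -scalemxAr scalerA mxE.
  by rewrite (mulrC (r ^+ n)).
have : projP w = 0.
  apply/eqP; rewrite -normr_le0; apply/ler_addgt0Pr => e e0; rewrite add0r.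
  have C0 : 0 <= C by apply: le_trans (hC 0%N).
  pose D := M * (B * (C + 1)) + 1.
  have D0 : 0 < D by rewrite ltr_wpDl // !mulr_ge0 ?addr_ge0 // ltW.
  have [N hN] := contr_unif (divr_gt0 e0 D0).
  have -> : projP w = projP (w *m Ai ^+ N) *m A ^+ N by rewrite -pA -mulmxA AiA mulmx1.
  apply: le_trans (hN N _ (leqnn N) (projPz _)) _.
  rewrite mulrAC ler_pdivrMr // ler_wpM2l ?(ltW e0) // /D.
  have := le_trans (hM (w *m Ai ^+ N)) (ler_wpM2l M0 (wA N)).
  by lra.
by move=> h; rewrite [LHS]projPE h addr0.
Qed.

Lemma plaque_curve k (E : V -> set V) (W : V -> chart R k) i x y :
  is_foliation E W -> plaque (W i) x y -> x = y \/
  exists c c', [/\ tcurve E c c' 0 1, c 0 = x & c 1 = y].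
Proof.
move=> fol [t [t' [c [-> ->]]]]; case: (eqVneq t t') => [->|tt']; [by left|right].
have [ch _] := fol.1 i.
have tc := @plaque_tcurve R k E (W i) t t' c 0 1 ch tt'.
by eexists; eexists; split; [exact: tc|rewrite /= scale0r addr0|rewrite /= scale1r addrC subrK].
Qed.

(** Valid for any curve tangent to [E^u], hence also for the Peano curves inside us-plaques. *)
Lemma ucurve_line c c' a b : a <= b -> tcurve (inF Pu) c c' a b ->
  H (c b) - H (c a) = ((H (c b) - H (c a)) *m z) ord0 ord0 *: u.
Proof.
move=> ab tc; have [C C0 hC] := rate_curve ab (ltW qu0) FiC ru tc.
apply: (@bounded_back_u C) => n; apply: le_trans (hC n) _.
have q1 : qu <= 1 by case/andP: qu01 => _ /ltW.
by rewrite ler_piMr // exprn_ile1 // ltW.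
Qed.

Lemma Wu_line : line_image H Wu u.
Proof.
move=> i x y pl; case: (plaque_curve Wu_fol pl) => [->|[c [c' [tc <- <-]]]].
  by exists 0; rewrite subrr scale0r.
eexists; exact: ucurve_line ler01 tc.
Qed.

Lemma line_leaf (P : V -> 'M[R]_3) (W : V -> chart R 1) (w : V) : w != 0 ->
  is_foliation (inF P) W -> line_image H W w ->
  forall x y, leaf W x y <-> exists s, H y - H x = s *: w.
Proof.
move=> w0 fol img; apply: (@leaf_eq R H K HK KH 1 W (fun v => exists s, v = s *: w)).
- by exists 0; rewrite scale0r.
- by move=> a v [s ->]; exists (a * s); rewrite scalerA.
- by move=> v v' [s ->] [s' ->]; exists (s + s'); rewrite scalerDl.
- exact: img.
move=> x; have [e e0 he] := line_leaf_local HK Hc w0 fol img x.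
have wn : 0 < `|w| by rewrite normr_gt0.
exists (e * `|w|); first by rewrite mulr_gt0.
move=> v [s ->]; rewrite normrZ ltr_pM2r // => /he; exact: chain_plaque.
Qed.

Lemma plane_leaf (E : V -> set V) (W : V -> chart R 2) (n : 'cV[R]_3) : n != 0 ->
  is_foliation E W -> (forall i x y, plaque (W i) x y -> (H y - H x) *m n = 0) ->
  forall x y, leaf W x y <-> (H y - H x) *m n = 0.
Proof.
move=> n0 fol img.
apply: (@leaf_eq R H K HK KH 2 W (fun v => v *m n = 0)) => //.
- by rewrite mul0mx.
- by move=> a v vn; rewrite -scalemxAl vn scaler0.
- by move=> v w vn wn; rewrite mulmxDl vn wn addr0.
move=> x; have [e e0 he] := plane_leaf_local HK KH Hc Kc n0 fol img x.
by exists e => // w wn we; apply: (@chain_plaque _ _ _ x); exact: he.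
Qed.

Lemma ru_ge1 : 1 <= `|r| * qu.
Proof.
exact: (@lines_expand R H K F Fi A HK KH Hc Kc He Ke FK HF Pu Wu u r qu u_neq0
  Pu_lf Wu_fol Wu_line uA qu01 ru FiC).
Qed.

(** [kcs * qu < 1 <= |r| * qu]: what separates no faster than the center-stable bundle allows has an
    image without component along [u]. *)
Lemma kcs_r : kcs < `|r|.
Proof. by rewrite -(ltr_pM2r qu0); apply: lt_le_trans kcs_qu ru_ge1. Qed.

Lemma growth_z (q C : R) x y : q <= kcs -> 0 <= q ->
  (forall n, `|iter n F x - iter n F y| <= C * q ^+ n) -> (H x - H y) *m z = 0.
Proof.
move=> qk q0 h; apply: (@functional_zero R H F A z r kcs C x y ucH HF Az).
  by rewrite kcs1 kcs_r.
move=> n; apply: le_trans (h n) _; apply: ler_wpM2l.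
  by have := h 0%N; rewrite expr0 mulr1; apply: le_trans.
by rewrite lerXn2r ?nnegrE.
Qed.

Lemma curve_z (E : V -> set V) (q : R) c c' a b : a <= b -> rate E F q ->
  q <= kcs -> 0 <= q -> tcurve E c c' a b -> (H (c b) - H (c a)) *m z = 0.
Proof.
move=> ab rt qk q0 tc; have [C C0 hC] := rate_curve ab q0 FC rt tc.
exact: growth_z qk q0 hC.
Qed.

Lemma Wcs_z i x y : plaque (Wcs i) x y -> (H y - H x) *m z = 0.
Proof.
move=> pl; case: (plaque_curve Wcs_fol pl) => [->|[c [c' [tc <- <-]]]].
  by rewrite subrr mul0mx.
exact: (curve_z ler01 rcs (lexx _) kcs0 tc).
Qed.

(** The substitute for lying on a common stable leaf. It relates the ends of every curve tangent to
    [E^s], whether or not that curve lies in a leaf of [Ws]. *)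
Definition asym (x y : V) := exists2 C : R, 0 <= C &
  forall n, `|iter n F x - iter n F y| <= C * qs ^+ n.

Lemma asym_refl x : asym x x.
Proof. by exists 0 => // n; rewrite subrr normr0 mul0r. Qed.

Lemma asym_sym x y : asym x y -> asym y x.
Proof. by move=> [C C0 h]; exists C => // n; rewrite distrC. Qed.

Lemma asym_trans x y w : asym x y -> asym y w -> asym x w.
Proof.
move=> [C C0 h] [D D0 k]; exists (C + D) => [|n]; first exact: addr_ge0.
rewrite -(subrKA (iter n F y)) mulrDl.
by apply: le_trans (ler_normD _ _) (lerD _ _).
Qed.

Lemma asym_F x y : asym x y -> asym (F x) (F y).
Proof.
move=> [C C0 h]; exists (C * qs) => [|n]; first by rewrite mulr_ge0 // ltW.
by rewrite -!iterSr -mulrA -exprS.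
Qed.

Lemma scurve_asym c c' a b : a <= b -> tcurve (inF Ps) c c' a b -> asym (c b) (c a).
Proof.
move=> ab tc; have [C C0 hC] := rate_curve ab (ltW qs0) FC rs tc.
by exists C.
Qed.

Lemma asym_z x y : asym x y -> (H x - H y) *m z = 0.
Proof.
move=> [C C0 h]; apply: (growth_z _ (ltW qs0) h).
by apply: le_trans kcs1; case/andP: qs01 => _ /ltW.
Qed.

Lemma inF_sumFl (P Q : V -> 'M[R]_3) x v : inF P x v -> sumF (inF P) (inF Q) x v.
Proof. by move=> h; exists v, 0; rewrite /inF mul0mx addr0. Qed.

Lemma inF_sumFr (P Q : V -> 'M[R]_3) x v : inF Q x v -> sumF (inF P) (inF Q) x v.
Proof. by move=> h; exists 0, v; rewrite /inF mul0mx add0r. Qed.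

Lemma ccurve_z c c' a b : a <= b -> tcurve (inF Pc) c c' a b ->
  (H (c b) - H (c a)) *m z = 0.
Proof.
move=> ab tc; apply: (curve_z ab rcs (lexx _) kcs0 (c' := c')).
by apply: tcurve_weaken tc => x v; exact: inF_sumFl.
Qed.

Lemma diff_iter_inj n x v : 'd (iter n F) x v = 0 -> v = 0.
Proof.
move=> h; have [dF _] := FC n; have [dFi _] := FiC n.
have E := diff_cancel v (iter_cancel n FK) (dF x) (dFi _).
have E' := congr1 (fun w => 'd (iter n Fi) (iter n F x) w) h.
exact: etrans (esym E) (etrans E' (diff_zero _ _)).
Qed.

(** Images of center curves lie in the plane contracted by [A], so the whole curve eventually
    becomes small under [F]. This is what makes [tcurve_chord] applicable to its iterates. *)
Lemma ccurve_small c c' (e : R) : 0 < e -> tcurve (inF Pc) c c' 0 1 ->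
  exists N, forall n t, (N <= n)%N -> 0 <= t <= 1 ->
    `|iter n F (c t) - iter n F (c 0)| < e.
Proof.
move=> e0 tc; have [d d0 hd] := ucK e0.
have nc : continuous (fun y : V => `|H y - H (c 0)|).
  apply: (@cont_comp R V V R (fun y => H y - H (c 0)) (fun y => `|y|)).
    by apply: cont_sub => //; exact: cont_cst.
  exact: norm_continuous.
have cc : {within `[0, 1], continuous (fun t => `|H (c t) - H (c 0)|)}.
  apply: within_continuous_segment => t t01.
  exact: (continuous_comp (tcurve_continuous tc t01) (nc (c t))).
have [m _ hm] := EVT_max ler01 cc.
pose B := `|H (c m) - H (c 0)| + 1.
have B0 : 0 < B by rewrite ltr_wpDl.
have [N hN] := contr_unif (divr_gt0 d0 B0).
exists N => n t Nn t01.
rewrite -(HK (iter n F (c t))) -(HK (iter n F (c 0))); apply: hd.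
rewrite (iter_diff n _ _ HF).
have wz : (H (c t) - H (c 0)) *m z = 0.
  case/andP: (t01) => t0 t1; apply: (ccurve_z t0 (c' := c')).
  exact: tcurve_sub (lexx _) t1 tc.
apply: le_lt_trans (hN n _ Nn wz) _.
rewrite mulrAC ltr_pdivrMr // ltr_pM2l //.
apply: le_lt_trans (_ : `|H (c m) - H (c 0)| < B); last by rewrite ltrDl.
by apply: hm; rewrite in_itv.
Qed.

(* Pulling back [k] steps stretches a center chord by at most [C * kcu ^+ k],
   while the end points come [qs ^+ k]-close, and [kcu * qs < 1]. *)
Lemma asym_ccurve c c' : tcurve (inF Pc) c c' 0 1 -> asym (c 0) (c 1) -> c 0 = c 1.
Proof.
move=> tc [D D0 hD].
have [d d0 chord] := tcurve_chord Pc_lf.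
have [N hN] := ccurve_small d0 tc.
have [C C0 rt] := rcu.
apply: (can_inj (iter_cancel N FK)); apply/eqP; rewrite -subr_eq0 -normr_le0.
apply/ler_addgt0Pr => e e0; rewrite add0r.
pose M := 2 * C * D * qs ^+ N + 1.
have M0 : 0 < M by rewrite ltr_wpDl // !mulr_ge0 // exprn_ge0 // ltW.
have [|k hk] := @geometric_small R (kcu * qs) (e / M) _ (divr_gt0 e0 M0).
  by rewrite kcu_qs mulr_ge0 // ltW.
have := hk k (leqnn k); rewrite ltr_pdivlMr // exprMn => hk'.
pose n := (k + N)%N.
have tcn := tcurve_map (FC n) (iter_invariant n FC Pc_inv) (@diff_iter_inj n) tc.
have small t : 0 <= t <= 1 -> `|iter n F (c t) - iter n F (c 0)| < d.
  by apply: hN; rewrite leq_addl.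
have Ck0 : 0 <= C * kcu ^+ k by rewrite mulr_ge0 // exprn_ge0.
have FkC x : differentiable (iter k Fi) x by have [h _] := FiC k; exact: h.
have := chord _ _ 0 1 ler01 tcn small (iter k Fi) _ FkC Ck0
  (fun x v h => rt k x v (inF_sumFl Pu h)).
have EN x : iter k Fi (iter n F x) = iter N F x by rewrite /n iterD (iter_cancel k FK).
rewrite !EN distrC (distrC (iter _ F (c 1))) => h.
apply: le_trans h _; apply: le_trans (ler_wpM2l _ (hD _)) _.
  by rewrite mulr_ge0.
rewrite exprD; apply: ltW; apply: le_lt_trans hk'.
have -> : 2 * (C * kcu ^+ k) * (D * (qs ^+ k * qs ^+ N)) =
  kcu ^+ k * qs ^+ k * (M - 1) by rewrite /M; ring.
rewrite ler_wpM2l //; last by rewrite gerBl.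
by rewrite mulr_ge0 // exprn_ge0 // ltW.
Qed.

Lemma curve_line_cover (Y : R -> V) (d : R) (w : V) : w != 0 -> 0 < d ->
  (forall s, - d <= s <= d -> {for s, continuous Y}) ->
  (forall s t, - d <= s <= d -> - d <= t <= d -> Y s = Y t -> s = t) ->
  (forall s, - d <= s <= d -> exists a, H (Y s) - H (Y 0) = a *: w) ->
  exists2 e : R, 0 < e & forall s, `|s| < e ->
    exists2 t, - d <= t <= d & K (H (Y 0) + s *: w) = Y t.
Proof.
move=> w0 d0 Yc Yinj Yw.
have [i wi] : exists i, w ord0 i != 0.
  have [i hi] := rV_norm_attained w; exists i.
  by rewrite -normr_gt0 hi normr_gt0.
pose f s := (H (Y s) - H (Y 0)) ord0 i / w ord0 i.
have YE s : - d <= s <= d -> H (Y s) - H (Y 0) = f s *: w.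
  by move=> /Yw[a ha]; rewrite /f ha mxE mulfK.
have fc : continuous (fun y : V => (H y - H (Y 0)) ord0 i / w ord0 i).
  apply: (@cont_comp R V R R (fun y => (H y - H (Y 0)) ord0 i) (fun x => x / w ord0 i)).
    by apply: cont_coord; apply: cont_sub Hc _; exact: cont_cst.
  by move=> x; exact: mulrr_continuous.
have [|||e e0 he] := @segment_inj_cover R f (- d) 0 d.
- by rewrite oppr_lt0 d0.
- by move=> s /Yc cY; exact: (continuous_comp cY (fc (Y s))).
- move=> s t sd td st; apply: Yinj => //; apply: (can_inj HK); apply/eqP.
  rewrite -subr_eq0.
  have -> : H (Y s) - H (Y t) = (H (Y s) - H (Y 0)) - (H (Y t) - H (Y 0)) by vec_ring.
  by rewrite (YE s sd) (YE t td) st subrr.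
have f0 : f 0 = 0 by rewrite /f subrr mxE mul0r.
exists e => // s se; have [|t td ft] := he s; first by rewrite f0 subr0.
exists t => //.
by rewrite -[RHS]HK -(subrK (H (Y 0)) (H (Y t))) YE // ft addrC.
Qed.

(** A Peano curve tangent to [E^u] runs inside the us-plaque, and its image is confined to the
    [u]-line, where injectivity makes it cover an interval. *)
Lemma u_saturated x : exists2 e : R, 0 < e & forall s, `|s| < e ->
  plaque (Wus x) x (K (H x + s *: u)).
Proof.
have [ch [t0 [c Wx]]] := Wus_fol.1 x.
have [d d0 [Y [Y' [Y0 tY pY Yinj]]]] := @plaque_integral_curve R Pu Ps Pu (Wus x) t0 c
  Pu_lf Ps_lf Pu_lf (fun x v => @inF_sumFl Pu Ps x v) ch.
rewrite Wx in Y0.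
have [|s /andP[s1 s2]|e e0 he] := curve_line_cover u_neq0 d0 _ Yinj _.
- by move=> s; exact: tcurve_continuous tY.
- have [s0|/ltW s0] := leP 0 s.
    eexists; apply: (ucurve_line s0 (c' := Y')); apply: tcurve_sub tY => //.
    by rewrite oppr_le0 ltW.
  have := ucurve_line s0 (tcurve_sub s1 (ltW d0) tY).
  by rewrite -opprB => /(congr1 -%R); rewrite opprK -scaleNr => ->; eexists.
by exists e => // s /he[t _]; rewrite Y0 => ->; have := pY t; rewrite Y0.
Qed.

(** Pull the component of [v] in the contracted plane back by [A ^+ N], round it to an integer
    vector [k], and push forward again: [A ^+ N] shrinks the bounded rounding error in the plane,
    while the multiple of [u] absorbs the rest. *)
Lemma u_dense (v : V) (e : R) : 0 < e -> exists s m, intvec m /\ `|v - (s *: u + m)| < e.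
Proof.
move=> e0.
pose B := 1 + 3 * `|z| * `|u| + 1.
have B0 : 0 < B by rewrite ltr_wpDl // !addr_ge0 // !mulr_ge0.
have [N hN] := contr_unif (divr_gt0 e0 B0).
pose v1 : V := projP v *m Ai ^+ N.
have [k k_int hk] := intvec_floor v1.
have AiA n : Ai ^+ n *m A ^+ n = 1%:M.
  elim: n => [|n IH]; first by rewrite !expr0 mulmx1.
  by rewrite exprS exprSr -!mulmxE mulmxA -(mulmxA Ai) IH mulmx1 mulVmx.
pose c := ((v1 - k) *m z) ord0 ord0.
have kA_int : intvec (k *m A ^+ N).
  elim: (N) => [|n IH]; first by rewrite expr0 mulmx1.
  by rewrite exprSr -mulmxE mulmxA; exact: A_int.
exists ((v *m z) ord0 ord0 + c * r ^+ N), (k *m A ^+ N); split=> //.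
have -> : v - (((v *m z) ord0 ord0 + c * r ^+ N) *: u + k *m A ^+ N) =
    projP (v1 - k) *m A ^+ N.
  have E : v1 *m A ^+ N = projP v by rewrite /v1 -mulmxA AiA mulmx1.
  rewrite [in RHS]/projP mulmxBl -/c -scalemxAl uAn mulmxBl E scalerA {1}[v]projPE.
  rewrite scalerDl; move: (projP v) (k *m _) (_ *: u) (_ *: u) => a b d f; vec_ring.
apply: le_lt_trans (hN N _ (leqnn N) (projPz _)) _.
rewrite mulrAC ltr_pdivrMr // ltr_pM2l // /projP.
have y1 : `|v1 - k| <= 1.
  apply: rV_norm_le => // j; have := hk j; rewrite !mxE => /andP[h1 h2].
  by rewrite ger0_norm.
apply: le_lt_trans (ler_normB _ _) _; rewrite normrZ /B.
have h1 := le_trans (mx_entry_le _ ord0 ord0) (mulmx_norm_le (v1 - k) z).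
have h2 : 3 * (`|v1 - k| * `|z|) <= 3 * `|z|.
  by rewrite ler_wpM2l // ler_piMl.
have h3 := ler_wpM2r (normr_ge0 u) (le_trans h1 h2).
by lra.
Qed.

Lemma transverse_exists (n : 'cV[R]_3) : n != 0 -> u *m n = 0 ->
  exists2 w1 : V, w1 *m z = 0 & 0 < (w1 *m n) ord0 ord0.
Proof.
move=> n0 un; exists (projP n^T); first exact: projPz.
by rewrite mulmxBl -scalemxAl un scaler0 subr0; exact: mul_trmx_gt0.
Qed.

(** * Stable and center directions in the flat picture *)

Section Flat.
Variables (n : 'cV[R]_3) (w0 : V).
Hypothesis n_neq0 : n != 0.
Hypothesis un : u *m n = 0.
Hypothesis Wus_n : forall i x y, plaque (Wus i) x y -> (H y - H x) *m n = 0.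
Hypothesis w0_neq0 : w0 != 0.
Hypothesis w0z : w0 *m z = 0.
Hypothesis w0n : w0 *m n = 0.

Variable w1 : V.
Hypothesis w1z : w1 *m z = 0.
Hypothesis w1n : 0 < (w1 *m n) ord0 ord0.

Lemma uw0w1_indep x y t : x *: u + y *: w0 + t *: w1 = 0 -> [/\ x = 0, y = 0 & t = 0].
Proof.
move=> h; have := congr1 (fun v : V => (v *m n) ord0 ord0) h.
rewrite /= !mulmxDl -!scalemxAl un w0n !scaler0 !add0r mul0mx mxE [RHS]mxE => /eqP.
rewrite mulf_eq0 (gt_eqF w1n) orbF => /eqP t0.
have := congr1 (fun v : V => (v *m z) ord0 ord0) h.
rewrite t0 scale0r addr0 /= mulmxDl -!scalemxAl w0z scaler0 addr0 mul0mx mxE uz00.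
rewrite mulr1 mxE => x0; split=> //.
by move/eqP: h; rewrite t0 x0 !scale0r add0r addr0 scaler_eq0 (negPf w0_neq0) orbF => /eqP.
Qed.

Lemma decomp v : exists b, v = (v *m z) ord0 ord0 *: u + b *: w0 +
  ((v *m n) ord0 ord0 / (w1 *m n) ord0 ord0) *: w1.
Proof.
have [f0 [f1 [f2 fE]]] := basis3_coord uw0w1_indep.
exists ((v *m f1) ord0 ord0); have vE := fE v.
have e1 : (v *m n) ord0 ord0 = (v *m f2) ord0 ord0 * (w1 *m n) ord0 ord0.
  by rewrite {1}vE !mulmxDl -!scalemxAl un w0n !scaler0 !add0r [LHS]mxE.
have e2 : (v *m z) ord0 ord0 = (v *m f0) ord0 ord0.
  by rewrite {1}vE !mulmxDl -!scalemxAl w0z w1z !scaler0 !addr0 [LHS]mxE uz00 mulr1.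
by rewrite e1 e2 mulfK ?gt_eqF ?w1n.
Qed.

Lemma span_w0 v : v *m z = 0 -> v *m n = 0 -> exists b, v = b *: w0.
Proof.
move=> vz vn; have [b ->] := decomp v; exists b.
by rewrite vz vn !mxE mul0r !scale0r add0r addr0.
Qed.

(** A Peano curve tangent to [E^s] inside a us-plaque has its image both in the plane of [z], by
    asymptoticity, and in the plane of [n], hence in the [w0]-line. It covers a piece of that line,
    and transitivity of [asym] continues along the line. *)
Lemma w0_line_asym x s : asym x (K (H x + s *: w0)).
Proof.
have local y : exists2 e : R, 0 < e & forall s, `|s| < e -> asym y (K (H y + s *: w0)).
  have [ch [t0 [c Wy]]] := Wus_fol.1 y.
  have [d d0 [Y [Y' [Y0 tY pY Yinj]]]] := @plaque_integral_curve R Pu Ps Ps (Wus y) t0 c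
    Pu_lf Ps_lf Ps_lf (fun x v => @inF_sumFr Pu Ps x v) ch.
  rewrite Wy in Y0.
  have Ya t : - d <= t <= d -> asym (Y 0) (Y t).
    move=> /andP[t1 t2]; have [tt|/ltW tt] := leP 0 t.
      apply/asym_sym/(scurve_asym tt (c' := Y')); apply: tcurve_sub tY => //.
      by rewrite oppr_le0 ltW.
    exact: (scurve_asym tt (tcurve_sub t1 (ltW d0) tY)).
  have [|t td|e e0 he] := curve_line_cover w0_neq0 d0 _ Yinj _.
  - by move=> t; exact: tcurve_continuous tY.
  - by apply: span_w0; [apply/asym_z/asym_sym/Ya|apply: (Wus_n (i := y))].
  by exists e => // s' /he[t td]; rewrite Y0 => ->; rewrite -Y0; exact: Ya.
apply: (@real_clopen R (fun s => asym x (K (H x + s *: w0))) 0).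
  by rewrite scale0r addr0 HK; exact: asym_refl.
move=> s1; have [e e0 he] := local (K (H x + s1 *: w0)).
exists e => // s2 /he; rewrite KH -addrA -scalerDl (addrC s1) subrK => h.
by split=> k; [exact: asym_trans k h|exact: asym_trans k (asym_sym h)].
Qed.

Lemma w0_diff_asym x y b : H y - H x = b *: w0 -> asym x y.
Proof.
move=> h; have := w0_line_asym x b; rewrite -h addrC subrK HK; exact.
Qed.

Lemma ccurve_exists x : exists p : R -> V, exists p' : R -> R -> R -> V,
  [/\ p 0 = x, continuous p, injective p & forall s t, s != t ->
     tcurve (inF Pc) (fun v => p (s + v * (t - s))) (p' s t) 0 1].
Proof.
have [t0 [c [Wx inj cont]]] := chart1_param x Wc_fol.
exists (fun s => Wc x (t0 + const_mx s) c).
pose tt s : 'rV[R]_1 := t0 + const_mx s.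
exists (fun s t v => 'd ((Wc x)^~ c) (tt s + v *: (tt t - tt s)) (tt t - tt s)).
split=> //.
  by rewrite (_ : const_mx 0 = 0) ?addr0.
move=> s t st; have [ch _] := Wc_fol.1 x.
have tne : tt s != tt t.
  apply: contra st => /eqP/addrI e; apply/eqP.
  by have := congr1 (fun v : 'rV[R]_1 => v ord0 ord0) e; rewrite !mxE.
have := @plaque_tcurve R 1 (inF Pc) (Wc x) (tt s) (tt t) c 0 1 ch tne.
suff -> : (fun v => Wc x (tt s + v *: (tt t - tt s)) c) =
   (fun v => Wc x (t0 + const_mx (s + v * (t - s))) c) by [].
apply/funext => v; congr (Wc x _ c); apply/rowP => j; rewrite !mxE; ring.
Qed.

(** If [w0 A] left the line of [w0], the directions [w0] and [w0 A] would span the plane [v z = 0],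
    and all points differing in that plane would be asymptotic. The ends of a center curve differ in
    it, which contradicts [asym_ccurve]. *)
Lemma w0_eigen : exists l, w0 *m A = l *: w0.
Proof.
have w0Az : (w0 *m A) *m z = 0 by rewrite -mulmxA Az -scalemxAr w0z scaler0.
have [w0An|w0An] := eqVneq ((w0 *m A) *m n) 0; first exact: span_w0.
have w0An0 : ((w0 *m A) *m n) ord0 ord0 != 0.
  apply: contra w0An => /eqP h; apply/eqP/matrixP => i j.
  by rewrite !ord1 h mxE.
have key x b : asym x (K (H x + b *: (w0 *m A))).
  have := asym_F (w0_line_asym (Fi x) b); rewrite FiK.
  set y := K (H (Fi x) + _); suff -> : F y = K (H x + b *: (w0 *m A)) by [].
  rewrite -[LHS]HK; congr K.
  have hy : H y = H (Fi x) + b *: w0 by rewrite /y KH.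
  have := HF y (Fi x); rewrite FiK hy [in RHS]addrAC subrr add0r -scalemxAl => <-.
  by rewrite addrC subrK.
have all x y : (H y - H x) *m z = 0 -> asym x y.
  move=> wz; set v := H y - H x in wz.
  pose b := (v *m n) ord0 ord0 / ((w0 *m A) *m n) ord0 ord0.
  have [||c cE] := @span_w0 (v - b *: (w0 *m A)).
  - by rewrite mulmxBl -scalemxAl wz w0Az scaler0 subrr.
  - rewrite mulmxBl -scalemxAl; apply/matrixP => i j; rewrite !ord1 mxE.
    by rewrite [X in _ + X]mxE [X in _ - X]mxE /b divfK // subrr mxE.
  apply: asym_trans (key x b) _; apply: (w0_diff_asym (b := c)).
  by rewrite KH -cE opprD addrA.
have [p [p' [p0 pc pinj tp]]] := ccurve_exists 0.
have ne : (0 : R) != 1 by rewrite eq_sym oner_neq0.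
have t01 := tp 0 1 ne.
have h := asym_ccurve t01 (all _ _ (ccurve_z ler01 t01)).
by move: h => /pinj; rewrite mul0r addr0 mul1r add0r subr0 => /eqP; rewrite (negPf ne).
Qed.

(** What is missing is that [n] is constant along a stable curve. A center curve through one of its
    points has injective [n]-coordinate, since equal values would give asymptotic points, so it is a
    local transversal against which the stable curve can be measured. *)
Lemma Ws_line : line_image H Ws w0.
Proof.
move=> i x y pl; case: (plaque_curve Ws_fol pl) => [->|[g [g' [tg <- <-]]]].
  by exists 0; rewrite subrr scale0r.
apply: span_w0; first by apply/asym_z/(scurve_asym ler01 tg).
have ga s t : 0 <= s <= 1 -> 0 <= t <= 1 -> asym (g s) (g t).
  have le s' t' : s' <= t' -> 0 <= s' -> t' <= 1 -> asym (g s') (g t').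
    by move=> st s0 t1; apply/asym_sym/(scurve_asym st (tcurve_sub s0 t1 tg)).
  move=> /andP[s0 s1] /andP[t0 t1]; case: (leP s t) => [st|/ltW ts]; first exact: le.
  exact/asym_sym/le.
apply: (@segment_clopen R (fun s => (H (g s) - H (g 0)) *m n = 0) 0 1 0) => //.
- by rewrite lexx ler01.
- by rewrite subrr mul0mx.
- move=> s s01; have [p [p' [p0 pc pinj tp]]] := ccurve_exists (g s).
  pose f t := (H (p t) *m n) ord0 ord0.
  have fc : continuous f.
    by apply: cont_coord; apply: cont_mulmxr; exact: cont_comp pc Hc.
  have pz t t' : (H (p t') - H (p t)) *m z = 0.
    case: (eqVneq t t') => [->|tt']; first by rewrite subrr mul0mx.
    have := ccurve_z ler01 (tp t t' tt').
    by rewrite mul0r addr0 mul1r (addrC t) subrK.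
  have pa t t' : asym (p t) (p t') -> t = t'.
    move=> h; apply/eqP/contraT => tt'.
    have := asym_ccurve (tp t t' tt').
    rewrite mul0r addr0 mul1r (addrC t) subrK => /(_ h)/pinj e.
    by rewrite e eqxx in tt'.
  have fn t t' : f t = f t' -> (H (p t') - H (p t)) *m n = 0.
    move=> e; rewrite mulmxBl; apply/matrixP => a b; rewrite !ord1 !mxE -/(f t) -/(f t').
    move: e; rewrite /f !mxE => ->; exact: subrr.
  have [|||e e0 he] := @segment_inj_cover R f (-1) 0 1.
  - by rewrite ltrN10 ltr01.
  - by move=> t _; exact: fc.
  - move=> t t' _ _ /fn h; have [b bE] := span_w0 (pz t t') h.
    exact: pa (w0_diff_asym bE).
  have hc : continuous (fun y => (H y *m n) ord0 ord0).
    by apply: cont_coord; exact: cont_mulmxr.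
  have /continuous_atP/(_ e e0)[d d0 hd] : {for s, continuous (fun t => (H (g t) *m n) ord0 ord0)}.
    exact: (continuous_comp (tcurve_continuous tg s01) (hc (g s))).
  (* [p t] is chosen with the [n]-coordinate of [g s']. It then also has the same [z]-coordinate, so
     it is asymptotic to [g s'], thus to [g s = p 0], and [t = 0]. *)
  exists d => // s' s'01 /hd; rewrite -{1}p0 => /he[t _ ft].
  have dz : (H (p t) - H (g s')) *m z = 0.
    have -> : H (p t) - H (g s') = (H (p t) - H (p 0)) + (H (p 0) - H (g s')) by rewrite subrKA.
    by rewrite mulmxDl pz add0r p0; apply/asym_z/ga.
  have dn : (H (p t) - H (g s')) *m n = 0.
    rewrite mulmxBl; apply/matrixP => a b; rewrite !ord1; move: ft; rewrite /f.
    by move: (H (p t) *m n) (H (g s') *m n) => M N e1; rewrite !mxE e1 subrr.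
  have [b bE] := span_w0 dz dn.
  have /pa t0 : asym (p 0) (p t).
    by rewrite p0; apply: asym_trans (ga s s' s01 s'01) (w0_diff_asym bE).
  suff -> : (H (g s') - H (g 0)) *m n = (H (g s) - H (g 0)) *m n by [].
  have -> : H (g s') - H (g 0) = - (H (p t) - H (g s')) + (H (g s) - H (g 0)).
    by rewrite -t0 p0; vec_ring.
  by rewrite mulmxDl mulNmx dn oppr0 add0r.
by rewrite ler01 lexx.
Qed.

Variable l : R.
Hypothesis w0A : w0 *m A = l *: w0.

Let Ainj (v : V) : v *m A = 0 -> v = 0.
Proof. by move=> h; rewrite -(mulmxK Au v) h mul0mx. Qed.

Lemma l_neq0 : l != 0.
Proof.
apply: contra w0_neq0 => /eqP e; apply/eqP/Ainj.
by rewrite w0A e scale0r.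
Qed.

(** This is [lines_expand] for the inverse dynamics: [Fi] acts on the [w0]-lines by [l^-1], and [F]
    contracts stable curves at rate [qs]. *)
Lemma l_le : `|l| <= qs.
Proof.
have w0Ai : w0 *m Ai = l^-1 *: w0.
  by rewrite -{2}(mulmxK Au w0) w0A -scalemxAl scalerA mulVf ?l_neq0 // scale1r.
have := @lines_expand R H K Fi F Ai HK KH Hc Kc He Ke FiK HFi Ps Ws w0 l^-1 qs
  w0_neq0 Ps_lf Ws_fol Ws_line w0Ai qs01 rs FC.
by rewrite normfV mulrC ler_pdivlMr ?mul1r // normr_gt0 l_neq0.
Qed.

(** The eigenvalue of [A] on the quotient by the plane of [u] and [w0]. *)
Let lc := ((w1 *m A) *m n) ord0 ord0 / (w1 *m n) ord0 ord0.

Lemma An_eigen : A *m n = lc *: n.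
Proof.
have h (v : V) : v *m (A *m n) = lc *: (v *m n).
  have [b vE] := decomp v; apply/matrixP => i j; rewrite !ord1.
  rewrite {1}vE !mulmxDl -!scalemxAl !mulmxA uA w0A -!scalemxAl un w0n !scaler0 !add0r.
  rewrite [LHS]mxE [RHS]mxE /lc; field.
  by rewrite gt_eqF // w1n.
apply/row_matrixP => i; rewrite !rowE h.
by rewrite -scalemxAr.
Qed.

Lemma lc_neq0 : lc != 0.
Proof.
apply: contra n_neq0 => /eqP e; have := An_eigen; rewrite e scale0r => h.
by rewrite -(mulKmx Au n) h mulmx0.
Qed.

(** Otherwise the functional [n] grows under [Fi] faster than center curves can, so it vanishes
    between the ends of a center curve. These ends then differ along [w0], hence are asymptotic,
    which is excluded. *)
Lemma lc_ge : 1 <= `|lc| * kcu.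
Proof.
rewrite leNgt; apply/negP => lt1.
have [p [p' [p0 pc pinj tp]]] := ccurve_exists 0.
have ne : (0 : R) != 1 by rewrite eq_sym oner_neq0.
have t01 := tp 0 1 ne.
have [C C0 hC] := rate_curve ler01 kcu0 FiC rcu
  (tcurve_weaken (fun x v => @inF_sumFl Pc Pu x v) t01).
have Ain : Ai *m n = lc^-1 *: n.
  have := mulKmx Au n; rewrite An_eigen -scalemxAr => /(congr1 ( *:%R lc^-1)).
  by rewrite scalerA mulVf ?lc_neq0 // scale1r.
have wn := @functional_zero R H Fi Ai n lc^-1 kcu C _ _ ucH HFi Ain _ hC.
have /wn {}wn : 1 <= kcu < `|lc^-1|.
  by rewrite kcu1 normfV -div1r ltr_pdivlMr ?normr_gt0 ?lc_neq0 // mulrC.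
have [b bE] := span_w0 (ccurve_z ler01 t01) wn.
have := asym_ccurve t01 (w0_diff_asym bE).
by move=> /pinj; rewrite mul0r addr0 mul1r add0r subr0 => /eqP; rewrite (negPf ne).
Qed.

(** [w1] lies in the contracted plane, while its [n]-coordinate is multiplied by [lc] at each
    step. *)
Lemma lc_lt1 : `|lc| < 1.
Proof.
rewrite ltNge; apply/negP => ge1.
have D0 : 0 < 3 * `|n| + 1 by rewrite ltr_wpDl // mulr_ge0.
have [N hN] := contr w1z (divr_gt0 w1n D0).
have := hN N (leqnn N); rewrite ltr_pdivlMr // => h.
have wAn : (w1 *m A ^+ N) *m n = lc ^+ N *: (w1 *m n).
  elim: (N) => [|k IH]; first by rewrite !expr0 mulmx1 scale1r.
  rewrite exprSr -mulmxE mulmxA -(mulmxA (w1 *m _)) An_eigen -scalemxAr IH scalerA.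
  by rewrite -exprS.
have h1 := le_trans (mx_entry_le _ ord0 ord0) (mulmx_norm_le (w1 *m A ^+ N) n).
move: h1; rewrite wAn mxE normrM normrX (gtr0_norm w1n) => h1.
have h2 : (w1 *m n) ord0 ord0 <= `|lc| ^+ N * (w1 *m n) ord0 ord0.
  by rewrite ler_peMl ?exprn_ege1 // ltW // w1n.
have := normr_ge0 (w1 *m A ^+ N); move: h1 h2 h.
move: ((w1 *m n) ord0 ord0) (`|lc| ^+ N * _) => a b; lra.
Qed.

(** [|l| * kcu <= qs * kcu < 1 <= |lc| * kcu]: the domination of the center over the stable bundle
    passes to [A]. *)
Lemma l_lt_lc : `|l| < `|lc|.
Proof.
have k0 : 0 < kcu by apply: lt_le_trans kcu1.
rewrite -(ltr_pM2r k0); apply: lt_le_trans lc_ge.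
by apply: le_lt_trans kcu_qs; rewrite mulrC ler_wpM2l // l_le.
Qed.

Lemma ec_exists : exists ec, [/\ ec *m A = lc *: ec, ec *m z = 0 & ec *m n = w1 *m n].
Proof.
have [||b bE] := @span_w0 (w1 *m A - lc *: w1).
- by rewrite mulmxBl -mulmxA Az -scalemxAr -scalemxAl w1z !scaler0 subrr.
- rewrite mulmxBl -mulmxA An_eigen -scalemxAr -scalemxAl subrr //.
have ne : lc - l != 0.
  by rewrite subr_eq0; apply: contraTneq l_lt_lc => ->; rewrite ltxx.
(* With [w1 A = lc w1 + b w0], the vector [w1 + c w0] is an eigenvector exactly when
   [b + c l = c lc]. *)
exists (w1 + (b / (lc - l)) *: w0); split.
- move/eqP: bE; rewrite subr_eq => /eqP E.
  rewrite mulmxDl E -scalemxAl w0A scalerDr !scalerA addrAC addrC; congr (_ + _).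
  rewrite -scalerDl; congr (_ *: _).
  by field.
- by rewrite mulmxDl -scalemxAl w1z w0z scaler0 addr0.
by rewrite mulmxDl -scalemxAl w0n scaler0 addr0.
Qed.

Hypothesis w1A : w1 *m A = lc *: w1.

(** The remaining plane is the kernel of [f1], the dual eigenvector for [l]. Under [Fi] it grows
    like [|l|^-1 > kcu], too fast for center-unstable curves, so it vanishes on them; center curves
    are then confined to the intersection with the kernel of [z]. *)
Lemma transverse_splitting : adapted_splitting H A Ws Wc Wu Wcs Wcu Wus.
Proof.
have [f0 [f1 [f2 fE]]] := basis3_coord uw0w1_indep.
have dual (v : V) (x y t : R) : v = x *: u + y *: w0 + t *: w1 ->
    (v *m f1) ord0 ord0 = y.
  move=> vE; have := fE v.
  set a := (v *m f0) _ _; set b := (v *m f1) _ _; set c := (v *m f2) _ _ => vE'.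
  have : (a - x) *: u + (b - y) *: w0 + (c - t) *: w1 = 0.
    move: (congr2 (fun p q : V => p - q) vE' vE); rewrite subrr => ->.
    by vec_ring.
  by move=> /uw0w1_indep[_ /eqP + _]; rewrite subr_eq0 => /eqP.
have f1A : A *m f1 = l *: f1.
  apply/row_matrixP => i; rewrite !rowE mulmxA -scalemxAr.
  move: (delta_mx 0 i) => v; apply/matrixP => a b; rewrite !ord1 [RHS]mxE.
  rewrite (@dual (v *m A) ((v *m f0) ord0 ord0 * r) (l * (v *m f1) ord0 ord0)
    ((v *m f2) ord0 ord0 * lc)) //.
  by rewrite {1}[v]fE !mulmxDl -!scalemxAl uA w0A w1A !scalerA (mulrC l).
have f1n0 : f1 != 0.
  apply/eqP => e; have := @dual w0 0 1 0; rewrite e mulmx0 mxE.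
  rewrite !scale0r scale1r add0r addr0 => /(_ erefl)/eqP.
  by rewrite eq_sym oner_eq0.
have cuf1 c c' : tcurve (sumF (inF Pc) (inF Pu)) c c' 0 1 -> (H (c 1) - H (c 0)) *m f1 = 0.
  move=> tc; have [C C0 hC] := rate_curve ler01 kcu0 FiC rcu tc.
  apply: (@functional_zero R H Fi Ai f1 l^-1 kcu C _ _ ucH HFi _ _ hC).
    have := mulKmx Au f1; rewrite f1A -scalemxAr => /(congr1 ( *:%R l^-1)).
    by rewrite scalerA mulVf ?l_neq0 // scale1r.
  rewrite kcu1 normfV -div1r ltr_pdivlMr ?normr_gt0 ?l_neq0 //.
  by apply: le_lt_trans kcu_qs; rewrite ler_wpM2l // l_le.
have Wcu_f i x y : plaque (Wcu i) x y -> (H y - H x) *m f1 = 0.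
  move=> pl; case: (plaque_curve Wcu_fol pl) => [->|[c [c' [tc <- <-]]]].
    by rewrite subrr mul0mx.
  exact: cuf1 tc.
have z0 : z != 0 by apply: contra_eq_neq uz => ->; rewrite mulmx0 eq_sym oner_eq0.
have w1n0 : w1 != 0.
  by apply: contraTneq w1n => ->; rewrite mul0mx mxE ltxx.
have f1_coord v y : (v *m f1) = 0 -> (v *m f1) ord0 ord0 = y -> y = 0.
  by move=> -> <-; rewrite mxE.
have coordE v : v = (v *m z) ord0 ord0 *: u + (v *m f1) ord0 ord0 *: w0 +
    ((v *m n) ord0 ord0 / (w1 *m n) ord0 ord0) *: w1.
  by have [b vE] := decomp v; rewrite (dual _ _ _ _ vE).
have Wc_line : line_image H Wc w1.
  move=> i x y pl; case: (plaque_curve Wc_fol pl) => [->|[c [c' [tc <- <-]]]].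
    by exists 0; rewrite subrr scale0r.
  eexists; rewrite [LHS]coordE (ccurve_z ler01 tc).
  rewrite (cuf1 _ _ (tcurve_weaken (fun x v => @inF_sumFl Pc Pu x v) tc)).
  by rewrite !mxE !scale0r !add0r.
have uf1 : u *m f1 = 0.
  apply/matrixP => i j; rewrite !ord1 [RHS]mxE; apply: (@dual u 1 0 0).
  by rewrite scale1r !scale0r !addr0.
have w1f1 : w1 *m f1 = 0.
  apply/matrixP => i j; rewrite !ord1 [RHS]mxE; apply: (@dual w1 0 0 1).
  by rewrite scale1r !scale0r !add0r.
exists w0, w1, u, l, lc, r; split.
- by split.
- move=> x y t; rewrite addrAC -addrA addrC addrAC => /uw0w1_indep[-> -> ->].
  by [].
- split=> //; first exact: l_lt_lc.
  + exact: lt_trans lc_lt1 r1.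
  + exact: lt_trans l_lt_lc lc_lt1.
- split=> x y; first exact: (line_leaf w0_neq0 Ws_fol Ws_line).
    exact: (line_leaf w1n0 Wc_fol Wc_line).
  exact: (line_leaf u_neq0 Wu_fol Wu_line).
split=> x y.
- rewrite (plane_leaf z0 Wcs_fol Wcs_z); split=> [h|[a [b ->]]].
    exists (((H y - H x) *m n) ord0 ord0 / (w1 *m n) ord0 ord0).
    exists (((H y - H x) *m f1) ord0 ord0).
    have h0 : ((H y - H x) *m z) ord0 ord0 = 0 by rewrite h mxE.
    by rewrite {1}[H y - H x]coordE h0 scale0r add0r addrC.
  by rewrite mulmxDl -!scalemxAl w1z w0z !scaler0 addr0.
- rewrite (plane_leaf f1n0 Wcu_fol Wcu_f); split=> [h|[a [b ->]]].
    exists (((H y - H x) *m n) ord0 ord0 / (w1 *m n) ord0 ord0).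
    exists (((H y - H x) *m z) ord0 ord0).
    have h0 : ((H y - H x) *m f1) ord0 ord0 = 0 by rewrite h mxE.
    by rewrite {1}[H y - H x]coordE h0 scale0r addr0 addrC.
  by rewrite mulmxDl -!scalemxAl w1f1 uf1 !scaler0 addr0.
rewrite (plane_leaf n_neq0 Wus_fol Wus_n); split=> [h|[a [b ->]]].
  exists (((H y - H x) *m z) ord0 ord0), (((H y - H x) *m f1) ord0 ord0).
  have h0 : ((H y - H x) *m n) ord0 ord0 = 0 by rewrite h mxE.
  by rewrite {1}[H y - H x]coordE h0 mul0r scale0r addr0.
by rewrite mulmxDl -!scalemxAl un w0n !scaler0 addr0.
Qed.

End Flat.

Theorem isolated_unstable_splitting : adapted_splitting H A Ws Wc Wu Wcs Wcu Wus.
Proof.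
have [n [n0 un Wn _]] := flat_foliation HK KH Hc Kc Ke Wus_fol uz u_saturated u_dense.
have [w0 [w00 w0z w0n]] : exists w0 : V, [/\ w0 != 0, w0 *m z = 0 & w0 *m n = 0].
  have K0 : kermx (row_mx z n) != 0.
    rewrite -mxrank_eq0 mxrank_ker -lt0n subn_gt0.
    by apply: leq_ltn_trans (rank_leq_col _) _.
  exists (nz_row (kermx (row_mx z n))).
  have : nz_row (kermx (row_mx z n)) *m row_mx z n = 0.
    by apply/sub_kermxP; exact: nz_row_sub.
  rewrite mul_mx_row -[0]hsubmxK => /eq_row_mx[-> ->].
  by split; [rewrite nz_row_eq0|apply/matrixP => i j; rewrite !mxE..].
have [w1 w1z w1n] := transverse_exists n0 un.
have [l w0A] : exists l, w0 *m A = l *: w0 by eapply w0_eigen; eassumption.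
have [ec [ecA ecz ecn]] : exists ec : V, [/\ ec *m A =
    (((w1 *m A) *m n) ord0 ord0 / (w1 *m n) ord0 ord0) *: ec, ec *m z = 0 &
    ec *m n = w1 *m n] by eapply ec_exists; eassumption.
have ecn0 : 0 < (ec *m n) ord0 ord0 by rewrite ecn.
eapply transverse_splitting; try eassumption.
rewrite ecA; congr (_ *: _).
by rewrite -scalemxAl ecn [X in _ = X / _]mxE mulfK // gt_eqF.
Qed.

End Core.

(** * The isolated eigenvalue *)

Section Cubics.
Variable R : realType.

(* The two roots of [x^2 - t x + d] lie in the open unit disc; the first case is
   that of non-real roots. *)
Definition contracting (t d : R) := (t ^+ 2 < 4 * d /\ d < 1) \/
  exists a b, [/\ t = a + b, d = a * b, `|a| < 1 & `|b| < 1].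

(** For non-real roots the form [q] is positive definite and multiplied by [d] at each step. For
    real roots [x n.+1 - b * x n] is geometric of ratio [a], and [x] is recovered by summation. *)
Lemma contracting_recurrence (t d : R) (x : nat -> R) : contracting t d ->
  (forall n, x n.+2 = t * x n.+1 - d * x n) ->
  forall e, 0 < e -> exists N, forall n, (N <= n)%N -> `|x n| < e.
Proof.
move=> [[td d1]|[a [b [tE dE a1 b1]]]] rec e e0.
  have d0 : 0 < d by have := sqr_ge0 t; lra.
  pose q n := x n.+1 ^+ 2 - t * x n.+1 * x n + d * x n ^+ 2.
  have qE n : q n = d ^+ n * q 0%N.
    elim: n => [|n IH]; first by rewrite mul1r.
    by rewrite exprS -mulrA -IH /q rec; ring.
  have k0 : 0 < d - t ^+ 2 / 4 by lra.
  have ql n : (d - t ^+ 2 / 4) * x n ^+ 2 <= q n.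
    by rewrite /q; have := sqr_ge0 (x n.+1 - t / 2 * x n); lra.
  have q0 : 0 <= q 0%N by apply: le_trans (ql 0%N); rewrite mulr_ge0 ?sqr_ge0 // ltW.
  have e10 : 0 < e ^+ 2 * (d - t ^+ 2 / 4) / (q 0%N + 1).
    by rewrite divr_gt0 ?mulr_gt0 ?exprn_gt0 // ltr_wpDl.
  have [|N hN] := geometric_small (q := d) _ e10; first by rewrite ltW.
  exists N => n /hN; rewrite ltr_pdivlMr ?ltr_wpDl // => h.
  have h1 : (d - t ^+ 2 / 4) * x n ^+ 2 < (d - t ^+ 2 / 4) * e ^+ 2.
    apply: le_lt_trans (ql n) _; rewrite qE [X in _ < X]mulrC.
    apply: le_lt_trans h.
    by rewrite ler_wpM2l ?exprn_ge0 ?(ltW d0) // lerDl.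
  move: h1; rewrite ltr_pM2l // -[x n ^+ 2]real_normK ?num_real // => h1.
  by rewrite -(ltr_pXn2r (n := 2)) ?nnegrE // ltW.
pose m := Num.max `|a| `|b|.
have m1 : m < 1 by rewrite gt_max a1.
have am : `|a| <= m by rewrite le_max lexx.
have bm : `|b| <= m by rewrite le_max lexx orbT.
(* A ratio strictly between [m] and 1 also handles [a = b], where [x n] may contain a term of order
   [n * a ^+ n]. *)
pose rho := (m + 1) / 2.
have rho1 : 0 <= rho < 1.
  by have := normr_ge0 a; rewrite /rho => ?; apply/andP; split; lra.
have brho : 0 < rho - `|b| by rewrite /rho; lra.
pose y n := x n.+1 - b * x n.
have yE n : y n = a ^+ n * y 0%N.
  elim: n => [|n IH]; first by rewrite mul1r.
  by rewrite exprS -mulrA -IH /y rec tE dE; ring.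
pose M := `|x 0%N| + `|y 0%N| / (rho - `|b|).
have M0 : 0 <= M by rewrite addr_ge0 // divr_ge0 // ltW.
have My : `|y 0%N| <= M * (rho - `|b|).
  by rewrite mulrDl divfK ?gt_eqF // lerDr mulr_ge0 // ltW.
have rho0 : 0 <= rho by case/andP: rho1.
have xM n : `|x n| <= M * rho ^+ n.
  elim: n => [|n IH]; first by rewrite mulr1 /M lerDl divr_ge0 // ltW.
  have -> : x n.+1 = b * x n + a ^+ n * y 0%N by rewrite -yE /y; ring.
  apply: le_trans (ler_normD _ _) _; rewrite !normrM normrX.
  have k1 : `|b| * `|x n| <= `|b| * (M * rho ^+ n) by rewrite ler_wpM2l.
  have k2 : `|a| ^+ n * `|y 0%N| <= rho ^+ n * (M * (rho - `|b|)).
    apply: ler_pM => //; rewrite ?exprn_ge0 // lerXn2r ?nnegrE //.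
    by apply: le_trans am _; rewrite /rho; lra.
  by rewrite exprS; lra.
have e10 : 0 < e / (M + 1) by rewrite divr_gt0 // ltr_wpDl.
have [N hN] := geometric_small rho1 e10.
exists N => n /hN; rewrite ltr_pdivlMr ?ltr_wpDl // => h.
apply: le_lt_trans (xM n) _; apply: le_lt_trans h.
by rewrite mulrC ler_wpM2l ?exprn_ge0 // lerDl.
Qed.

Lemma contracting_matrix (n : nat) (A : 'M[R]_n) (v : 'rV[R]_n) t d :
  contracting t d ->
  (forall k, v *m A ^+ k.+2 = t *: (v *m A ^+ k.+1) - d *: (v *m A ^+ k)) ->
  forall e, 0 < e -> exists N, forall k, (N <= k)%N -> `|v *m A ^+ k| < e.
Proof.
move=> td rec e e0; have e20 : 0 < e / 2 by rewrite divr_gt0.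
have co i : exists N, forall k, (N <= k)%N -> `|(v *m A ^+ k) ord0 i| < e / 2.
  apply: (contracting_recurrence td (x := fun k => (v *m A ^+ k) ord0 i)) => // k.
  rewrite rec.
  by move: (v *m _) (v *m _) => a b; rewrite !mxE.
have /fin_all_exists[N hN] := co.
exists (\max_i N i) => k Nk; apply: le_lt_trans (_ : e / 2 < e); last first.
  by rewrite ltr_pdivrMr // ltr_pMr // ltr1n.
apply: rV_norm_le => [|i]; first exact: ltW.
by apply/ltW/hN; apply: leq_trans Nk; exact: leq_bigmax.
Qed.

Definition cubic (r t d : R) : {poly R} := ('X - r%:P) * ('X^2 - t%:P * 'X + d%:P).

Lemma cubic_horner r t d x : (cubic r t d).[x] = (x - r) * (x ^+ 2 - t * x + d).
Proof. by rewrite /cubic !hornerE. Qed.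

Lemma cubic_perm r a b : cubic r (a + b) (a * b) = cubic a (r + b) (r * b).
Proof. by rewrite /cubic !polyCD !polyCM; ring. Qed.

Lemma monic_cubic (p : {poly R}) : p \is monic -> size p = 4%N ->
  exists r t d, p = cubic r t d.
Proof.
move=> pm ps; have [|r pr] := @odd_poly_root R p; first by rewrite ps.
have [q pq] := factor_theorem _ _ pr.
have qm : q \is monic by move: pm; rewrite pq monicMr // monicXsubC.
have qs : size q = 3%N.
  have := ps; rewrite pq size_Mmonic ?monicXsubC ?monic_neq0 //.
  by rewrite size_XsubC addn2 /= => -[].
exists r, (- q`_1), q`_0; rewrite pq mulrC /cubic; congr (_ * _).
have q2 : q`_2 = 1 by have /eqP := qm; rewrite /lead_coef qs.
apply/polyP => i; rewrite !(coefD, coefN, coefCM, coefC, coefX, coefXn).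
case: i => [|[|[|i]]] /=; rewrite ?q2; try lra.
by rewrite nth_default ?qs //; lra.
Qed.

(** The moduli of the roots multiply to 1. Three real roots off the unit circle are not all on one
    side, so one is alone on its side. A non-real pair has product [d] with [|r| * d = 1], so it
    lies across the circle from [r]. Roots outside the disc are described by their reciprocals, the
    roots of [x^2 - (t / d) x + d^-1]. *)
Lemma cubic_isolated_root (p : {poly R}) : p \is monic -> size p = 4%N ->
  `|p`_0| = 1 -> ~~ root p 1 -> ~~ root p (-1) ->
  exists r t d, [/\ p = cubic r t d, d != 0 &
    (1 < `|r| /\ contracting t d) \/ (`|r| < 1 /\ contracting (t / d) d^-1)].
Proof.
move=> pm ps p0 p1 pN1.
have [r [t [d pE]]] := monic_cubic pm ps.
have ne1 x : root p x -> `|x| != 1.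
  move=> px; apply/eqP => /eqP; rewrite eqr_norml ler01 andbT => /orP[]/eqP e;
    by move: px; rewrite e ?(negPf p1) ?(negPf pN1).
have rd : `|r| * `|d| = 1.
  rewrite -p0 -horner_coef0 pE cubic_horner expr0n mulr0 !sub0r oppr0 add0r.
  by rewrite normrM normrN.
have d0 : d != 0 by apply: contra_eq_neq rd => ->; rewrite normr0 mulr0 eq_sym oner_neq0.
have r0 : r != 0 by apply: contra_eq_neq rd => ->; rewrite normr0 mul0r eq_sym oner_neq0.
have ra0 : 0 < `|r| by rewrite normr_gt0.
have da0 : 0 < `|d| by rewrite normr_gt0.
have rr : root p r by rewrite /root pE cubic_horner subrr mul0r.
have [neg|pos] := ltP (t ^+ 2) (4 * d).
  exists r, t, d; split=> //.
  have dp : 0 < d by have := sqr_ge0 t; lra.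
  rewrite (gtr0_norm dp) in rd.
  have [r1|r1|] := ltgtP `|r| 1; last by have := ne1 r rr => /eqP.
    right; split=> //; left; split.
      rewrite expr_div_n ltr_pdivrMr ?exprn_gt0 //.
      by have -> : 4 / d * d ^+ 2 = 4 * d by field.
    rewrite invf_lt1 //; nra.
  left; split=> //; left; split=> //; nra.
pose s := Num.sqrt (t ^+ 2 - 4 * d).
have s2 : s ^+ 2 = t ^+ 2 - 4 * d by rewrite sqr_sqrtr // subr_ge0.
pose a := (t + s) / 2; pose b := (t - s) / 2.
have tE : t = a + b by rewrite /a /b; lra.
have dE : d = a * b by rewrite /a /b; lra.
have pE1 : p = cubic r (a + b) (a * b) by rewrite pE tE dE.
have pE2 := etrans pE1 (cubic_perm r a b).
have pE3 : p = cubic b (r + a) (r * a).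
  by rewrite pE1 addrC mulrC cubic_perm.
have ra : root p a by rewrite /root pE2 cubic_horner subrr mul0r.
have rb : root p b by rewrite /root pE3 cubic_horner subrr mul0r.
have prod : `|r| * (`|a| * `|b|) = 1 by rewrite -normrM -dE.
have [a0 b0] : a != 0 /\ b != 0.
  by move: d0; rewrite dE mulf_eq0 negb_or => /andP[].
have inv (x y : R) : x != 0 -> y != 0 -> 1 < `|x| -> 1 < `|y| ->
    contracting ((x + y) / (x * y)) (x * y)^-1.
  move=> x0 y0 x1 y1; right; exists x^-1, y^-1; split.
  - by field; rewrite x0 y0.
  - by rewrite invfM.
  - by rewrite normfV invf_lt1 // normr_gt0.
  by rewrite normfV invf_lt1 // normr_gt0.
have dir (x y : R) : `|x| < 1 -> `|y| < 1 -> contracting (x + y) (x * y).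
  by move=> x1 y1; right; exists x, y.
have bnd (x y w : R) : 0 <= x -> 0 <= y -> 0 <= w -> x < 1 -> y < 1 -> w < 1 ->
    x * (y * w) != 1.
  move=> x0 y0 w0 x1 y1 w1; rewrite lt_eqF //.
  apply: le_lt_trans x1; rewrite ler_piMr // mulr_ile1 // ltW //.
have bnd2 (x y w : R) : 1 < x -> 1 < y -> 1 < w -> x * (y * w) != 1.
  move=> x1 y1 w1; have k : 1 < y * w by nra.
  by rewrite gt_eqF //; nra.
have nr := ne1 r rr; have na := ne1 a ra; have nb := ne1 b rb.
have [r1|r1|] := ltgtP `|r| 1; last by move/eqP: nr.
- have [a1|a1|] := ltgtP `|a| 1; last by move/eqP: na.
  + have [b1|b1|] := ltgtP `|b| 1; last by move/eqP: nb.
      by have := bnd _ _ _ (normr_ge0 r) (normr_ge0 a) (normr_ge0 b) r1 a1 b1; rewrite prod eqxx.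
    by exists b, (r + a), (r * a); rewrite mulf_neq0 //; split=> //; left; split=> //; exact: dir.
  + have [b1|b1|] := ltgtP `|b| 1; last by move/eqP: nb.
      by exists a, (r + b), (r * b); rewrite mulf_neq0 //; split=> //; left; split=> //; exact: dir.
    by exists r, (a + b), (a * b); rewrite mulf_neq0 //; split=> //; right; split=> //; exact: inv.
have [a1|a1|] := ltgtP `|a| 1; last by move/eqP: na.
- have [b1|b1|] := ltgtP `|b| 1; last by move/eqP: nb.
    by exists r, (a + b), (a * b); rewrite mulf_neq0 //; split=> //; left; split=> //; exact: dir.
  by exists a, (r + b), (r * b); rewrite mulf_neq0 //; split=> //; right; split=> //; exact: inv.
have [b1|b1|] := ltgtP `|b| 1; last by move/eqP: nb.
  by exists b, (r + a), (r * a); rewrite mulf_neq0 //; split=> //; right; split=> //; exact: inv.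
by have := bnd2 _ _ _ r1 a1 b1; rewrite prod eqxx.
Qed.

End Cubics.

Section IsolatedEigenvalue.
Variable R : realType.

Lemma rank_le1 (m n : nat) (N : 'M[R]_(m, n)) : (\rank N <= 1)%N ->
  exists (c : 'cV[R]_m) (l : 'rV[R]_n), N = c *m l.
Proof.
have := mulmx_base N; move: (col_base N) (row_base N).
case: (\rank N) => [|[|//]] c l <- _; last by exists c, l.
by exists 0, 0; rewrite mul0mx thinmx0 mul0mx.
Qed.

Lemma det3 (a : 'I_3 -> 'I_3 -> R) (i := ord0 : 'I_3) (j := lift ord0 ord0 : 'I_3)
    (k := ord_max : 'I_3) :
  \det (\matrix_(s, t) a s t) =
    a i i * (a j j * a k k - a j k * a k j)
  - a i j * (a j i * a k k - a j k * a k i)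
  + a i k * (a j i * a k j - a j j * a k i).
Proof.
have E (f : nat -> nat -> R) :
    \det (\matrix_(s < 3, t < 3) f s t) =
      f 0 0 * (f 1 1 * f 2 2 - f 1 2 * f 2 1)
    - f 0 1 * (f 1 0 * f 2 2 - f 1 2 * f 2 0)
    + f 0 2 * (f 1 0 * f 2 1 - f 1 1 * f 2 0) :> R.
  rewrite (expand_det_row _ ord0) !big_ord_recl big_ord0 /cofactor.
  do 3! rewrite (expand_det_row _ ord0) !big_ord_recl big_ord0 /cofactor !det_mx11.
  rewrite !mxE /=.
  rewrite /bump /=; ring.
have -> : \matrix_(s, t) a s t = \matrix_(s < 3, t < 3) (fun p q => a (inord p) (inord q)) s t.
  by apply/matrixP => s t; rewrite !mxE !inord_val.
have e0 : inord 0 = i by apply/val_inj; rewrite /= inordK.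
have e1 : inord 1 = j by apply/val_inj; rewrite /= inordK.
have e2 : inord 2 = k by apply/val_inj; rewrite /= inordK.
by rewrite (E (fun p q => a (inord p) (inord q))) e0 e1 e2.
Qed.

Lemma char_poly_horner (n : nat) (A : 'M[R]_n) x : (char_poly A).[x] = \det (x%:M - A).
Proof.
rewrite -[LHS]/(horner_eval x _) -det_map_mx; congr (\det _).
apply/matrixP => i j; rewrite !mxE.
by rewrite -[LHS]/(_.[x]) hornerD hornerN hornerMn hornerX hornerC.
Qed.

Lemma det_rank_one_perturbation (c : 'cV[R]_3) (l : 'rV[R]_3) y :
  \det (y%:M - c *m l) = y ^+ 2 * (y - (l *m c) ord0 ord0).
Proof.
have -> : y%:M - c *m l = \matrix_(s, t) (y *+ (s == t) - c s ord0 * l ord0 t).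
  by apply/matrixP => s t; rewrite !mxE big_ord_recl big_ord0 addr0.
rewrite det3 !mxE !big_ord_recl big_ord0 /=.
have -> : lift ord0 (lift ord0 ord0) = ord_max :> 'I_3 by apply/val_inj.
rewrite !mulr1n !mulr0n; ring.
Qed.

(* If the [r]-eigenspace had dimension 2, then [A - r] would have rank one and
   [r] would be a double root of the characteristic polynomial. *)
Lemma repeated_eigenvector (A : 'M[R]_3) (u w : 'rV[R]_3) (z : 'cV[R]_3) r t d :
  u *m A = r *: u -> w *m A = r *: w -> u *m z = 1%:M -> w *m z = 0 ->
  char_poly A = cubic r t d -> r ^+ 2 - t * r + d != 0 -> w = 0.
Proof.
move=> uA wA uz wz pE qr.
have [U1|U2] := leqP (\rank (col_mx u w)) 1.
  have [c [l /esym cl]] := rank_le1 U1.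
  rewrite -[c]vsubmxK mul_col_mx in cl; case/eq_col_mx: cl => cu cw.
  have sc (a : 'M[R]_1) (b : 'M[R]_(1, 3)) : a *m b = a ord0 ord0 *: b.
    by rewrite {1}[a]mx11_scalar mul_scalar_mx.
  have [k lz] : exists k : R, l *m z = k%:M by exists ((l *m z) ord0 ord0); rewrite -mx11_scalar.
  move: uz wz; rewrite -cu -cw !sc -!scalemxAl lz !scale_scalar_mx => h1 h2.
  have e1 : usubmx c ord0 ord0 * k = 1 by have /matrixP/(_ ord0 ord0) := h1; rewrite !mxE !mulr1n.
  have e2 : dsubmx c ord0 ord0 * k = 0 by have /matrixP/(_ ord0 ord0) := h2; rewrite !mxE !mulr1n.
  move/eqP: e2; rewrite mulf_eq0 => /orP[/eqP->|/eqP k0]; first by rewrite scale0r.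
  by move/eqP: e1; rewrite k0 mulr0 eq_sym oner_eq0.
pose N := A - r%:M.
have UN : col_mx u w *m N = 0.
  by rewrite mulmxBr mul_mx_scalar mul_col_mx scale_col_mx uA wA subrr.
have N1 : (\rank N <= 1)%N.
  by rewrite -(leq_add2l 2); apply: leq_trans (mulmx0_rank_max UN); rewrite leq_add2r.
have [c [l cl]] := rank_le1 N1.
pose s := (l *m c) ord0 ord0.
have ev y : y * ((y + r) ^+ 2 - t * (y + r) + d) = y ^+ 2 * (y - s).
  rewrite -det_rank_one_perturbation -cl.
  have -> : y%:M - N = (y + r)%:M - A by rewrite /N opprB addrA raddfD.
  by rewrite -char_poly_horner pE cubic_horner addrK.
(* Subtracting the values at 1 and -1 isolates the coefficient of [y], which is [r ^+ 2 - t * r + d]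
   on the left and 0 on the right. *)
have h1 := ev 1; have h2 := ev (-1); case/eqP: qr; lra.
Qed.

Lemma contracting_nonroot t d (x : R) : contracting t d -> 1 < `|x| ->
  x ^+ 2 - t * x + d != 0.
Proof.
move=> [[td _]|[a [b [-> -> a1 b1]]]] x1.
  by rewrite gt_eqF //; have := sqr_ge0 (x - t / 2); lra.
have -> : x ^+ 2 - (a + b) * x + a * b = (x - a) * (x - b) by ring.
by rewrite mulf_neq0 // subr_eq0; apply: contraTneq x1 => ->; rewrite -leNgt ltW.
Qed.

Definition eigen_pair (A : 'M[R]_3) r (u : 'rV[R]_3) (z : 'cV[R]_3) :=
  [/\ u *m A = r *: u, A *m z = r *: z & u *m z = 1%:M].

Definition contracts (A : 'M[R]_3) (z : 'cV[R]_3) := forall v : 'rV[R]_3, v *m z = 0 ->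
  forall e, 0 < e -> exists N, forall n, (N <= n)%N -> `|v *m A ^+ n| < e.

(** By Cayley-Hamilton the quadratic factor at [A], called [Q], satisfies [(A - r) Q = 0], so its
    columns are right [r]-eigenvectors; [z] is one of them, normalised against [u]. On the plane
    [v z = 0] the matrix [Q] vanishes, and this is the recurrence that governs orbits. *)
Lemma isolated_eigenvalue (A : 'M[R]_3) : `|\det A| = 1 ->
  ~~ root (char_poly A) 1 -> ~~ root (char_poly A) (-1) ->
  exists r u z, eigen_pair A r u z /\
    ((1 < `|r| /\ contracts A z) \/ (`|r| < 1 /\ contracts (invmx A) z)).
Proof.
move=> dA p1 pN1.
have p0 : `|(char_poly A)`_0| = 1.
  by rewrite char_poly_det normrM normrX normrN1 expr1n mul1r.
have [r [t [d [pE d0 alt]]]] :=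
  cubic_isolated_root (char_poly_monic A) (size_char_poly A) p0 p1 pN1.
have Au : A \in unitmx.
  by rewrite unitmxE unitfE -normr_eq0 dA oner_eq0.
have r0 : r != 0.
  apply: contra_eq_neq p0 => r0.
  by rewrite -horner_coef0 pE cubic_horner r0 subrr mul0r normr0 eq_sym oner_neq0.
have qr : r ^+ 2 - t * r + d != 0.
  case: alt => -[r1 c]; first exact: contracting_nonroot.
  have := contracting_nonroot (x := r^-1) c; rewrite normfV invf_gt1 ?normr_gt0 //.
  move=> /(_ r1); apply: contraNneq => h.
  have -> : r^-1 ^+ 2 - t / d * r^-1 + d^-1 = (r ^+ 2 - t * r + d) / (d * r ^+ 2).
    by field; rewrite r0.
  by rewrite h mul0r.
have : root (char_poly A) r by rewrite pE /root cubic_horner subrr mul0r.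
rewrite -eigenvalue_root_char => /eigenvalueP[u uA u0].
pose Q := A ^+ 2 - t *: A + d%:M.
have CH : (A - r%:M) * Q = 0.
  rewrite -(Cayley_Hamilton A) pE /cubic expr2 rmorphM /= !(rmorphB, rmorphD) /= !rmorphM /=.
  by rewrite !horner_mx_C horner_mx_X /Q expr2 -!mulmxE mul_scalar_mx.
have CH' : Q *m (A - r%:M) = 0.
  rewrite -CH /Q; apply: comm_mxB; last exact: comm_mx_scalar.
  apply: comm_mx_sym; apply: comm_mxD; last exact: comm_mx_scalar.
  apply: comm_mxB; first by rewrite expr2; apply: comm_mxM; exact: comm_mx_refl.
  by rewrite /comm_mx -scalemxAl -scalemxAr.
have [j uj] : exists j, u ord0 j != 0 by apply/rV0Pn.
pose q := r ^+ 2 - t * r + d.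
pose z : 'cV[R]_3 := (q * u ord0 j)^-1 *: (Q *m delta_mx j ord0).
have uQ : u *m Q = q *: u.
  rewrite /Q mulmxDr mulmxBr expr2 -mulmxE mulmxA -scalemxAr !uA mul_mx_scalar.
  by rewrite -scalemxAl uA !scalerA -scalerBl -scalerDl.
have Az : A *m z = r *: z.
  rewrite /z -scalemxAr scalerA [r * _]mulrC -scalerA; congr (_ *: _).
  move/eqP: CH; rewrite mulrBl subr_eq0 -!mulmxE mul_scalar_mx mulmxA => /eqP ->.
  by rewrite -scalemxAl.
have uz : u *m z = 1%:M.
  rewrite /z -scalemxAr mulmxA uQ -scalemxAl scalerA -colE [col j u]mx11_scalar mxE.
  by rewrite scale_scalar_mx -mulrA mulVf // mulf_neq0.
(* [v Q] is a left [r]-eigenvector killed by [z], and [repeated_eigenvector] leaves it no choice but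
   0. *)
have kerQ (v : 'rV[R]_3) : v *m z = 0 -> v *m Q = 0.
  move=> vz; apply: (repeated_eigenvector uA _ uz _ pE qr).
    apply/eqP; rewrite -subr_eq0 -mul_mx_scalar -mulmxBr -mulmxA CH'.
    by rewrite mulmx0.
  have Qz : Q *m z = q *: z.
    rewrite /Q mulmxDl mulmxBl expr2 -mulmxE -mulmxA -scalemxAl !Az mul_scalar_mx.
    by rewrite -scalemxAr Az !scalerA -scalerBl -scalerDl -mulrBl -mulrDl.
  by rewrite -mulmxA Qz -scalemxAr vz scaler0.
exists r, u, z; split=> //.
have rec (v : 'rV[R]_3) k : v *m z = 0 ->
    v *m A ^+ k.+2 = t *: (v *m A ^+ k.+1) - d *: (v *m A ^+ k).
  move=> /kerQ; rewrite /Q mulmxDr mulmxBr mul_mx_scalar -scalemxAr => h.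
  have this : v *m A ^+ 2 = t *: (v *m A) - d *: v.
    by apply/eqP; rewrite -subr_eq0 opprB addrA addrAC h.
  rewrite -{1}[k.+2]/(2 + k)%N exprD -mulmxE mulmxA this mulmxBl -!scalemxAl.
  by rewrite exprS -mulmxE mulmxA.
case: alt => -[r1 c]; [left|right]; split=> // v vz e e0.
  by apply: (contracting_matrix c) => // k; exact: rec.
apply: (contracting_matrix c) => // k.
have := rec v 0%N vz; rewrite expr1 expr0 mulmx1 expr2 -mulmxE => h.
have E (w : 'rV[R]_3) i : w *m A *m invmx A ^+ i.+1 = w *m invmx A ^+ i.
  by rewrite exprS -mulmxE -mulmxA mulKVmx.
have := congr1 (mulmx^~ (invmx A ^+ k.+2)) h.
rewrite mulmxBl -!scalemxAl mulmxA !E => ->.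
by rewrite scalerBr !scalerA mulVf // scale1r [d^-1 * t]mulrC subKr.
Qed.

(** The characteristic polynomial has integer coefficients, so its values at the integers 1 and -1
    vanish over [algC] exactly when they vanish over [R]. *)
Lemma hyperbolic_isolated (M : 'M[int]_3) (A := map_mx intr M : 'M[R]_3) :
  hyperbolic_aut M -> A \in unitmx /\ exists r u z, eigen_pair A r u z /\
    ((1 < `|r| /\ contracts A z) \/ (`|r| < 1 /\ contracts (invmx A) z)).
Proof.
move=> [dM hM].
have dA : `|\det A| = 1.
  by rewrite det_map_mx; case: dM => ->; rewrite ?rmorphN /= ?normrN normr1.
have nr (e : int) : `|e| = 1 -> ~~ root (char_poly A) e%:~R.
  move=> e1; rewrite -map_char_poly /root horner_map intr_eq0 -/(root _ e).
  apply: contraL (isT) => pe.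
  have := hM e%:~R; rewrite eigenvalue_root_char -map_char_poly /root horner_map /=.
  rewrite (eqP pe) eqxx => /(_ isT); rewrite -intr_norm.
  by rewrite e1 eqxx.
split; first by rewrite unitmxE unitfE -normr_eq0 dA oner_eq0.
apply: isolated_eigenvalue => //; first by have := nr 1 erefl.
by have := nr (-1) erefl; rewrite rmorphN.
Qed.

End IsolatedEigenvalue.

(** * Rates of expansion and contraction *)

Section LineProjections.
Variable R : realType.
Local Notation V := 'rV[R]_3.

(** Compactness leaves room below a strict bound; pointwise strict inequalities become uniform in
    this way. *)
Lemma periodic_gap (phi : V -> R) c : continuous phi ->
  (forall x n, intvec n -> phi (x + n) = phi x) -> (forall x, phi x < c) ->
  exists2 c', c' < c & forall x, phi x <= c'.
Proof.
move=> phic per lt.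
have [x|a b y /andP[b0 ba] h|a y n n_int h|a a0 h] := @periodic_uniform R
  (fun a x => phi x <= c - a); last by exists (c - a); first lra.
- have e0 : 0 < (c - phi x) / 2 by have := lt x; lra.
  have [d d0 hd] := continuousP_eps phic x e0.
  exists ((c - phi x) / 2) => //; exists d => // y /hd; rewrite ltr_norml; lra.
- lra.
by rewrite per.
Qed.

Definition quad (X : 'M[R]_3) (v : V) : R := (v *m X *m v^T) ord0 ord0.

(** The Euclidean square, as opposed to the maximum norm [|v|]. *)
Definition sq (v : V) : R := (v *m v^T) ord0 ord0.

Lemma quadZ X a v : quad X (a *: v) = a ^+ 2 * quad X v.
Proof. by rewrite /quad linearZ /= -!scalemxAl -scalemxAr scalerA mxE expr2. Qed.

Lemma sqZ a v : sq (a *: v) = a ^+ 2 * sq v.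
Proof. by rewrite /sq linearZ /= -scalemxAl -scalemxAr scalerA mxE expr2. Qed.

Lemma sqE v : sq v = v ord0 ord0 ^+ 2 + v ord0 (lift ord0 ord0) ^+ 2 + v ord0 ord_max ^+ 2.
Proof.
rewrite /sq mxE !big_ord_recl big_ord0 !mxE -!expr2 addr0 addrA.
by congr (_ + v _ _ ^+ 2); exact/val_inj.
Qed.

Lemma sq_ge v : `|v| ^+ 2 <= sq v.
Proof.
have [j <-] := rV_norm_attained v; rewrite real_normK ?num_real //.
rewrite /sq mxE (bigD1 j) //= mxE -expr2 lerDl.
by apply: sumr_ge0 => i _; rewrite mxE -expr2 sqr_ge0.
Qed.

Lemma sq_le v : sq v <= 3 * `|v| ^+ 2.
Proof.
have h j : v ord0 j ^+ 2 <= `|v| ^+ 2.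
  by rewrite -[leLHS]real_normK ?num_real // lerXn2r ?nnegrE // mx_entry_le.
by rewrite sqE; have := h ord0; have := h (lift ord0 ord0); have := h ord_max; lra.
Qed.

Lemma sq_gt0 v : v != 0 -> 0 < sq v.
Proof.
by move=> v0; apply: lt_le_trans (sq_ge v); rewrite exprn_gt0 // normr_gt0.
Qed.

Definition line_proj (P : 'M[R]_3) := P^T = P /\ P *m P = P /\ \rank P = 1%N.

Lemma line_proj_unit P : line_proj P ->
  exists p : V, [/\ sq p = 1, p *m P = p & P = p^T *m p].
Proof.
move=> [PT [PP rk]].
pose w := nz_row P.
have w0 : w != 0 by rewrite nz_row_eq0 -mxrank_eq0 rk.
have wP : w *m P = w.
  by have /submxP[a e] := nz_row_sub P; rewrite /w e -mulmxA PP.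
have s0 := sq_gt0 w0.
have ww : w *m w^T = (sq w)%:M by rewrite [LHS]mx11_scalar.
have /submxP[c Pc] : (P <= w)%MS.
  have := mxrank_leqif_eq (nz_row_sub P).
  by rewrite -/w rk rank_rV w0 => -[_ /esym /andP[]].
have wE : w^T = sq w *: c.
  have : P *m w^T = w^T by rewrite -{1}PT -trmx_mul wP.
  by rewrite Pc -mulmxA ww mul_mx_scalar => ->.
pose k := Num.sqrt (sq w).
have k0 : 0 < k by rewrite sqrtr_gt0.
have k2 : k ^+ 2 = sq w by rewrite sqr_sqrtr // ltW.
exists (k^-1 *: w); split.
- by rewrite sqZ exprVn k2 mulVf // gt_eqF.
- by rewrite -scalemxAl wP.
have -> : (k^-1 *: w)^T = k^-1 *: w^T by rewrite linearZ.
rewrite -scalemxAl -scalemxAr scalerA -expr2 exprVn k2 wE.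
by rewrite -scalemxAl scalerA mulVf ?gt_eqF // scale1r.
Qed.

Lemma line_proj_span (p a : V) (P : 'M[R]_3) : P = p^T *m p -> a *m P = a ->
  exists k : R, a = k *: p.
Proof.
move=> -> <-; exists ((a *m p^T) ord0 ord0).
by rewrite mulmxA {1}[a *m p^T]mx11_scalar mul_scalar_mx.
Qed.

Lemma line_proj_quad P X a : line_proj P -> a *m P = a ->
  quad X a = \tr (P *m X) * sq a.
Proof.
move=> /line_proj_unit[p [p1 _ PE]] /(line_proj_span PE)[k ->].
rewrite quadZ sqZ p1 mulr1 mulrC PE -mulmxA mxtrace_mulC /quad.
by rewrite {2}[p *m X *m _]mx11_scalar mxtrace_scalar.
Qed.

Lemma line_proj_trace_gt0 P X : line_proj P -> (forall v, v != 0 -> 0 < quad X v) ->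
  0 < \tr (P *m X).
Proof.
move=> lp X0; have [p [p1 pP _]] := line_proj_unit lp.
have p0 : p != 0.
  by apply: contra_eq_neq p1 => ->; rewrite /sq mul0mx mxE eq_sym oner_eq0.
by have := X0 p p0; rewrite (line_proj_quad X lp pP) p1 mulr1.
Qed.

Lemma cont_trace (f : V -> 'M[R]_3) : continuous f -> continuous (fun x => \tr (f x)).
Proof.
move=> fc x; apply: (@continuous_sum_at R V R) => i.
exact: (continuous_comp (fc x) (@coord_continuous R 3 3 i i (f x))).
Qed.

Lemma cont_mulr (f g : V -> R) : continuous f -> continuous g ->
  continuous (fun x => f x * g x).
Proof. by move=> fc gc x; exact: (continuousM (fc x) (gc x)). Qed.

Definition jac (f : V -> V) (x : V) : 'M[R]_3 := lin1_mx ('d f x).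

Lemma jacE f x v : v *m jac f x = 'd f x v.
Proof. exact: mul_rV_lin1. Qed.

Lemma jac_cont f : C1 f -> continuous (jac f).
Proof.
move=> [_ fc]; apply: cont_matrix => i j x.
have -> : (fun y => jac f y i j) = (fun y => 'd f y (delta_mx ord0 i) ord0 j).
  by apply/funext => y; rewrite mxE.
exact: (continuous_comp (fc _ x) (@coord_continuous R 1 3 ord0 j _)).
Qed.

Lemma jac_periodic f x n : (forall x, differentiable f x) -> int_equivariant f -> intvec n ->
  jac f (x + n) = jac f x.
Proof.
move=> df fe /fe[k _ h]; apply/row_matrixP => i.
apply: etrans (rowE _ _) (etrans _ (esym (rowE _ _))).
apply: etrans (jacE f _ _) (etrans _ (esym (jacE f _ _))).
apply: etrans (esym (deriveE _ (df (x + n)))) (etrans _ (deriveE _ (df x))).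
apply: (congr1 (fun h : R -> V => lim (h @ 0^'))); apply/funext => t /=.
by rewrite addrA !h; congr (_ *: _); rewrite opprD addrACA subrr addr0.
Qed.

Lemma C1_sub (f : V -> V) k : C1 f -> C1 (fun x => f x - k).
Proof.
move=> [df fc].
have dk x : differentiable (cst k : V -> V) x by exact: differentiable_cst.
have dfk x : differentiable (fun x => f x - k) x := differentiableB (df x) (dk x).
split=> [x|v]; first exact: dfk.
suff -> : (fun x => 'd (fun x => f x - k) x v) = (fun x => 'd f x v) by exact: fc.
apply/funext => x; apply: etrans (esym (deriveE _ (dfk x))) (etrans _ (deriveE _ (df x))).
apply: (congr1 (fun h : R -> V => lim (h @ 0^'))); apply/funext => t /=.
by congr (_ *: _); rewrite opprB addrA addrNK.
Qed.

Lemma diff_compE (f h : V -> V) x v : differentiable h x -> differentiable f (h x) ->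
  'd (f \o h) x v = 'd f (h x) ('d h x v).
Proof. by move=> dh df; exact: (congr1 (fun u : V -> V => u v) (diff_comp dh df)). Qed.

Lemma C1_comp (f h : V -> V) : C1 f -> C1 h -> C1 (f \o h).
Proof.
move=> [df fc] [dh hc]; split=> [x|v]; first exact: differentiable_comp.
have -> : (fun x => 'd (f \o h) x v) = (fun x => v *m jac h x *m jac f (h x)).
  apply/funext => x; apply: etrans (diff_compE v (dh x) (df (h x))) _.
  by apply: esym; apply: etrans (jacE f _ _) _; congr ('d f _ _); exact: jacE.
apply: cont_mulmx; last apply: cont_comp (jac_cont _) => //.
  apply: cont_mulmx; last exact: jac_cont.
  by move=> x; exact: cst_continuous.
by move=> x; exact: differentiable_continuous.
Qed.

Lemma C1_iter (f : V -> V) : C1 f -> iter_C1 f.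
Proof.
move=> fC; elim=> [|n IH]; last exact: (C1_comp fC IH).
split=> [x|v x]; first exact: ex_diff.
have -> : (fun x => 'd (iter 0 f) x v) = cst v by apply/funext => y; exact: diff_idE.
exact: cst_continuous.
Qed.

End LineProjections.

(** * The expansion factor of a differential along a line field *)

Section Stretch.
Variable R : realType.
Local Notation V := 'rV[R]_3.

Lemma cont_trmx (f : V -> 'M[R]_3) : continuous f -> continuous (fun x => (f x)^T).
Proof.
move=> fc; apply: cont_matrix => i j x.
have -> : (fun y => (f y)^T i j) = (fun y => f y j i) by apply/funext => y; rewrite mxE.
exact: (continuous_comp (fc x) (@coord_continuous R 3 3 j i (f x))).
Qed.

Section Metric.
Variables (g : V -> 'M[R]_3) (f : V -> V) (P : V -> 'M[R]_3).
Hypothesis gm : riem_metric g.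
Hypothesis fC : C1 f.
Hypothesis fe : int_equivariant f.
Hypothesis Pl : line_field P.

Let lp x : line_proj (P x) := Pl.2.2 x.
Let gpos x v : v != 0 -> 0 < quad (g x) v := (gm.2.2 x).2 v.

Definition metric_trace x := \tr (P x *m g x).

(* On a line the squared norm of [v] is [\tr (P x *m g x)] times its Euclidean
   square, so the expansion factor is a continuous periodic function of [x]
   without any choice of a continuous unit section. *)
Definition stretch x := \tr (P x *m (jac f x *m g (f x) *m (jac f x)^T)) / metric_trace x.

Lemma metric_trace_gt0 x : 0 < metric_trace x.
Proof. by apply: line_proj_trace_gt0 => // v; exact: gpos. Qed.

Lemma metric_trace_cont : continuous metric_trace.
Proof. by apply: cont_trace; apply: cont_mulmx; [exact: Pl.1|exact: gm.1]. Qed.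

Lemma metric_trace_periodic x n : intvec n -> metric_trace (x + n) = metric_trace x.
Proof. by move=> ni; rewrite /metric_trace (Pl.2.1 x n ni) (gm.2.1 x n ni). Qed.

Lemma metric_inv_cont : continuous (fun x => (metric_trace x)^-1).
Proof.
by move=> x; apply: (cvgV (lt0r_neq0 (metric_trace_gt0 x)) (@metric_trace_cont x)).
Qed.

Lemma metric_bounds : exists m B : R, [/\ 0 < m, 0 < B &
  forall x v, inF P x v -> m * sq v <= quad (g x) v <= B * sq v].
Proof.
have [m' m0 hm] := periodic_gap (phi := fun x => - metric_trace x) (c := 0)
  (fun x => continuousN (metric_trace_cont (x:=x)))
  (fun x n ni => congr1 _ (metric_trace_periodic x ni))
  ltac:(by move=> x; rewrite oppr_lt0 metric_trace_gt0).
have [b' b0 hb] := periodic_gap (phi := fun x => - (metric_trace x)^-1) (c := 0)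
  (fun x => continuousN (metric_inv_cont (x:=x)))
  (fun x n ni => congr1 (fun a => - a^-1) (metric_trace_periodic x ni))
  ltac:(by move=> x; rewrite oppr_lt0 invr_gt0 metric_trace_gt0).
exists (- m'), ((- b')^-1); split; rewrite ?invr_gt0 ?oppr_gt0 // => x v xv.
have s0 : 0 <= sq v by apply: le_trans (sq_ge v); rewrite exprn_ge0.
rewrite (line_proj_quad _ (lp x) xv) -/(metric_trace x) !ler_wpM2r //; last first.
  by rewrite lerNl hm.
rewrite -[leLHS]invrK lef_pV2 ?posrE ?invr_gt0 ?metric_trace_gt0 ?oppr_gt0 //.
by rewrite lerNl hb.
Qed.

Lemma stretchE x v : inF P x v -> quad (g (f x)) ('d f x v) = stretch x * quad (g x) v.
Proof.
move=> xv; have e := jacE f x v.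
have -> : quad (g (f x)) ('d f x v) = quad (jac f x *m g (f x) *m (jac f x)^T) v.
  by rewrite -e /quad trmx_mul !mulmxA.
rewrite !(line_proj_quad _ (lp x) xv) /stretch -/(metric_trace x).
rewrite mulrA divfK // gt_eqF // metric_trace_gt0 //.
Qed.

Lemma stretch_cont : continuous stretch.
Proof.
apply: cont_mulr metric_inv_cont; apply: cont_trace; apply: cont_mulmx; first exact: Pl.1.
have df x : {for x, continuous f} by apply: differentiable_continuous; exact: fC.1.
apply: cont_mulmx; last by apply: cont_trmx; exact: jac_cont.
by apply: cont_mulmx; [exact: jac_cont|exact: cont_comp gm.1].
Qed.

Lemma stretch_periodic x n : intvec n -> stretch (x + n) = stretch x.
Proof.
move=> ni; have [k ki h] := fe ni.
rewrite /stretch (metric_trace_periodic x ni) (Pl.2.1 x n ni) (jac_periodic x fC.1 fe ni).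
by rewrite (h x) (gm.2.1 (f x) k ki).
Qed.

Lemma line_field_unit x : exists2 v, inF P x v & quad (g x) v = 1.
Proof.
have [p [p1 pP _]] := line_proj_unit (lp x).
have p0 : p != 0.
  by apply: contra_eq_neq p1 => ->; rewrite /sq mul0mx mxE eq_sym oner_eq0.
have q0 := gpos x p0.
exists ((Num.sqrt (quad (g x) p))^-1 *: p); first by rewrite /inF -scalemxAl pP.
by rewrite quadZ exprVn sqr_sqrtr ?mulVf ?gt_eqF // ltW.
Qed.

Lemma stretch_ge0 x : 0 <= stretch x.
Proof.
have [v xv v1] := line_field_unit x.
have := stretchE xv; rewrite v1 mulr1 => <-.
have [->|n0] := eqVneq ('d f x v) 0; last by rewrite ltW // gpos.
by rewrite /quad !mul0mx mxE.
Qed.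

Lemma stretch_upper c : 0 < c -> (forall x, stretch x < c ^+ 2) ->
  exists2 k, 0 < k < c & forall x, stretch x <= k ^+ 2.
Proof.
move=> c0 /(periodic_gap stretch_cont stretch_periodic)[k kc hk].
have k0 : 0 <= k by apply: le_trans (hk 0); exact: stretch_ge0.
(* [c / 2] keeps the bound positive even if [k] is 0, and below [c]. *)
pose k' := Num.max (Num.sqrt k) (c / 2).
have kk : Num.sqrt k <= k' by rewrite le_max lexx.
exists k' => [|x].
  rewrite lt_max divr_gt0 // orbT /= gt_max; apply/andP; split; last first.
    by rewrite ltr_pdivrMr // ltr_pMr // ltr1n.
  by rewrite -[ltRHS](gtr0_norm c0) -sqrtr_sqr ltr_sqrt // exprn_gt0.
apply: le_trans (hk x) _; rewrite -[leLHS]sqr_sqrtr //.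
by rewrite lerXn2r // nnegrE // (le_trans _ kk).
Qed.

Lemma stretch_lower c : 0 < c -> (forall x, c ^+ 2 < stretch x) ->
  exists2 k, c < k & forall x, k ^+ 2 <= stretch x.
Proof.
move=> c0 h.
have [k kc hk] := periodic_gap (phi := fun x => - stretch x) (c := - c ^+ 2)
  (fun x => continuousN (stretch_cont (x:=x)))
  (fun x n ni => congr1 _ (stretch_periodic x ni))
  ltac:(by move=> x; rewrite ltrN2).
have ck : c ^+ 2 < - k by rewrite ltrNr.
have k0 : 0 < - k by apply: lt_trans ck; rewrite exprn_gt0.
exists (Num.sqrt (- k)) => [|x].
  by rewrite -[ltLHS](gtr0_norm c0) -sqrtr_sqr ltr_sqrt.
by rewrite sqr_sqrtr ?(ltW k0) // lerNl.
Qed.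

Lemma rate_of_contraction q : 0 <= q -> iter_C1 f ->
  (forall x v, inF P x v -> inF P (f x) ('d f x v)) ->
  (forall x v, inF P x v -> quad (g (f x)) ('d f x v) <= q ^+ 2 * quad (g x) v) ->
  rate (inF P) f q.
Proof.
move=> q0 iC inv h.
have it n x v : inF P x v ->
    quad (g (iter n f x)) ('d (iter n f) x v) <= (q ^+ n) ^+ 2 * quad (g x) v.
  move=> xv; elim: n => [|n IH].
    by rewrite (_ : 'd (iter 0 f) x v = v) ?expr0 ?expr1n ?mul1r //; exact: diff_idE.
  have e : 'd (iter n.+1 f) x v = 'd f (iter n f x) ('d (iter n f) x v).
    by apply: diff_compE; [exact: (iC n).1|exact: fC.1].
  have k : quad (g (iter n.+1 f x)) ('d (iter n.+1 f) x v) <=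
      q ^+ 2 * quad (g (iter n f x)) ('d (iter n f) x v).
    have k0 := h _ _ (iter_invariant n iC inv xv).
    by apply: le_trans k0; rewrite le_eqVlt; apply/orP; left; apply/eqP; congr (quad _ _).
  apply: le_trans k _; rewrite [q ^+ n.+1]exprS exprMn -[leRHS]mulrA.
  by apply: ler_wpM2l IH; rewrite exprn_ge0.
have [m [B [m0 B0 hB]]] := metric_bounds.
have C0 : 0 <= 3 * B / m + 1 by rewrite addr_ge0 // divr_ge0 ?(ltW m0) // mulr_ge0 // ltW.
(* The comparison of norms yields the square root of [3 * B / m]; adding 1 gives a number whose
   square is larger than [3 * B / m], so no root has to be taken. *)
exists (3 * B / m + 1) => // n x v xv.
rewrite -(ler_pXn2r (n := 2)) ?nnegrE ?mulr_ge0 ?exprn_ge0 //.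
apply: le_trans (sq_ge _) _; rewrite !exprMn -(ler_pM2l m0).
have /andP[h1 _] := hB _ _ (iter_invariant n iC inv xv).
apply: le_trans h1 _; apply: le_trans (it n x v xv) _.
have /andP[_ h2] := hB _ _ xv.
have h3 : quad (g x) v <= B * (3 * `|v| ^+ 2).
  by apply: le_trans h2 _; rewrite ler_wpM2l ?(ltW B0) // sq_le.
apply: le_trans (_ : (q ^+ n) ^+ 2 * (B * (3 * `|v| ^+ 2)) <= _).
  by rewrite ler_wpM2l // exprn_ge0 // exprn_ge0.
rewrite [leRHS](_ : _ = (q ^+ n) ^+ 2 * (m * (3 * B / m + 1) ^+ 2 * `|v| ^+ 2)); last by ring.
rewrite ler_wpM2l ?exprn_ge0 // mulrA ler_wpM2r ?exprn_ge0 //.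
have e : 3 * B = m * (3 * B / m) by rewrite [RHS]mulrC divfK // gt_eqF.
rewrite [leLHS]mulrC {1}e -mulrA ler_pM2l //.
have : 0 <= 3 * B / m by rewrite divr_ge0 ?(ltW m0) // mulr_ge0 // ltW.
move: (3 * B / m) => a a0; nra.
Qed.

End Metric.
End Stretch.

(** * Angles between transverse line fields *)

Section Angles.
Variable R : realType.
Local Notation V := 'rV[R]_3.

Lemma trmx_comb (a b : R) (p q : V) : (a *: p + b *: q)^T = a *: p^T + b *: q^T.
Proof. by apply/matrixP => i j; rewrite !mxE. Qed.

(* [\tr (P *m Q)] is the squared cosine of the angle between the two lines. *)
Lemma transverse_trace (P Q S : 'M[R]_3) : line_proj P -> line_proj Q -> line_proj S ->
  (forall v : V, exists a b c : V, [/\ a *m P = a, b *m Q = b, c *m S = c & v = a + b + c]) ->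
  \tr (P *m Q) < 1.
Proof.
move=> lP lQ lS span.
have [p [p1 pP PE]] := line_proj_unit lP.
have [q [q1 qQ QE]] := line_proj_unit lQ.
have [s [s1 sS SE]] := line_proj_unit lS.
pose c := (p *m q^T) ord0 ord0.
have pq : p *m q^T = c%:M by rewrite [LHS]mx11_scalar.
have qp : q *m p^T = c%:M by rewrite -[LHS]trmxK trmx_mul trmxK pq tr_scalar_mx.
have qq : q *m q^T = 1%:M by rewrite [LHS]mx11_scalar -/(sq q) q1.
have trE : \tr (P *m Q) = c ^+ 2.
  have := line_proj_quad Q lP pP; rewrite p1 mulr1 => <-.
  rewrite /quad QE mulmxA pq mul_scalar_mx -scalemxAl qp.
  by rewrite scale_scalar_mx mxE mulr1n expr2.
rewrite trE ltNge; apply/negP => c1.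
have pcq : p = c *: q.
  apply/eqP; rewrite -subr_eq0; apply/eqP; apply/eqP/negPn/negP => /sq_gt0.
  have -> : sq (p - c *: q) = ((p - c *: q) *m (p^T - c *: q^T)) ord0 ord0.
    have tB : (p - c *: q)^T = p^T - c *: q^T by apply/matrixP => i j; rewrite !mxE.
    by rewrite /sq tB.
  rewrite mulmxBl !mulmxBr -!scalemxAl -!scalemxAr pq qp qq.
  have -> : p *m p^T = 1%:M by rewrite [LHS]mx11_scalar -/(sq p) p1.
  by rewrite !scale_scalar_mx -!raddfB mxE mulr1n; lra.
have K0 : kermx (row_mx q^T s^T) != 0.
  rewrite -mxrank_eq0 mxrank_ker -lt0n subn_gt0.
  by apply: leq_ltn_trans (rank_leq_col _) _.
pose v : V := nz_row (kermx (row_mx q^T s^T)).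
have v0 : v != 0 by rewrite nz_row_eq0.
have : v *m row_mx q^T s^T = 0 by apply/sub_kermxP; exact: nz_row_sub.
rewrite mul_mx_row -[0]row_mx0 => /eq_row_mx[vq vs].
have [a [b [d [aP bQ dS vE]]]] := span v.
have [ka aE] := line_proj_span PE aP.
have [kb bE] := line_proj_span QE bQ.
have [kd dE] := line_proj_span SE dS.
have := sq_gt0 v0.
have -> : sq v = (v *m (ka *: (c *: q^T) + kb *: q^T + kd *: s^T)) ord0 ord0.
  have vT : v^T = ka *: (c *: q^T) + kb *: q^T + kd *: s^T.
    by rewrite vE aE bE dE pcq; apply/matrixP => i j; rewrite !mxE.
  by rewrite /sq vT.
by rewrite !mulmxDr -!scalemxAr vq vs !scaler0 !addr0 mxE ltxx.
Qed.

(** [1 - t] bounds the squared sine of the angle from below, and [a + b] is at least as long as [a]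
    times the sine. The factor 3 compares Euclidean and maximum norms, and the added 1 spares a
    square root. *)
Lemma line_field_angle (P Q : V -> 'M[R]_3) : line_field P -> line_field Q ->
  (forall x, \tr (P x *m Q x) < 1) ->
  exists2 K : R, 0 <= K & forall x a b, inF P x a -> inF Q x b -> `|a| <= K * `|a + b|.
Proof.
move=> Pl Ql tr1.
have [||t t1 ht] := periodic_gap (phi := fun x => \tr (P x *m Q x)) (c := 1) _ _ tr1.
- by apply: cont_trace; apply: cont_mulmx; [exact: Pl.1|exact: Ql.1].
- by move=> x n ni; rewrite (Pl.2.1 x n ni) (Ql.2.1 x n ni).
have t0 : 0 < 1 - t by lra.
have K0 : 0 <= 3 / (1 - t) by rewrite divr_ge0 // ltW.
exists (3 / (1 - t) + 1) => [|x a b aP bQ]; first by rewrite addr_ge0.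
have [p [p1 pP PE]] := line_proj_unit (Pl.2.2 x).
have [q [q1 qQ QE]] := line_proj_unit (Ql.2.2 x).
pose c := (p *m q^T) ord0 ord0.
have pq : p *m q^T = c%:M by rewrite [LHS]mx11_scalar.
have qp : q *m p^T = c%:M by rewrite -[LHS]trmxK trmx_mul trmxK pq tr_scalar_mx.
have pp : p *m p^T = 1%:M by rewrite [LHS]mx11_scalar -/(sq p) p1.
have qq : q *m q^T = 1%:M by rewrite [LHS]mx11_scalar -/(sq q) q1.
have ct : c ^+ 2 <= t.
  have := ht x; have := line_proj_quad (Q x) (Pl.2.2 x) pP; rewrite p1 mulr1 => <-.
  rewrite /quad QE mulmxA pq mul_scalar_mx -scalemxAl qp.
  by rewrite scale_scalar_mx mxE mulr1n expr2.
have [ka aE] := line_proj_span PE aP.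
have [kb bE] := line_proj_span QE bQ.
have sE : sq (a + b) = ka ^+ 2 + kb ^+ 2 + 2 * ka * kb * c.
  have -> : sq (a + b) = ((ka *: p + kb *: q) *m (ka *: p^T + kb *: q^T)) ord0 ord0.
    by rewrite /sq aE bE trmx_comb.
  rewrite mulmxDl !mulmxDr -!scalemxAl -!scalemxAr.
  rewrite pp pq qp qq !scale_scalar_mx -!raddfD /= mxE mulr1n; ring.
have h1 : (1 - t) * ka ^+ 2 <= sq (a + b).
  rewrite sE; have := sqr_ge0 (kb + c * ka); have := sqr_ge0 ka; nra.
have h2 : `|a| ^+ 2 <= ka ^+ 2.
  by apply: le_trans (sq_ge _) _; rewrite aE sqZ p1 mulr1.
have h3 : `|a| ^+ 2 <= 3 / (1 - t) * `|a + b| ^+ 2.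
  rewrite mulrAC ler_pdivlMr // mulrC; apply: le_trans (sq_le _); apply: le_trans h1.
  by rewrite ler_pM2l.
rewrite -(ler_pXn2r (n := 2)) ?nnegrE ?mulr_ge0 ?addr_ge0 //.
apply: le_trans h3 _; rewrite exprMn ler_wpM2r ?exprn_ge0 //.
move: (3 / (1 - t)) K0 => k k0; nra.
Qed.

Lemma rate_weaken (E : V -> set V) f q q' : 0 <= q <= q' -> rate E f q -> rate E f q'.
Proof.
move=> /andP[q0 qq] [C C0 h]; exists C => // n x v xv; apply: le_trans (h n x v xv) _.
have qn : q ^+ n <= q' ^+ n by rewrite lerXn2r ?nnegrE // (le_trans q0).
by rewrite ler_wpM2r // ler_wpM2l.
Qed.

(** The span condition with the third line makes the lines of [P] and [Q] transverse, so splitting a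
    vector of their sum costs only a uniform factor. *)
Lemma rate_sum (P Q S : V -> 'M[R]_3) f q : 0 <= q ->
  line_field P -> line_field Q -> line_field S ->
  (forall x v, exists a b c, [/\ inF P x a, inF Q x b, inF S x c & v = a + b + c]) ->
  rate (inF P) f q -> rate (inF Q) f q -> rate (sumF (inF P) (inF Q)) f q.
Proof.
move=> q0 Pl Ql Sl span [C C0 hC] [D D0 hD].
have tPQ x : \tr (P x *m Q x) < 1.
  exact: (transverse_trace (Pl.2.2 x) (Ql.2.2 x) (Sl.2.2 x) (span x)).
have tQP x : \tr (Q x *m P x) < 1 by rewrite mxtrace_mulC.
have [K K0 hK] := line_field_angle Pl Ql tPQ.
have [L L0 hL] := line_field_angle Ql Pl tQP.
exists (C * K + D * L) => [|n x v [a [b [aP [bQ ->]]]]].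
  by rewrite addr_ge0 // mulr_ge0.
have -> : 'd (iter n f) x (a + b) = 'd (iter n f) x a + 'd (iter n f) x b by exact: linearD.
apply: le_trans (ler_normD _ _) _.
have qn : 0 <= q ^+ n by rewrite exprn_ge0.
have h1 : C * q ^+ n * `|a| <= C * q ^+ n * (K * `|a + b|).
  by rewrite ler_wpM2l ?mulr_ge0 // (hK x).
have h2 : D * q ^+ n * `|b| <= D * q ^+ n * (L * `|a + b|).
  by rewrite ler_wpM2l ?mulr_ge0 // addrC (hL x).
apply: le_trans (lerD (hC n x a aP) (hD n x b bQ)) _.
apply: le_trans (lerD h1 h2) _; rewrite le_eqVlt; apply/orP; left; apply/eqP; ring.
Qed.

(** ['d f] is injective and maps a line into a line, hence onto it; the inverse differential maps it
    back. *)
Lemma inverse_invariant (P : V -> 'M[R]_3) (f fi : V -> V) : line_field P ->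
  cancel f fi -> cancel fi f -> C1 f -> C1 fi ->
  (forall x v, inF P x v -> inF P (f x) ('d f x v)) ->
  forall x v, inF P x v -> inF P (fi x) ('d fi x v).
Proof.
move=> Pl ffi fif [df _] [dfi _] inv x v xv.
have [p [p1 pP PE]] := line_proj_unit (Pl.2.2 (fi x)).
have h1 : inF P x ('d f (fi x) p) by rewrite -{1}(fif x); exact: inv.
have e1 : 'd fi x ('d f (fi x) p) = p.
  by have := diff_cancel p ffi (df (fi x)) (dfi _); rewrite fif.
have [w [w1 wP WE]] := line_proj_unit (Pl.2.2 x).
have [a aE] := line_proj_span WE xv.
have [b bE] := line_proj_span WE h1.
have e2 : p = b *: 'd fi x w.
  by apply: etrans (esym e1) (etrans (congr1 _ bE) _); exact: linearZ.
have -> : 'd fi x v = a *: 'd fi x w.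
  by apply: etrans (congr1 _ aE) _; exact: linearZ.
move: ('d fi x w) e2 => W e2.
have b0 : b != 0.
  apply: contra_eq_neq p1 => b0.
  by rewrite e2 b0 scale0r /sq mul0mx mxE eq_sym oner_eq0.
have -> : a *: W = (a / b) *: p by rewrite e2 scalerA divfK.
by rewrite /inF -scalemxAl pP.
Qed.

End Angles.

(** * Rates from absolute partial hyperbolicity *)

Section Domination.
Variable R : realType.
Local Notation V := 'rV[R]_3.

(** [kcs * qu < 1] says that center-stable growth under [F] is slower than unstable growth, and
    [kcu * qs < 1] is the same for [Fi]. The bounds [kcs] and [kcu] are at least 1, as the additive
    error in [functional_zero] requires. *)
Definition dominated (F Fi : V -> V) (Ps Pc Pu : V -> 'M[R]_3) :=
  exists qs qu kcs kcu : R,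
  [/\ 0 < qs < 1, 0 < qu < 1, 1 <= kcs /\ 1 <= kcu & kcs * qu < 1 /\ kcu * qs < 1] /\
  [/\ rate (inF Ps) F qs, rate (inF Pu) Fi qu,
      rate (sumF (inF Pc) (inF Ps)) F kcs & rate (sumF (inF Pc) (inF Pu)) Fi kcu].

Lemma stretch_inverse (g : V -> 'M[R]_3) (F Fi : V -> V) (P : V -> 'M[R]_3) (k : R) :
  riem_metric g -> line_field P -> cancel F Fi -> cancel Fi F -> C1 F -> C1 Fi ->
  (forall x v, inF P x v -> inF P (F x) ('d F x v)) -> 0 < k ->
  (forall x, k ^+ 2 <= stretch g F P x) -> rate (inF P) Fi k^-1.
Proof.
move=> gm Pl FFi FiF FC FiC inv k0 hk.
have inv' := inverse_invariant Pl FFi FiF FC FiC inv.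
have k'0 : 0 <= k^-1 by rewrite invr_ge0 ltW.
apply: (rate_of_contraction gm FiC Pl k'0 (C1_iter FiC) inv') => x v xv.
have xw := inv' x v xv.
have e : 'd F (Fi x) ('d Fi x v) = v by exact: diff_cancel FiF (FiC.1 x) (FC.1 (Fi x)).
have -> : quad (g x) v = stretch g F P (Fi x) * quad (g (Fi x)) ('d Fi x v).
  apply: etrans (stretchE F gm Pl xw); apply: (congr2 (@quad R) _ (esym e)).
  by congr g; exact: esym (FiF x).
have h := hk (Fi x).
have q0 : 0 <= quad (g (Fi x)) ('d Fi x v).
  have [m [B [m0 _ hB]]] := metric_bounds gm Pl.
  have /andP[+ _] := hB _ _ xw; apply: le_trans; rewrite mulr_ge0 ?(ltW m0) //.
  by apply: le_trans (sq_ge _); rewrite exprn_ge0.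
rewrite mulrA exprVn ler_peMl // mulrC ler_pdivlMr ?exprn_gt0 // mul1r //.
Qed.

(** [sig] and [mu^-1] themselves are rates on the stable and unstable lines. On the center line
    compactness improves the strict inequalities to [k < mu] and [k2 > sig]; raising [k] and [k2^-1]
    to at least 1 keeps both products below 1 because [sig < 1 < mu]. *)
Lemma abs_PH_dominated (g : V -> 'M[R]_3) (F Fi : V -> V) (Ps Pc Pu : V -> 'M[R]_3) :
  riem_metric g -> cancel F Fi -> cancel Fi F -> C1 F -> C1 Fi ->
  int_equivariant F -> abs_PH g F Ps Pc Pu ->
  dominated F Fi Ps Pc Pu.
Proof.
move=> gm FFi FiF FC FiC Fe [[sl [cl ul]] span [si [ci ui]] [sig [mu [/andP[s1 m1] ineq]]]].
have gn P (Pl : line_field P) x v : inF P x v -> quad (g x) v = 1 ->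
    stretch g F P x = Defs.gnorm g (F x) ('d F x v) ^+ 2 /\ Defs.gnorm g x v = 1.
  move=> xv v1; split; last by rewrite /Defs.gnorm -/(quad _ _) v1 sqrtr1.
  have e := stretchE F gm Pl xv; rewrite v1 mulr1 in e.
  rewrite /Defs.gnorm -/(quad _ _) e sqr_sqrtr //; exact: (stretch_ge0 F gm Pl).
have all x : [/\ 0 < sig, stretch g F Ps x < sig ^+ 2, sig ^+ 2 < stretch g F Pc x,
    stretch g F Pc x < mu ^+ 2 & mu ^+ 2 < stretch g F Pu x].
  have [vs xs s1'] := line_field_unit gm sl x.
  have [vc xc c1'] := line_field_unit gm cl x.
  have [vu xu u1'] := line_field_unit gm ul x.
  have [-> sn] := gn _ sl _ _ xs s1'; have [-> cn] := gn _ cl _ _ xc c1'.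
  have [-> un] := gn _ ul _ _ xu u1'.
  have [h1 h2 h3 h4] := ineq x vs vc vu xs xc xu sn cn un.
  have p y w : 0 <= Defs.gnorm g y w by exact: sqrtr_ge0.
  have sig0 : 0 < sig by apply: le_lt_trans h1.
  have mu0 : 0 < mu by lra.
  by split; rewrite // ltr_pXn2r ?nnegrE // ltW.
have sig0 : 0 < sig by case: (all 0).
have mu0 : 0 < mu by lra.
have [x|k /andP[k0 kmu] hk] := stretch_upper gm FC Fe cl mu0.
  by case: (all x).
have [x|k2 ksig hk2] := stretch_lower gm FC Fe cl sig0.
  by case: (all x).
have rate_le P (Pl : line_field P) c : 0 <= c ->
    (forall x v, inF P x v -> inF P (F x) ('d F x v)) ->
    (forall x, stretch g F P x <= c ^+ 2) -> rate (inF P) F c.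
  move=> c0 inv h; apply: (rate_of_contraction gm FC Pl c0 (C1_iter FC) inv) => x v xv.
  rewrite (stretchE F gm Pl xv); apply: ler_wpM2r (h x).
  have [m [B [m0 _ hB]]] := metric_bounds gm Pl.
  have /andP[+ _] := hB _ _ xv; apply: le_trans; rewrite mulr_ge0 ?(ltW m0) //.
  by apply: le_trans (sq_ge _); rewrite exprn_ge0.
have rs : rate (inF Ps) F sig.
  by apply: (rate_le _ sl _ (ltW sig0) si) => x; case: (all x) => _ /ltW.
have rc : rate (inF Pc) F k := rate_le _ cl _ (ltW k0) ci hk.
have ru : rate (inF Pu) Fi mu^-1.
  apply: (stretch_inverse gm ul FFi FiF FC FiC ui mu0) => x.
  by case: (all x) => _ _ _ _ /ltW.
have k20 : 0 < k2 by apply: lt_trans ksig.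
have rci : rate (inF Pc) Fi k2^-1 by exact: (stretch_inverse gm cl FFi FiF FC FiC ci k20 hk2).
have mu1 : 0 < mu^-1 < 1 by rewrite invr_gt0 mu0 invf_lt1.
exists sig, mu^-1, (Num.max k 1), (Num.max k2^-1 1); split; first split=> //.
- by rewrite sig0.
- by rewrite !le_max !lexx !orbT.
- rewrite ltr_pdivrMr // mul1r gt_max kmu m1; split=> //.
  rewrite -ltr_pdivlMr // mul1r gt_max ltf_pV2 ?posrE // ksig.
  by rewrite -[1]invr1 ltf_pV2 ?posrE ?ltr01.
split=> //.
- apply: (rate_sum (S := Pu)) => //; first by rewrite le_max ler01 orbT.
  + move=> x v; have [a [b [c [h1 [h2 [h3 ->]]]]]] := span x v.
    by exists b, a, c; split=> //; rewrite [b + a]addrC.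
  + by apply: rate_weaken rc; rewrite (ltW k0) le_max lexx.
  by apply: rate_weaken rs; rewrite (ltW sig0) le_max (ltW s1) orbT.
apply: (rate_sum (S := Ps)) => //; first by rewrite le_max ler01 orbT.
- move=> x v; have [a [b [c [h1 [h2 [h3 ->]]]]]] := span x v.
  by exists b, c, a; split=> //; rewrite -addrA addrC.
- by apply: rate_weaken rci; rewrite invr_ge0 (ltW k20) le_max lexx.
by apply: rate_weaken ru; case/andP: mu1 => /ltW -> /ltW h; rewrite le_max h orbT.
Qed.

End Domination.

(** * Assembly *)

Section Assembly.
Variable R : realType.
Local Notation V := 'rV[R]_3.

Lemma sumFC (E1 E2 : V -> set V) : sumF E1 E2 = sumF E2 E1.
Proof.
apply/funext => x; apply/funext => v; apply/propext.
by split=> -[a [b [h1 [h2 ->]]]]; exists b, a; rewrite addrC.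
Qed.

Definition line_onto (e : V) : 'M[R]_3 := (sq e)^-1 *: (e^T *m e).

Lemma line_onto_fix e v : e != 0 -> v *m line_onto e = v <-> exists k, v = k *: e.
Proof.
move=> /sq_gt0 e0; rewrite /line_onto; split=> [<-|[k ->]].
  exists ((v *m ((sq e)^-1 *: e^T)) ord0 ord0).
  by rewrite scalemxAl mulmxA {1}[v *m _]mx11_scalar mul_scalar_mx.
rewrite -scalemxAr -scalemxAl mulmxA [e *m e^T]mx11_scalar mul_scalar_mx.
by rewrite -/(sq e) !scalerA mulrAC mulVf ?mul1r // gt_eqF.
Qed.

Lemma line_onto_field e : e != 0 -> line_field (fun _ => line_onto e).
Proof.
move=> e0; split; first by move=> x; exact: cst_continuous.
split=> // _; have ee : e *m line_onto e = e by apply/line_onto_fix => //; exists 1; rewrite scale1r.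
split; first by rewrite /line_onto linearZ /= trmx_mul trmxK.
split; first by rewrite {1}/line_onto -scalemxAl -mulmxA ee.
apply/eqP; rewrite eqn_leq; apply/andP; split.
  rewrite /line_onto scalemxAl; apply: leq_trans (mxrankM_maxr _ _) _.
  exact: rank_leq_row.
rewrite lt0n mxrank_eq0; apply: contra e0 => /eqP h.
by rewrite -ee h mulmx0.
Qed.

Lemma diff_Alin (M : 'M[int]_3) x v : 'd (@Alin R M) x v = Alin M v.
Proof.
pose f : {linear V -> V} := mulmxr (map_mx (fun a : int => a%:~R) M).
have fc : continuous f by exact: mulmx_continuous.
exact: (congr1 (fun u : V -> V => u v) (diff_lin x fc)).
Qed.

Lemma span1_leaf (e : V) (W : V -> chart R 1) (H K : V -> V) : e != 0 -> cancel K H ->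
  (forall x y, leaf W x y <-> exists s, H y - H x = s *: e) ->
  maps_leaves H (leaf W) (linleaf (inF (fun _ => line_onto e))).
Proof.
move=> e0 KH h; apply: (maps_leaves_of KH) => // x y.
by rewrite h; apply: iff_sym; exact: line_onto_fix.
Qed.

Lemma span2_leaf (e f : V) (W : V -> chart R 2) (H K : V -> V) :
  e != 0 -> f != 0 -> cancel K H ->
  (forall x y, leaf W x y <-> exists a b, H y - H x = a *: e + b *: f) ->
  maps_leaves H (leaf W)
    (linleaf (sumF (inF (fun _ => line_onto e)) (inF (fun _ => line_onto f)))).
Proof.
move=> e0 f0 KH h; apply: (maps_leaves_of KH) => // x y; rewrite h; split.
  move=> [a [b ->]]; exists (a *: e), (b *: f).
  by split; [|split=> //]; apply/line_onto_fix => //; [exists a|exists b].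
by move=> [v [w [/(line_onto_fix _ e0)[a ->] [/(line_onto_fix _ f0)[b ->] ->]]]]; exists a, b.
Qed.

Lemma splitting_conclusion (M : 'M[int]_3) (H K : V -> V)
    (Ws Wc Wu : V -> chart R 1) (Wcs Wcu Wus : V -> chart R 2) : cancel K H ->
  adapted_splitting H (map_mx (fun a : int => a%:~R) M) Ws Wc Wu Wcs Wcu Wus ->
  exists (gA : V -> 'M[R]_3) (Qs Qc Qu : V -> 'M[R]_3),
    [/\ riem_metric gA, constant_field Qs, constant_field Qc,
        constant_field Qu & abs_PH gA (Alin M) Qs Qc Qu] /\
    [/\ maps_leaves H (leaf Ws) (linleaf (inF Qs)),
        maps_leaves H (leaf Wc) (linleaf (inF Qc)) &
        maps_leaves H (leaf Wu) (linleaf (inF Qu))] /\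
    [/\
        maps_leaves H (leaf Wcs) (linleaf (sumF (inF Qc) (inF Qs))),
        maps_leaves H (leaf Wcu) (linleaf (sumF (inF Qc) (inF Qu))) &
        maps_leaves H (leaf Wus) (linleaf (sumF (inF Qu) (inF Qs)))].
Proof.
move=> KH [es [ec [eu [ls [lc [lu [[Es Ec Eu] ind [sc cu s1 u1] [Ls Lc Lu] [Lcs Lcu Lus]]]]]]]].
have [es0 ec0 eu0] : [/\ es != 0, ec != 0 & eu != 0].
  split; apply/eqP => e0.
  - by have [/eqP] := ind 1 0 0 ltac:(by rewrite e0 !scale0r scaler0 !addr0); rewrite oner_eq0.
  - by have [_ /eqP] := ind 0 1 0 ltac:(by rewrite e0 !scale0r scaler0 !addr0); rewrite oner_eq0.
  by have [_ _ /eqP] := ind 0 0 1 ltac:(by rewrite e0 !scale0r scaler0 !addr0); rewrite oner_eq0.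
have [fs [fc [fu dec]]] := basis3_coord ind.
(* The metric in which the eigenbasis is orthonormal, so that [A] stretches each eigenline by
   exactly the modulus of its eigenvalue. *)
pose gA : 'M[R]_3 := fs *m fs^T + fc *m fc^T + fu *m fu^T.
have gAE v : quad gA v = (v *m fs) ord0 ord0 ^+ 2 + (v *m fc) ord0 ord0 ^+ 2
    + (v *m fu) ord0 ord0 ^+ 2.
  rewrite /quad /gA !mulmxDr !mulmxDl !mulmxA.
  have sq1 (f : 'cV[R]_3) : v *m f *m f^T *m v^T = ((v *m f) ord0 ord0 ^+ 2)%:M.
    rewrite -mulmxA -trmx_mul; move: (v *m f) => a.
    by rewrite {1 2}[a]mx11_scalar tr_scalar_mx -scalar_mxM expr2.
  by rewrite !sq1 -!raddfD /= mxE mulr1n.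
have dual (x y t : R) (v := x *: es + y *: ec + t *: eu) :
    [/\ (v *m fs) ord0 ord0 = x, (v *m fc) ord0 ord0 = y & (v *m fu) ord0 ord0 = t].
  have := dec v; move: (v *m fs) (v *m fc) (v *m fu) => a b c; rewrite {}/v.
  move=> e; have [|h1 h2 h3] := ind (a ord0 ord0 - x) (b ord0 ord0 - y) (c ord0 ord0 - t).
    by rewrite !scalerBl (addrACA (_ *: es)) -opprD addrACA -opprD -e subrr.
  by split; apply/eqP; rewrite -subr_eq0 ?h1 ?h2 ?h3.
have qs k : quad gA (k *: es) = k ^+ 2.
  have [] := dual k 0 0; rewrite !scale0r !addr0 gAE => -> -> ->; ring.
have qc k : quad gA (k *: ec) = k ^+ 2.
  have [] := dual 0 k 0; rewrite !scale0r add0r !addr0 gAE => -> -> ->; ring.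
have qu k : quad gA (k *: eu) = k ^+ 2.
  have [] := dual 0 0 k; rewrite !scale0r !add0r gAE => -> -> ->; ring.
exists (fun _ => gA), (fun _ => line_onto es), (fun _ => line_onto ec), (fun _ => line_onto eu).
split; last first.
  split; split; [exact: span1_leaf Ls|exact: span1_leaf Lc|exact: span1_leaf Lu|
    exact: span2_leaf Lcs|exact: span2_leaf Lcu|exact: span2_leaf Lus].
split=> //.
  split; first by move=> x; exact: cst_continuous.
  split=> // _; split; first by rewrite /gA !linearD /= !trmx_mul !trmxK.
  move=> v v0; rewrite -/(quad _ _) lt_neqAle; apply/andP; split; last first.
    by rewrite gAE !addr_ge0 ?sqr_ge0.
  apply: contra v0 => /eqP; rewrite gAE => z.
  have p0 := sqr_ge0 ((v *m fs) ord0 ord0); have p1 := sqr_ge0 ((v *m fc) ord0 ord0).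
  have p2 := sqr_ge0 ((v *m fu) ord0 ord0).
  have z0 : (v *m fs) ord0 ord0 = 0 by apply/eqP; rewrite -sqrf_eq0; apply/eqP; lra.
  have z1 : (v *m fc) ord0 ord0 = 0 by apply/eqP; rewrite -sqrf_eq0; apply/eqP; lra.
  have z2 : (v *m fu) ord0 ord0 = 0 by apply/eqP; rewrite -sqrf_eq0; apply/eqP; lra.
  by rewrite (dec v) z0 z1 z2 !scale0r !addr0.
have inv e l (x v : V) : e != 0 -> e *m map_mx (fun a : int => a%:~R) M = l *: e ->
    inF (fun _ => line_onto e) x v -> inF (fun _ => line_onto e) (Alin M x) ('d (@Alin R M) x v).
  move=> e0 El /(line_onto_fix _ e0)[k ->]; rewrite diff_Alin.
  by apply/(line_onto_fix _ e0); exists (k * l); rewrite /Alin -scalemxAl El scalerA.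
split; first by split; [|split]; exact: line_onto_field.
- move=> x v; exists ((v *m fs) ord0 ord0 *: es), ((v *m fc) ord0 ord0 *: ec),
    ((v *m fu) ord0 ord0 *: eu).
  split; first by apply/line_onto_fix => //; eexists.
  split; first by apply/line_onto_fix => //; eexists.
  by split; [apply/line_onto_fix => //; eexists|exact: dec].
- by split; [|split]=> x v; [apply: inv Es|apply: inv Ec|apply: inv Eu].
(* The center eigenvalue may lie on either side of 1, while the constants have to separate both 1
   and its modulus from the other two moduli; midpoints of the resulting gaps are taken. *)
pose a := Num.min `|lc| 1; pose b := Num.max `|lc| 1.
have sa : `|ls| < a by rewrite lt_min sc.
have bu : b < `|lu| by rewrite gt_max cu.
have ac : a <= `|lc| by rewrite ge_min lexx.
have a1 : a <= 1 by rewrite ge_min lexx orbT.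
have cb : `|lc| <= b by rewrite le_max lexx.
have b1 : 1 <= b by rewrite le_max lexx orbT.
exists ((`|ls| + a) / 2), ((b + `|lu|) / 2); split; first by apply/andP; split; lra.
have gn e l k x : (forall k, quad gA (k *: e) = k ^+ 2) ->
    e *m map_mx (fun a : int => a%:~R) M = l *: e ->
    Defs.gnorm (fun _ => gA) x (k *: e) = 1 ->
    Defs.gnorm (fun _ => gA) (Alin M x) ('d (@Alin R M) x (k *: e)) = `|l|.
  move=> qe El; rewrite diff_Alin /Defs.gnorm -!/(quad _ _) /Alin -scalemxAl El scalerA.
  by rewrite !qe !sqrtr_sqr normrM => ->; rewrite mul1r.
move=> x vs vc vu /(line_onto_fix _ es0)[ks ->] /(line_onto_fix _ ec0)[kc ->].
move=> /(line_onto_fix _ eu0)[ku ->] ns nc nu.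
by rewrite (gn _ _ _ _ qs Es ns) (gn _ _ _ _ qc Ec nc) (gn _ _ _ _ qu Eu nu); split; lra.
Qed.

(** Inverse eigenvalues reverse the order of the moduli, which matches the exchange of s and u; the
    eigenvectors and the images of the leaves are unchanged. *)
Lemma adapted_splitting_inverse (A : 'M[R]_3) (H : V -> V)
    (Ws Wc Wu : V -> chart R 1) (Wcs Wcu Wus : V -> chart R 2) : A \in unitmx ->
  adapted_splitting H (invmx A) Wu Wc Ws Wcu Wcs Wus ->
  adapted_splitting H A Ws Wc Wu Wcs Wcu Wus.
Proof.
move=> Au [eu [ec [es [lu [lc [ls [[Eu Ec Es] ind [uc cs u1 s1] [Lu Lc Ls] [Lcu Lcs Lus]]]]]]]].
have inv (e : V) l : l != 0 -> e *m invmx A = l *: e -> e *m A = l^-1 *: e.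
  move=> l0 El; apply: (scalerI l0); rewrite scalerA mulfV // scale1r scalemxAl -El.
  by rewrite mulmxKV.
have lu0 : lu != 0.
  apply/eqP => l0; have e0 : eu = 0.
    by rewrite -[eu](mulmxKV Au) Eu l0 scale0r mul0mx.
  have [/eqP] := ind 1 0 0 ltac:(by rewrite e0 !scale0r scaler0 !addr0).
  by rewrite oner_eq0.
have lu1 : 0 < `|lu| by rewrite normr_gt0.
have lc1 : 0 < `|lc| by apply: lt_trans uc.
have ls1 : 0 < `|ls| by apply: lt_trans cs.
have lc0 : lc != 0 by rewrite -normr_gt0.
have ls0 : ls != 0 by rewrite -normr_gt0.
exists es, ec, eu, ls^-1, lc^-1, lu^-1; split.
- by split; exact: inv.
- by move=> x y t e; have [|-> -> ->] := ind t y x; rewrite // -e addrC addrA addrAC addrC addrA.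
- rewrite !normfV; split.
  + by rewrite ltf_pV2.
  + by rewrite ltf_pV2.
  + by rewrite invf_lt1.
  by rewrite invf_gt1.
- by [].
split=> // x y; rewrite Lus; split=> -[a [b ->]]; exists b, a; exact: addrC.
Qed.

Lemma invmx_int (M : 'M[int]_3) (v : V) : \det M = 1 \/ \det M = -1 ->
  intvec v -> intvec (v *m invmx (map_mx (fun a : int => a%:~R) M)).
Proof.
move=> dM vi; have Mu : M \in unitmx by rewrite unitmxE; case: dM => ->.
suff -> : invmx (map_mx (fun a : int => a%:~R) M) =
    map_mx (fun a : int => a%:~R : R) (invmx M) by exact: intvec_mul.
have e : map_mx (fun a : int => a%:~R : R) M *m map_mx (fun a : int => a%:~R) (invmx M) = 1%:M.
  by rewrite -map_mxM mulmxV // map_mx1.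
by rewrite -[LHS]mulmx1 -e mulKmx //; have [] := mulmx1_unit e.
Qed.

Lemma eigen_pair_neq0 (A : 'M[R]_3) r u z : A \in unitmx -> eigen_pair A r u z -> r != 0.
Proof.
move=> Au [uA _ uz]; apply/eqP => r0.
have : u *m z = 0 by rewrite -[u](mulmxK Au) uA r0 scale0r !mul0mx.
by rewrite uz => /matrixP/(_ ord0 ord0)/eqP; rewrite !mxE oner_eq0.
Qed.

Lemma eigen_pair_inverse (A : 'M[R]_3) r u z : A \in unitmx -> r != 0 ->
  eigen_pair A r u z -> eigen_pair (invmx A) r^-1 u z.
Proof.
move=> Au r0 [uA Az uz]; split=> //; apply: (scalerI r0);
  rewrite scalerA mulfV // scale1r.
  by rewrite scalemxAl -uA mulmxK.
by rewrite scalemxAr -Az mulKmx.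
Qed.

End Assembly.

Unset Implicit Arguments.
Local Close Scope classical_set_scope.

Theorem theorem6p1 (R : realType) (F : 'rV[R]_3 -> 'rV[R]_3)
  (g : 'rV[R]_3 -> 'M[R]_3) (Ps Pc Pu : 'rV[R]_3 -> 'M[R]_3)
  (Ws Wc Wu : 'rV[R]_3 -> chart R 1) (Wcs Wcu Wus : 'rV[R]_3 -> chart R 2)
  (M : 'M[int]_3) (H : 'rV[R]_3 -> 'rV[R]_3) :
  torus_diffeo F -> riem_metric g -> abs_PH g F Ps Pc Pu ->
  is_foliation (inF Ps) Ws -> f_invariant F (leaf Ws) ->
  is_foliation (inF Pc) Wc -> f_invariant F (leaf Wc) ->
  is_foliation (inF Pu) Wu -> f_invariant F (leaf Wu) ->
  is_foliation (sumF (inF Pc) (inF Ps)) Wcs -> f_invariant F (leaf Wcs) ->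
  is_foliation (sumF (inF Pc) (inF Pu)) Wcu -> f_invariant F (leaf Wcu) ->
  is_foliation (sumF (inF Pu) (inF Ps)) Wus ->
  hyperbolic_aut M -> torus_homeo H ->
  (forall x, torus_eq (H (F x)) (Alin M (H x))) ->
  exists (gA : 'rV[R]_3 -> 'M[R]_3) (Qs Qc Qu : 'rV[R]_3 -> 'M[R]_3),
    [/\ riem_metric gA, constant_field Qs, constant_field Qc,
        constant_field Qu & abs_PH gA (Alin M) Qs Qc Qu] /\
    [/\ maps_leaves H (leaf Ws) (linleaf (inF Qs)),
        maps_leaves H (leaf Wc) (linleaf (inF Qc)) &
        maps_leaves H (leaf Wu) (linleaf (inF Qu))] /\
    [/\
        maps_leaves H (leaf Wcs) (linleaf (sumF (inF Qc) (inF Qs))),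
        maps_leaves H (leaf Wcu) (linleaf (sumF (inF Qc) (inF Qu))) &
        maps_leaves H (leaf Wus) (linleaf (sumF (inF Qu) (inF Qs)))].
Proof.
move=> [Ft [FC [G [Gt [GC GF]]]]] gm ph Ws_f _ Wc_f _ Wu_f _ Wcs_f _ Wcu_f _ Wus_f.
move=> Mh [Ht [K0 [Kt HK0]]] semi.
have [m mi [FK FiK]] := torus_inverse Ft Gt GF.
have [k ki [HK KH]] := torus_inverse Ht Kt HK0.
have FiC := C1_sub m GC.
have HF := semiconj_diff Ft Ht semi.
have He := torus_map_equivariant Ht.
have Ke : int_equivariant (fun y => K0 y - k).
  move=> n ni; have [a ai h] := torus_map_equivariant Kt ni.
  by exists a => // x; rewrite h addrAC.
have Kc : continuous (fun y => K0 y - k) by exact: cont_comp Kt.1 (@cont_shift _ _ (- k)).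
have [[sl [cl ul]] _ [_ [ci _]] _] := ph.
have [qs [qu [kcs [kcu [[qs1 qu1 [cs1 cu1] [csu cus]] [rs ru rcs rcu]]]]]] :=
  abs_PH_dominated gm FK FiK FC FiC (torus_map_equivariant Ft) ph.
have [Au [r [u [z [iso alt]]]]] := hyperbolic_isolated R Mh.
apply: (splitting_conclusion KH).
case: alt => -[r1 con].
  have [uA Az uz] := iso.
  exact: (isolated_unstable_splitting FK FiK (C1_iter FC) (C1_iter FiC) HK KH Ht.1 Kc He Ke HF Au
    (fun v vi => intvec_mul M vi) sl cl ul ci qs1 qu1 cs1 cu1 csu cus rs ru rcs rcu
    Ws_f Wc_f Wu_f Wcs_f Wcu_f Wus_f uA Az uz r1 con).
have r0 : r != 0 := eigen_pair_neq0 Au iso.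
have [uA Az uz] := eigen_pair_inverse Au r0 iso.
apply: (adapted_splitting_inverse Au).
(* Exchanging s and u reverses the summands of the us-bundle. *)
rewrite sumFC in Wus_f.
have HFi x y : H (G x - m) - H (G y - m) = (H x - H y) *m invmx (map_mx (fun a : int => a%:~R) M).
  by have := HF (G x - m) (G y - m); rewrite !FiK => ->; rewrite mulmxK.
apply: (isolated_unstable_splitting FiK FK (C1_iter FiC) (C1_iter FC) HK KH Ht.1 Kc He Ke HFi _
    (fun v vi => invmx_int Mh.1 vi) ul cl sl (inverse_invariant cl FK FiK FC FiC ci)
    qu1 qs1 cu1 cs1 cus csu ru rs rcu rcs
    Wu_f Wc_f Ws_f Wcu_f Wcs_f Wus_f uA Az uz _ con).
  by rewrite unitmx_inv.
by rewrite normfV invf_gt1 // normr_gt0.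
Qed.
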